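(* Let $(\mathfrak{A},\mathsf{L},\mathfrak{M})$ be a Lipschitz triple. Then a tame subset of $\mathscr{S}(\mathfrak{A})$ is tight. In particular, the weak* closure of a tame subset is a weak* compact subset of $\mathscr{S}(\mathfrak{A})$.
   Context: For a C*-algebra $\mathfrak{A}$: $\mathfrak{u}\mathfrak{A}$ is $\mathfrak{A}$ if $\mathfrak{A}$ is unital and its standard unitization $\mathfrak{A}\oplus\mathbb{C}$ otherwise, with unit $1$; $\mathfrak{sa}(\cdot)$ denotes self-adjoint elements; $\mathscr{S}(\mathfrak{A})$ is the state space; each state is identified with its unique extension to a state of $\mathfrak{u}\mathfrak{A}$ and with its normal extension to the von Neumann algebra $\mathfrak{A}^{\ast\ast}$ (which contains $\mathfrak{u}\mathfrak{A}$). The weak* topology is $\sigma(\mathfrak{A}^\ast,\mathfrak{A})$; weak* closures are taken in $\mathfrak{A}^\ast$. A Lipschitz pair $(\mathfrak{A},\mathsf{L})$ is a C*-algebra $\mathfrak{A}$ with a seminorm $\mathsf{L}$ defined on a dense subspace of $\mathfrak{sa}(\mathfrak{u}\mathfrak{A})$ such that $\{a\in\mathfrak{sa}(\mathfrak{u}\mathfrak{A}):\mathsf{L}(a)=0\}=\mathbb{R}1$ (writing $\mathsf{L}(a)\leq 1$ presumes $a$ is in the domain). For a state $\mu$, $\mathfrak{L}_1(\mathfrak{A},\mathsf{L},\mu)=\{a\in\mathfrak{sa}(\mathfrak{u}\mathfrak{A}):\mathsf{L}(a)\leq1\text{ and }\mu(a)=0\}$. A topographic quantum space $(\mathfrak{A},\mathfrak{M})$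 is a C*-algebra $\mathfrak{A}$ with an Abelian C*-subalgebra $\mathfrak{M}$ containing an approximate identity for $\mathfrak{A}$. $\sigma(\mathfrak{M})$ is the Gel'fand spectrum of $\mathfrak{M}$; $\mathcal{K}(\sigma(\mathfrak{M}))$ is the set of its compact subsets, directed so that larger sets come later; for $K\in\mathcal{K}(\sigma(\mathfrak{M}))$, $\chi_K$ is the indicator function of $K$, a projection in $\mathfrak{M}^{\ast\ast}\subseteq\mathfrak{A}^{\ast\ast}$. Set $\mathscr{S}(\mathfrak{A}|K)=\{\varphi\in\mathscr{S}(\mathfrak{A}):\varphi(\chi_K)=1\}$ and $\mathscr{S}(\mathfrak{A}|\mathfrak{M})=\bigcup_{K\in\mathcal{K}(\sigma(\mathfrak{M}))}\mathscr{S}(\mathfrak{A}|K)$ (local states). A subset $\mathscr{K}\subseteq\mathscr{S}(\mathfrak{A})$ is tight when for every $\varepsilon>0$ there is $Q\in\mathcal{K}(\sigma(\mathfrak{M}))$ such that for all $K\in\mathcal{K}(\sigma(\mathfrak{M}))$ with $Q\subseteq K$, $\sup\{\varphi(1-\chi_K):\varphi\in\mathscr{K}\}<\varepsilon$. A Lipschitz triple $(\mathfrak{A},\mathsf{L},\mathfrak{M})$ is a Lipschitz pair $(\mathfrak{A},\mathsf{L})$ together with an Abelian C*-subalgebra $\mathfrak{M}$ such that $(\mathfrak{A},\mathfrak{M})$ is a topographic quantum space. A subset $\mathscr{K}\subseteq\mathscr{S}(\mathfrak{A})$ is tame when, for some $\mu\in\mathscr{S}(\mathfrak{A}|\mathfrak{M})$,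 $\lim_{K\in\mathcal{K}(\sigma(\mathfrak{M}))}\sup\{|\varphi(a-\chi_Ka\chi_K)|:a\in\mathfrak{L}_1(\mathfrak{A},\mathsf{L},\mu),\varphi\in\mathscr{K}\}=0$. *)

(* Defs.v *)
From HB Require Import structures.
From mathcomp Require Import all_boot all_order all_algebra.
From mathcomp Require Import all_classical all_reals all_analysis.
From mathcomp Require Export complex.

Set Implicit Arguments.
Unset Strict Implicit.
Unset Printing Implicit Defensive.

Import Order.TTheory GRing.Theory Num.Theory.
Import numFieldNormedType.Exports.

Local Open Scope classical_set_scope.
Local Open Scope ring_scope.
Local Open Scope complex_scope.

Reserved Notation "a ** b" (at level 40, left associativity).

(* Not necessarily unital; the norm of a normed module over R[i] takes its
   values in R[i], hence the C*-identity is an equation in R[i]. *)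
HB.mixin Record isCStarAlgebra (R : realType) A
    & CompleteNormedModule R[i] A := {
  cmul : A -> A -> A ;
  cstar : A -> A ;
  cmulA : forall a b c : A, cmul a (cmul b c) = cmul (cmul a b) c ;
  cmulDl : forall a b c : A, cmul (a + b) c = cmul a c + cmul b c ;
  cmulDr : forall a b c : A, cmul a (b + c) = cmul a b + cmul a c ;
  cmulZl : forall (z : R[i]) (a b : A), cmul (z *: a) b = z *: cmul a b ;
  cmulZr : forall (z : R[i]) (a b : A), cmul a (z *: b) = z *: cmul a b ;
  cstarK : forall a : A, cstar (cstar a) = a ;
  cstarD : forall a b : A, cstar (a + b) = cstar a + cstar b ;
  cstarZ : forall (z : R[i]) (a : A), cstar (z *: a) = (z^*)%C *: cstar a ;
  cstarM : forall a b : A, cstar (cmul a b) = cmul (cstar b) (cstar a) ;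
  cnormM : forall a b : A, `|cmul a b| <= `|a| * `|b| ;
  cnorm_star : forall a : A, `|cmul (cstar a) a| = `|a| ^+ 2
}.

#[short(type="cstarType")]
HB.structure Definition CStarAlgebra (R : realType) :=
  {A of isCStarAlgebra R A & CompleteNormedModule R[i] A}.

Notation "a ** b" := (cmul a b) : ring_scope.


Section CStarDefs.
Variables (R : realType) (A : cstarType R).
Local Notation C := (R[i]^o).
Implicit Types (a b : A) (phi : {ptws A -> C}).

Definition rnorm a : R := complex.Re `|a|.

(* The dual of A inside the space of all functions A -> C with the topology of
   pointwise convergence: the subspace topology is sigma(A^*, A). *)
Definition dual : set {ptws A -> C} :=
  [set phi | scalar phi /\ continuous (phi : A -> C)].

Definition dual_norm phi : R :=
  sup [set complex.Re `|phi a| | a in [set a | rnorm a <= 1]].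

Definition states : set {ptws A -> C} :=
  [set phi | [/\ dual phi, forall a, 0 <= phi (cstar a ** a)
               & dual_norm phi = 1]].

Definition wstar_closure (S : set {ptws A -> C}) : set {ptws A -> C} :=
  dual `&` closure S.

Definition is_unit e := forall a, e ** a = a /\ a ** e = a.

Definition unital := exists e, is_unit e.

(* uA is carried by the pairs (a, z), read a + z 1; if A has a unit, only the
   pairs (a, 0) belong to it. *)
Definition unitization : set (A * C)%type := [set x | unital -> x.2 = 0].

Definition uone : A * C :=
  if `[< unital >] then (xget 0 is_unit, 0) else (0, 1).

Definition ustar (x : A * C) : A * C := (cstar x.1, (x.2 : R[i])^*).

(* the product x b, which lies in the ideal A of uA *)
Definition uact (x : A * C) b : A := x.1 ** b + x.2 *: b.

(* the C*-norm of uA *)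
Definition unorm (x : A * C) : R :=
  sup [set rnorm (uact x b) | b in [set b | rnorm b <= 1]].

Definition usa : set (A * C)%type :=
  [set x | unitization x /\ ustar x = x].

(* the extension of a state to uA *)
Definition uext phi (x : A * C) : C := phi x.1 + x.2.

(* L is only meaningful on its domain D. *)
Record lipschitz_pair (D : set (A * C)%type) (L : A * C -> R) : Prop := {
  lip_dom : D `<=` usa ;
  lip_dom0 : D 0 ;
  lip_domD : forall x y, D x -> D y -> D (x + y) ;
  lip_domZ : forall (r : R) x, D x -> D (r%:C *: x) ;
  lip_dense : forall x, usa x -> forall e : R, 0 < e ->
    exists2 y, D y & unorm (x - y) < e ;
  lip_ge0 : forall x, D x -> 0 <= L x ;
  lip_triangle : forall x y, D x -> D y -> L (x + y) <= L x + L y ;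
  lipZ : forall (r : R) x, D x -> L (r%:C *: x) = `|r| * L x ;
  lip_ker : [set x | D x /\ L x = 0] = [set r%:C *: uone | r in [set: R]]
}.

Definition lip_ball (D : set (A * C)%type) (L : A * C -> R) phi :
    set (A * C)%type :=
  [set x | [/\ D x, L x <= 1 & uext phi x = 0]].

Record abelian_csubalgebra (M : set A) : Prop := {
  csub0 : M 0 ;
  csubD : forall a b, M a -> M b -> M (a + b) ;
  csubZ : forall (z : R[i]) a, M a -> M (z *: a) ;
  csubM : forall a b, M a -> M b -> M (a ** b) ;
  csub_star : forall a, M a -> M (cstar a) ;
  csub_closed : closed M ;
  csub_comm : forall a b, M a -> M b -> a ** b = b ** a
}.

(* Nets are rendered by filters. *)
Definition has_approximate_identity (M : set A) :=
  exists F : set_system A, [/\ ProperFilter F, F M &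
    forall a, (e ** a @[e --> F] --> a) /\ (a ** e @[e --> F] --> a)].

Definition topographic (M : set A) :=
  abelian_csubalgebra M /\ has_approximate_identity M.

Definition lipschitz_triple (D : set (A * C)%type) (L : A * C -> R)
    (M : set A) := lipschitz_pair D L /\ topographic M.

Section Spectrum.
Variable M : set A.
Local Notation T := {ptws M -> C}.
Local Notation borelT := (g_sigma_algebraType (@open T)).

Definition spectrum : set T := [set x | [/\
  exists a : M, x a != 0,
  forall a b c : M, val c = val a + val b -> x c = x a + x b,
  forall (z : R[i]) (a c : M), val c = z *: val a -> x c = z * x a &
  forall a b c : M, val c = val a ** val b -> x c = x a * x b]].

Definition spectrum_compact (K : set T) := compact K /\ K `<=` spectrum.

(* the compact subsets of the spectrum, directed by inclusion *)
Definition compacts : set_system (set T) :=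
  [set P | exists2 Q, spectrum_compact Q &
    forall K, spectrum_compact K -> Q `<=` K -> P K].

(* The finite Radon measures on the spectrum, seen as the Borel measures of the
   ambient space T that are inner regular with respect to the compact subsets
   of the spectrum; they vanish off the spectrum. *)
Definition radon (m : {finite_measure set borelT -> \bar R}) :=
  forall B : set borelT, measurable B ->
    m B = ereal_sup [set m K | K in [set K : set borelT |
                                 spectrum_compact K /\ K `<=` B]].

Definition cintegral (m : {finite_measure set borelT -> \bar R})
    (f : T -> C) : C :=
  Rintegral m spectrum (fun x => complex.Re (f x)) +i*
  Rintegral m spectrum (fun x => complex.Im (f x)).

(* The Riesz identification of M^* with the complex Radon measures on the
   spectrum; the complex measure is m_0 + i m_1 - m_2 - i m_3. *)
Definition riesz_measure (m : 'I_4 -> {finite_measure set borelT -> \bar R})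
    phi :=
  (forall k, radon (m k)) /\
  forall a : M,
    phi (val a) = \sum_(k < 4) ('i%C : R[i]) ^+ k * cintegral (m k) (fun x => x a).

(* An element of A^** is given by its values on dual; the indicator function of
   K, as an element of M^** contained in A^**, maps a functional phi to the mass
   of K for the complex Radon measure that represents the restriction of phi to
   M. *)
Definition chi (K : set T) : {ptws A -> C} -> C := fun phi =>
  xget 0 [set z | exists2 m, riesz_measure m phi &
                  z = \sum_(k < 4) ('i%C : R[i]) ^+ k * (fine (m k K))%:C].

End Spectrum.

(* the multiplication of A^** (Arens product) *)
Definition arens (F G : {ptws A -> C} -> C) : {ptws A -> C} -> C :=
  fun phi => F (fun a => G (fun b => phi (a ** b))).

(* The product x G in A^** for x in uA; for x = (a, 0) it is the Arens product
   of the evaluation at a with G. *)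
Definition ubidual_mul (x : A * C) (G : {ptws A -> C} -> C) :
    {ptws A -> C} -> C :=
  fun phi => G (fun b => phi (uact x b)).

(* chi_K x chi_K *)
Definition compress (M : set A) (K : set {ptws M -> C}) (x : A * C) :
    {ptws A -> C} -> C :=
  arens (chi K) (ubidual_mul x (chi K)).

Definition local_states (M : set A) : set {ptws A -> C} :=
  [set phi | states phi /\
     exists2 K : set {ptws M -> C}, spectrum_compact K & chi K phi = 1].

Definition tight (M : set A) (S : set {ptws A -> C}) :=
  forall e : R, 0 < e ->
  exists2 Q : set {ptws M -> C}, spectrum_compact Q &
  forall K : set {ptws M -> C}, spectrum_compact K -> Q `<=` K ->
    (ereal_sup [set (complex.Re (1 - chi K phi))%:E | phi in S] < e%:E)%E.

(* The supremum is taken in [0, +oo], so that it is 0 for an empty family. *)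
Definition tame (D : set (A * C)%type) (L : A * C -> R) (M : set A)
    (S : set {ptws A -> C}) :=
  exists2 mu, local_states M mu &
  ereal_sup ([set 0%E] `|`
    [set (complex.Re `|uext p.2 p.1 - compress K p.1 p.2|)%:E
       | p in lip_ball D L mu `*` S])
    @[K --> @compacts M] --> (0 : \bar R)%E.

End CStarDefs.

(* Main.v *)
From HB Require Import structures.
Require Import Defs.
From mathcomp Require Import all_boot all_order all_algebra.
From mathcomp Require Import all_classical all_reals all_analysis.
From mathcomp Require Import measurable_realfun.
From mathcomp Require Import ring lra.

(** Tightness. Let mu be the local state that witnesses tameness, and let h be
    an element of M with values in [0, 1] on the spectrum and mu h >= 1/2. By
    density some d in the domain of L is close to h, and y = d - mu(d) 1, once
    rescaled, lies in the Lipschitz ball at mu. If K contains the compact set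
    where h is not small, then chi_K h chi_K is close to h, so that a state
    phi satisfies phi(y) - phi(chi_K y chi_K) = - mu(d) (1 - phi(chi_K)) up to
    a small error. Tameness makes the left-hand side small uniformly in phi,
    and mu(d) >= 1/4; hence phi(chi_K) is uniformly close to 1. This is
    compress_lower_bound followed by tame_tight.

    Closure. A pointwise limit of states is a positive contraction, and the
    set of contractions is compact. The norm of the limit is still 1, because
    tightness provides a single element g of the unit ball of M with phi(g)
    close to 1 for all phi in the set (tight_closure_states).

    Indicator functions. The value of chi_K at a functional is the mass of K
    for some measure that represents the functional on M, so these arguments
    need such measures for a state phi, for the functionals b |-> phi(a x b),
    and for a |-> chi_K(b |-> phi(a x b)). By polarization each is a
    combination of four positive functionals of a in M, the last one in the
    limit along an ultrafilter (matrix_coefficient_riesz). The mass of K is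
    then the limit of the values at cutoffs g, elements of M that are nearly 1
    on K and nearly 0 on compact sets away from K (chi_cvg), and all estimates
    are made on cutoffs, which exist by urysohn_cutoff.

    Riesz representation. A positive functional w on the self-adjoint part of
    M + C 1 is cut repeatedly into the halves (w + w(h .))/2 and (w - w(h
    .))/2. Cutting along a lowers the total variance of a, so after many cuts
    the normalized pieces are nearly multiplicative. The discrete measures
    that they define converge along an ultrafilter to a finitely additive
    content that charges only nearly multiplicative functionals
    (positive_functional_content); approximation by compact sets from inside
    and by open sets from outside turns it into a Radon measure
    (content_radon), and step functions identify w with the integral
    (representing_measure). Inverses of h + id for self-adjoint h are obtained
    from fixed points of contractions; they give the bounded functions h / (h
    + id) of h, from which approximate units and cutoffs are made. *)

Set Implicit Arguments.
Unset Strict Implicit.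
Unset Printing Implicit Defensive.

Import Order.TTheory GRing.Theory Num.Theory.
Import numFieldNormedType.Exports.

Local Open Scope classical_set_scope.
Local Open Scope ring_scope.

(** * Radon measures from finitely additive contents *)

Section Compactness.
Variable T : topologicalType.

(** An induction principle in place of the extraction of finite subcovers: if
    P K failed, the sets A such that P holds of K minus A would form a proper
    filter on K, and locality excludes that it has a cluster point. *)
Lemma compact_ind (P : set T -> Prop) (K : set T) :
  P set0 -> (forall A B, A `<=` B -> P B -> P A) ->
  (forall A B, P A -> P B -> P (A `|` B)) ->
  compact K -> (forall x, K x -> exists2 N, nbhs x N & P N) -> P K.
Proof.
move=> P0 Pmono PU cK Ploc; apply: contrapT => nPK.
pose F : set_system T := [set A | P (K `\` A)].
have FF : ProperFilter F.
  split.
    by rewrite /F /= setD0.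
  split.
  - by rewrite /F /= setDT.
  - move=> A B FA FB; apply: Pmono (PU _ _ FA FB) => x [Kx nAB].
    by have [Ax|nAx] := pselect (A x); [right|left]; split => // Bx; exact: nAB.
  - by move=> A B AB; apply: Pmono => x [Kx nBx]; split => // Ax; exact/nBx/AB.
have [|x [Kx clx]] := cK F FF; first by rewrite /F /= setDv.
have [N Nx PN] := Ploc x Kx.
have FN : F (~` N) by apply: Pmono PN => y [_ /contrapT].
by have [y []] := clx _ _ FN Nx.
Qed.

End Compactness.

Section AdditiveSetFunction.
Context {R : realType} {T : Type}.
Variable nu : set T -> R.
Hypothesis nu_ge0 : forall E, 0 <= nu E.
Hypothesis nuU : forall E F, E `&` F = set0 -> nu (E `|` F) = nu E + nu F.

Lemma content0 : nu set0 = 0.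
Proof. by have := @nuU set0 set0 (setI0 _); rewrite setU0; lra. Qed.

Lemma le_content E F : E `<=` F -> nu E <= nu F.
Proof.
move=> EF; have -> : F = E `|` (F `\` E).
  by apply/seteqP; split=> x; [have := EM (E x); move=> [|] /=; tauto|case=> [/EF|[]]].
by rewrite nuU ?lerDl// setDE setICA setICr setI0.
Qed.

Lemma contentU_le E F : nu (E `|` F) <= nu E + nu F.
Proof.
have -> : E `|` F = E `|` (F `\` E).
  apply/seteqP; split=> x /=; [|tauto].
  by have [] := EM (E x); tauto.
rewrite nuU ?setDE 1?setICA ?setICr ?setI0// lerD2l.
by apply: le_content => x [].
Qed.

End AdditiveSetFunction.

Section RadonFromContent.
Context {R : realType} {T : puniformType}.
Variables (nu : set T -> R) (Y : set T).
Hypothesis nu_ge0 : forall E, 0 <= nu E.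
Hypothesis nuU : forall E F, E `&` F = set0 -> nu (E `|` F) = nu E + nu F.
Hypothesis T2 : hausdorff_space T.
Hypothesis cptY : compact Y.
Hypothesis nuY : nu (~` Y) = 0.

Let nu0 : nu set0 = 0. Proof. exact: content0 nuU. Qed.
Let le_nu E F : E `<=` F -> nu E <= nu F.
Proof. exact: le_content nu_ge0 nuU E F. Qed.
Let leU_nu E F : nu (E `|` F) <= nu E + nu F.
Proof. exact: contentU_le nu_ge0 nuU E F. Qed.

Definition inner_content (U : set T) : \bar R :=
  ereal_sup [set (nu K)%:E | K in [set K | compact K /\ K `<=` U]].

(** The outer measure of the Riesz-Markov construction, started from a content
    on all subsets. *)
Definition outer_content (E : set T) : \bar R :=
  ereal_inf [set inner_content U | U in [set U | open U /\ E `<=` U]].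

Local Open Scope ereal_scope.

Lemma inner_content_ge0 U : 0 <= inner_content U.
Proof.
apply: ereal_sup_ubound; exists set0; last by rewrite nu0.
by split; [exact: compact0|].
Qed.

Lemma le_inner_content U V : U `<=` V -> inner_content U <= inner_content V.
Proof.
move=> UV; apply: le_ereal_sup => _ [K [cK KU] <-]; exists K => //.
by split => //; exact: subset_trans UV.
Qed.

Lemma inner_content_le U : inner_content U <= (nu U)%:E.
Proof.
by apply: ge_ereal_sup => _ [K [cK KU] <-]; rewrite lee_fin; exact: le_nu.
Qed.

(** Uniform spaces are regular, so the compact set K minus V has an open
    neighbourhood with closure inside U; that closure cuts K in two. *)
Lemma compact_open_split (K U V : set T) : compact K -> open U -> open V ->
  K `<=` U `|` V -> exists K1 K2, [/\ compact K1, compact K2, K1 `<=` U,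
    K2 `<=` V & K `<=` K1 `|` K2].
Proof.
move=> cK oU oV KUV.
have clK : closed K by exact: compact_closed.
have cKV : compact (K `\` V).
  by apply: compact_closedI => //; exact: open_closedC.
pose P (A : set T) := exists W, [/\ open W, A `<=` W & closure W `<=` U].
have [W [oW KVW WU]] : P (K `\` V).
  apply: (compact_ind _ _ _ cKV).
  - by exists set0; split; [exact: open0| |rewrite closure0].
  - by move=> A B AB [W [oW BW WU]]; exists W; split => //; exact: subset_trans BW.
  - move=> A B [W [oW AW WU]] [W' [oW' BW' WU']]; exists (W `|` W'); split.
    + exact: openU.
    + exact: setUSS.
    + by rewrite closureU => x [/WU|/WU'].
  - move=> x [Kx nVx]; have Ux : U x by have [] := KUV x Kx.
    have [N Nx NU] := uniform_regular (open_nbhs_nbhs (conj oU Ux)).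
    exists N°; first exact: nbhs_interior.
    exists N°; split => //; first exact: open_interior.
    exact: subset_trans (closureS (@interior_subset _ N)) NU.
exists (K `&` closure W), (K `\` W); split.
- by apply: compact_closedI => //; exact: closed_closure.
- by apply: compact_closedI => //; exact: open_closedC.
- by move=> x [_ /WU].
- by move=> x [Kx nW]; apply: contrapT => nV; exact/nW/KVW.
- move=> x Kx; have [Wx|nWx] := EM (W x); [left|right]; split => //.
  exact: subset_closure.
Qed.

Lemma inner_contentU_le U V : open U -> open V ->
  inner_content (U `|` V) <= inner_content U + inner_content V.
Proof.
move=> oU oV; apply: ge_ereal_sup => _ [K [cK KUV] <-].
have [K1 [K2 [cK1 cK2 K1U K2V KK]]] := compact_open_split cK oU oV KUV.
apply: (@le_trans _ _ ((nu K1)%:E + (nu K2)%:E)).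
  by rewrite -EFinD lee_fin (le_trans (le_nu KK))// leU_nu.
apply: leeD.
  by apply: ereal_sup_ubound; exists K1.
by apply: ereal_sup_ubound; exists K2.
Qed.

Lemma open_cover_ind (U : (set T)^nat) (K : set T) : (forall n, open (U n)) ->
  compact K -> K `<=` \bigcup_n U n ->
  exists n, K `<=` \big[setU/set0]_(i < n) U i.
Proof.
move=> oU cK KU.
apply: (@compact_ind _ (fun A => exists n, A `<=` \big[setU/set0]_(i < n) U i) K _ _ _ cK).
- by exists 0%N.
- by move=> A B AB [n Bn]; exists n; exact: subset_trans Bn.
- move=> A B [n An] [m Bm]; exists (maxn n m).
  have mono p : (p <= maxn n m)%N -> \big[setU/set0]_(i < p) U i `<=`
      \big[setU/set0]_(i < maxn n m) U i.
    by move=> pm; rewrite -!bigcup_mkord; apply: bigcup_sub => i /= ip x Ux; exists i => //=; exact: leq_trans pm.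
  by move=> x [/An|/Bm]; apply: mono; rewrite ?leq_maxl ?leq_maxr.
- move=> x /KU[n _ Unx]; exists (U n); first exact: open_nbhs_nbhs.
  by exists n.+1; rewrite -bigcup_mkord => y Uy; exists n => /=.
Qed.

Lemma inner_content_bigcup (U : (set T)^nat) : (forall n, open (U n)) ->
  inner_content (\bigcup_n U n) <= \sum_(n <oo) inner_content (U n).
Proof.
move=> oU; apply: ge_ereal_sup => _ [K [cK KU] <-].
have [n Kn] := open_cover_ind oU cK KU.
have H m : inner_content (\big[setU/set0]_(i < m) U i) <=
    \sum_(i < m) inner_content (U i).
  elim: m => [|m IH].
    by rewrite !big_ord0 (le_trans (inner_content_le _))// nu0.
  rewrite !big_ord_recr /=.
  apply: (le_trans (inner_contentU_le _ (oU m))); last by rewrite leeD2r.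
  by rewrite -bigcup_mkord; apply: bigcup_open => i _; exact: oU.
apply: (@le_trans _ _ (\sum_(i < n) inner_content (U i))).
  by apply: le_trans (H n); apply: ereal_sup_ubound; exists K.
rewrite -(big_mkord xpredT (fun i => inner_content (U i))).
by apply: nneseries_lim_ge => k *; exact: inner_content_ge0.
Qed.

Lemma outer_content_open U : open U -> outer_content U = inner_content U.
Proof.
move=> oU; apply/eqP; rewrite eq_le; apply/andP; split.
  by apply: ereal_inf_lbound; exists U => //; split.
apply: le_ereal_inf_tmp => _ [V [oV UV] <-]; exact: le_inner_content.
Qed.

Lemma outer_content_ge0 E : 0 <= outer_content E.
Proof. by apply: le_ereal_inf_tmp => _ [U _ <-]; exact: inner_content_ge0. Qed.

Lemma le_outer_content : {homo outer_content : A B / A `<=` B >-> A <= B}.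
Proof.
move=> A B AB; apply: ereal_inf_le_tmp => _ [U [oU BU] <-]; exists U => //.
by split => //; exact: subset_trans BU.
Qed.

Lemma outer_content0 : outer_content set0 = 0.
Proof.
rewrite outer_content_open; last exact: open0.
apply/eqP; rewrite eq_le inner_content_ge0 andbT.
by rewrite (le_trans (inner_content_le _))// nu0.
Qed.

Lemma outer_content_le E : outer_content E <= (nu setT)%:E.
Proof.
apply: (@le_trans _ _ (outer_content setT)); first exact: le_outer_content.
by rewrite outer_content_open; [exact: inner_content_le|exact: openT].
Qed.

Lemma outer_content_fin E : outer_content E \is a fin_num.
Proof.
rewrite ge0_fin_numE ?outer_content_ge0//.
exact: le_lt_trans (outer_content_le E) (ltry _).
Qed.

Lemma outer_content_adherent E (e : R) : (0 < e)%R -> exists U, [/\ open U,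
  E `<=` U & inner_content U <= outer_content E + e%:E].
Proof.
move=> e0; have [_ [U [oU EU] <-] H] := lb_ereal_inf_adherent e0 (outer_content_fin E).
by exists U; split => //; exact: ltW.
Qed.

Lemma outer_content_sigma_subadditive : sigma_subadditive outer_content.
Proof.
move=> A; apply/lee_addgt0Pr => e e0.
apply: (le_trans _ (epsilon_trick _ _ (ltW e0))); last first.
  by move=> n; exact: outer_content_ge0.
have [G PG] : {G : (set T)^nat & forall n, [/\ open (G n), A n `<=` G n &
    inner_content (G n) <= outer_content (A n) + (e / (2 ^ n.+1)%:R)%:E]}.
  apply: (@choice _ _ (fun n G => [/\ open G, A n `<=` G &
    inner_content G <= outer_content (A n) + (e / (2 ^ n.+1)%:R)%:E])) => n.
  by apply: outer_content_adherent; rewrite divr_gt0// ltr0n expn_gt0.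
have oG n : open (G n) by have [] := PG n.
apply: (@le_trans _ _ (inner_content (\bigcup_n G n))).
  apply: ereal_inf_lbound; exists (\bigcup_n G n) => //; split.
    by apply: bigcup_open => i _.
  by apply: subset_bigcup => i _; have [] := PG i.
apply: (le_trans (inner_content_bigcup oG)).
apply: lee_nneseries => n *; first exact: inner_content_ge0.
by have [] := PG n.
Qed.

HB.instance Definition _ := isOuterMeasure.Build R T outer_content
  outer_content0 outer_content_ge0 le_outer_content
  outer_content_sigma_subadditive.

(** For K inside U and V, and L inside U minus K, the union of K and L is
    compact and nu is additive on it; taking suprema over L and then over K
    gives the required superadditivity. *)
Lemma open_caratheodory V : open V -> caratheodory_measurable outer_content V.
Proof.
move=> oV; apply: le_caratheodory_measurable => X.
apply/lee_addgt0Pr => e e0.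
have [U [oU XU Ue]] := outer_content_adherent X e0.
apply: le_trans Ue.
apply: (@le_trans _ _ (outer_content (U `&` V) + outer_content (U `&` ~` V))).
  by apply: leeD; apply: le_outer_content; apply: setSI.
rewrite outer_content_open; last exact: openI.
rewrite -leeBrDr ?outer_content_fin//.
apply: ge_ereal_sup => _ [K [cK KUV] <-].
rewrite leeBrDl ?outer_content_fin// -leeBrDr//.
have clK : closed K by exact: compact_closed.
have oUK : open (U `\` K) by apply: openI => //; exact: closed_openC.
apply: (@le_trans _ _ (outer_content (U `\` K))).
  by apply: le_outer_content => x [Ux nVx]; split => // /KUV[].
rewrite outer_content_open//; apply: ge_ereal_sup => _ [L [cL LU] <-].
rewrite leeBrDr// -EFinD -nuU.
  apply: ereal_sup_ubound; exists (L `|` K) => //; split; first exact: compactU.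
  by move=> x [/LU[]|/KUV[]].
by apply/seteqP; split => // x [/LU[]].
Qed.

Local Notation borelT := (g_sigma_algebraType (@open T)).

Lemma borel_caratheodory (B : set borelT) : measurable B ->
  caratheodory_measurable outer_content B.
Proof.
move: B; apply: smallest_sub; last by move=> V; exact: open_caratheodory.
split.
- exact: caratheodory_measurable_set0.
- by move=> A; rewrite setTD; exact: caratheodory_measurable_setC.
- by move=> A; exact: caratheodory_measurable_bigcup.
Qed.

(** A name of its own for outer_content on Borel sets, which carries the
    structure of a finite measure. *)
Definition radonized : set borelT -> \bar R := outer_content.

Let radonized0 : radonized set0 = 0.
Proof. exact: outer_content0. Qed.

Let radonized_ge0 B : 0 <= radonized B.
Proof. exact: outer_content_ge0. Qed.

Let radonized_sigma_additive : semi_sigma_additive radonized.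
Proof.
move=> F mF tF mUF.
apply: (@caratheodory_measure_sigma_additive R T outer_content F) => //.
- by move=> n; exact: borel_caratheodory.
- exact: borel_caratheodory.
Qed.

HB.instance Definition _ := isMeasure.Build _ _ _ radonized
  radonized0 radonized_ge0 radonized_sigma_additive.

Let radonized_fin : fin_num_fun radonized.
Proof. by move=> U _; exact: outer_content_fin. Qed.

HB.instance Definition _ := Measure_isFinite.Build _ _ _ radonized radonized_fin.

Lemma measurable_open (U : set borelT) : open (U : set T) -> measurable U.
Proof. by move=> oU; exact: sub_sigma_algebra. Qed.

Lemma measurable_closed (U : set borelT) : closed (U : set T) -> measurable U.
Proof.
by move=> cU; rewrite -(setCK U); apply: measurableC; apply: measurable_open; exact: closed_openC.
Qed.

Lemma radonized_compact K : compact K -> (nu K)%:E <= radonized K.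
Proof.
move=> cK; apply: le_ereal_inf_tmp => _ [U [oU KU] <-].
by apply: ereal_sup_ubound; exists K.
Qed.

Lemma radonized_open U : open U -> radonized U <= (nu U)%:E.
Proof. by move=> oU; rewrite /radonized outer_content_open// inner_content_le. Qed.

Lemma radonized_open0 U : open U ->
  (forall K, compact K -> K `<=` U -> nu K = 0%R) -> radonized U = 0.
Proof.
move=> oU H; rewrite /radonized outer_content_open//.
apply/eqP; rewrite eq_le inner_content_ge0 andbT.
by apply: ge_ereal_sup => _ [K [cK KU] <-]; rewrite H.
Qed.

(** An open U just larger than the complement of B has a closed complement
    inside B, whose intersection with the compact set Y is compact and has the
    same measure. *)
Lemma radonized_inner_regular (B : set borelT) (e : R) :
  measurable B -> (0 < e)%R ->
  exists K : set T, [/\ compact K, K `<=` B & radonized B <= radonized K + e%:E].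
Proof.
move=> mB e0.
have [U [oU BU Ue]] := outer_content_adherent (~` B) e0.
have cY : closed Y by exact: compact_closed.
have oYc : open (~` Y) by exact: closed_openC.
have cU : closed (~` U) by exact: open_closedC.
exists (~` U `&` Y); split.
- by rewrite setIC; exact: compact_closedI.
- by move=> x [nUx _]; apply: contrapT => /BU.
have mU : measurable (U : set borelT) by exact: measurable_open.
have mY : measurable (Y : set borelT) by exact: measurable_closed.
have B_ : B `<=` ((~` U `&` Y) `|` (~` Y)) `|` (U `&` B).
  move=> x Bx; have [Ux|nUx] := EM (U x); [by right|left].
  by have [Yx|nYx] := EM (Y x); [left|right].
apply: (le_trans (le_outer_content B_)).
apply: (le_trans (outer_measureU2 _ _ _)).
apply: leeD.
  apply: (le_trans (outer_measureU2 _ _ _)).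
  have Y0 : outer_content (~` Y) = 0.
    apply: radonized_open0 => // K cK KY.
    by apply/eqP; rewrite eq_le nu_ge0 andbT -nuY le_nu.
  rewrite -[leRHS]adde0 -Y0; exact: lexx.
have HE : outer_content U - outer_content (~` B) = outer_content (U `&` B).
  rewrite (borel_caratheodory mB U).
  have -> : U `&` ~` B = ~` B by apply/setIidPr.
  by rewrite addeK// outer_content_fin.
apply: (@le_trans _ _ (outer_content U - outer_content (~` B))).
  by rewrite HE; exact: lexx.
by rewrite leeBlDr ?outer_content_fin// addeC outer_content_open.
Qed.

(** The content nu itself need not be countably additive. Its regularization
    is, and it lies above nu on compact sets and below nu on open sets, which
    suffices to compare integrals of continuous functions. *)
Theorem content_radon :
  exists m : {finite_measure set borelT -> \bar R}, [/\
    forall K : set T, compact K -> (nu K)%:E <= m K,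
    forall U : set T, open U -> m U <= (nu U)%:E,
    forall U : set T, open U ->
      (forall K, compact K -> K `<=` U -> nu K = 0%R) -> m U = 0 &
    forall (B : set borelT) (e : R), measurable B -> (0 < e)%R ->
      exists K : set T, [/\ compact K, K `<=` B & m B <= m K + e%:E]].
Proof.
exists [the {finite_measure set borelT -> \bar R} of radonized]; split.
- exact: radonized_compact.
- exact: radonized_open.
- exact: radonized_open0.
- exact: radonized_inner_regular.
Qed.

End RadonFromContent.

(** * Ultralimits and two real inequalities *)

Lemma ultra_compact_cvg (J : Type) (T : topologicalType) (U : set_system J)
    (f : J -> T) (K : set T) :
  UltraFilter U -> compact K -> (\forall j \near U, K (f j)) ->
  exists2 p, K p & f @ U --> p.
Proof.
move=> UU cK UK.
have [p [Kp clp]] := cK (f @ U) _ UK.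
exists p => // N Np.
have [//|UN] := in_ultra_setVsetC (f @^-1` N) UU.
by have [x []] := clp (~` N) N UN Np.
Qed.

Lemma ultra_bounded_cvg (R : realType) (J : Type) (U : set_system J)
    (f : J -> R) (a b : R) :
  UltraFilter U -> (\forall j \near U, a <= f j <= b) -> cvg (f @ U).
Proof.
move=> UU Hf.
have [|p _ fp] := @ultra_compact_cvg _ _ _ f _ UU (@segment_compact R a b).
  by apply: filterS Hf => j; rewrite /= in_itv.
by apply/cvg_ex; exists p.
Qed.

Lemma discriminant_le (R : realFieldType) (a b c : R) :
  (forall r, 0 <= a * r ^+ 2 + 2 * b * r + c) -> b ^+ 2 <= a * c.
Proof.
move=> H; have [a0|a0|a0] := ltrgtP a 0.
- have c0 : 0 <= c by have := H 0; rewrite expr0n/= !mulr0 !add0r.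
  pose r := (`|b| * 2 + c + 1) / (- a) + 1.
  have an : - a > 0 by lra.
  have r1 : 1 <= r by rewrite lerDr divr_ge0//; have := normr_ge0 b; lra.
  have ar : a * r = - (`|b| * 2 + c + 1) + a by rewrite /r; field; lra.
  have := H r; rewrite expr2 mulrA ar.
  have b1 : 2 * b * r <= 2 * `|b| * r by rewrite ler_wpM2r ?ler_wpM2l ?ler_norm//; lra.
  nra.
- pose r := - b / a.
  have := H r.
  have -> : a * r ^+ 2 + 2 * b * r + c = (a * c - b ^+ 2) / a by rewrite /r; field; lra.
  by rewrite pmulr_lge0 ?invr_gt0// subr_ge0.
- have c0 : 0 <= c by have := H 0; rewrite expr0n/= !mulr0 !add0r.
  have -> : b = 0.
    apply/eqP/negPn/negP => b0.
    have := H (- (c + 1) / (2 * b)); rewrite a0 mul0r add0r.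
    have -> : 2 * b * (- (c + 1) / (2 * b)) = - (c + 1) by field.
    by lra.
  by rewrite a0 mul0r expr0n.
Qed.

(** Convexity of x^2 / p in (x, p), including weights p = 0, for which x = 0
    and the quotient is 0. *)
Lemma sqr_div_le (R : realFieldType) (x y p q : R) : 0 <= p -> 0 <= q ->
  (p = 0 -> x = 0) -> (q = 0 -> y = 0) ->
  (x + y) ^+ 2 / (p + q) <= x ^+ 2 / p + y ^+ 2 / q.
Proof.
move=> p0 q0 px qy.
have [p00|pn] := eqVneq p 0; first by rewrite p00 px// !add0r invr0 mulr0 add0r.
have [q00|qn] := eqVneq q 0; first by rewrite q00 qy// !addr0 invr0 mulr0 addr0.
have pp : 0 < p by rewrite lt_def pn.
have qp : 0 < q by rewrite lt_def qn.
rewrite -subr_ge0.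
have -> : x ^+ 2 / p + y ^+ 2 / q - (x + y) ^+ 2 / (p + q) =
   (x * q - y * p) ^+ 2 / (p * q * (p + q)) by field; rewrite pn qn; lra.
by rewrite divr_ge0 ?sqr_ge0// ltW// !mulr_gt0// addr_gt0.
Qed.

(** * Cutting a positive functional into almost multiplicative pieces *)

Section Decomposition.
Variables (R : realType) (B : comNzRingType) (iota : R -> B) (N : B -> R).
Hypothesis N0 : N 0 = 0.
Hypothesis N_ge0 : forall b, 0 <= N b.
Hypothesis N_mul : forall a b, N (a * b) <= N a * N b.
Hypothesis N_scale : forall r b, N (iota r * b) = `|r| * N b.

(** B stands for the self-adjoint part of a unital abelian C*-algebra: a
    commutative ring with a norm N on which the reals act through iota. *)
Record positive_functional (w : B -> R) : Prop := PositiveFunctional {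
  pf_add : forall a b, w (a + b) = w a + w b ;
  pf_scale : forall r b, w (iota r * b) = r * w b ;
  pf_sqr : forall b, 0 <= w (b * b) ;
  pf_bound : exists2 C, 0 <= C & forall b, `|w b| <= C * N b }.

Section Functional.
Variable w : B -> R.
Hypothesis pw : positive_functional w.

Lemma pf1_ge0 : 0 <= w 1.
Proof. by have := pf_sqr pw 1; rewrite mulr1. Qed.

Lemma pf_cauchy_schwarz a b : w (a * b) ^+ 2 <= w (a * a) * w (b * b).
Proof.
apply: discriminant_le => r; have := pf_sqr pw (iota r * a + b).
have -> : (iota r * a + b) * (iota r * a + b) =
  iota r * (iota r * (a * a)) + iota r * (a * b) + iota r * (a * b) + b * b by ring.
rewrite !(pf_add pw) !(pf_scale pw).
by congr (_ <= _); ring.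
Qed.

(** For x n = w (h^(2^n) b^2), Cauchy-Schwarz reads x n ^ 2 <= w (b^2) x (n +
    1). If |x 0| exceeded w (b^2), then x n would grow without bound, whereas
    N h <= 1 keeps it bounded. *)
Lemma pf_mul_le h b : N h <= 1 -> `|w (h * (b * b))| <= w (b * b).
Proof.
move=> Nh; rewrite leNgt; apply/negP => hlt.
pose q := w (b * b); pose x n := w (h ^+ (2 ^ n) * (b * b)).
have q0 : 0 <= q := pf_sqr pw b.
have xS n : x n ^+ 2 <= q * x n.+1.
  have := pf_cauchy_schwarz b (h ^+ (2 ^ n) * b).
  have -> : h ^+ (2 ^ n) * b * (h ^+ (2 ^ n) * b) = h ^+ (2 ^ n.+1) * (b * b).
    by rewrite expnS mul2n -addnn exprD; ring.
  by have -> : b * (h ^+ (2 ^ n) * b) = h ^+ (2 ^ n) * (b * b) by ring.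
have x0 : q < `|x 0%N| by rewrite /x expn0 expr1.
have qgt : 0 < q.
  rewrite lt_def q0 andbT; apply/negP => /eqP q00.
  have := xS 0%N; rewrite q00 mul0r => x00.
  have : x 0%N ^+ 2 = 0 by apply/eqP; rewrite eq_le x00 sqr_ge0.
  move/eqP; rewrite expf_eq0/= => /eqP x00'.
  by move: x0; rewrite x00' normr0 q00 ltxx.
pose y n := x n / q.
have yS n : y n ^+ 2 <= y n.+1.
  have -> : y n ^+ 2 = (x n ^+ 2) / q / q by rewrite /y; field; lra.
  have -> : y n.+1 = q * x n.+1 / q / q by rewrite /y; field; lra.
  by rewrite !ler_pM2r ?invr_gt0.
have y1 : 1 < y 1%N.
  apply: lt_le_trans (yS 0%N).
  have : 1 < `|y 0%N| by rewrite normrM normfV (gtr0_norm qgt) ltr_pdivlMr// mul1r.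
  move=> H; rewrite -real_normK ?num_real// expr2.
  by have := ltr_pM ler01 ler01 H H; rewrite mulr1.
have yn n : n%:R * (y 1%N - 1) + y 1%N <= y n.+1.
  elim: n => [|n IH]; first by rewrite mul0r add0r.
  have nd : 0 <= n%:R * (y 1%N - 1) by rewrite mulr_ge0// subr_ge0 ltW.
  have Y1 : y 1%N <= y n.+1 by lra.
  by have := yS n.+1; rewrite -natr1 mulrDl; nra.
have [C C0 HC] := pf_bound pw.
have Nn n : N (h ^+ n.+1) <= 1.
  elim: n => [|n IH]; first by rewrite expr1.
  by rewrite exprS (le_trans (N_mul _ _))// mulr_ile1.
have ybd n : y n <= C * N (b * b) / q.
  rewrite ler_pdivrMr// /y divfK ?gt_eqF//.
  apply: (le_trans (ler_norm _)); apply: (le_trans (HC _)).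
  apply: ler_wpM2l => //; apply: (le_trans (N_mul _ _)).
  by apply: ler_piMl => //; case: (2 ^ n)%N (expn_gt0 2 n) => // k _.
pose D := C * N (b * b) / q / (y 1%N - 1).
have y10 : 0 < y 1%N - 1 by lra.
have := yn (Num.bound D); have := ybd (Num.bound D).+1.
have D0 : 0 <= D by rewrite !divr_ge0// ?mulr_ge0// ltW.
have := archi_boundP D0; rewrite /D ltr_pdivrMr//.
by move: (C * N (b * b) / q) => E; lra.
Qed.

Lemma pf_le b : `|w b| <= N b * w 1.
Proof.
have [Nb0|Nb0] := eqVneq (N b) 0.
  have [C C0 HC] := pf_bound pw.
  by have := HC b; rewrite Nb0 mulr0 mul0r.
have Nb : 0 < N b by rewrite lt_def Nb0 N_ge0.
have : `|w (iota (N b)^-1 * b * (1 * 1))| <= w (1 * 1).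
  by apply: pf_mul_le; rewrite N_scale gtr0_norm ?invr_gt0// mulVf.
rewrite !mulr1 (pf_scale pw) normrM gtr0_norm ?invr_gt0//.
by rewrite mulrC ler_pdivrMr// mulrC.
Qed.

Lemma pf_eq0 b : w 1 = 0 -> w b = 0.
Proof. by move=> w10; have := pf_le b; rewrite w10 mulr0 normr_le0 => /eqP. Qed.

End Functional.

(** Replacing h by 0 when its norm exceeds 1 makes the halves of a positive
    functional positive for every h. *)
Definition clip h : B := if N h <= 1 then h else 0.

Lemma clip_le h : N (clip h) <= 1.
Proof. by rewrite /clip; case: ifPn => // _; rewrite N0. Qed.

(** The functionals with densities (1 + h) / 2 and (1 - h) / 2 with respect to
    w. *)
Definition plus_half h (w : B -> R) b : R := (w b + w (clip h * b)) / 2.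
Definition minus_half h (w : B -> R) b : R := (w b - w (clip h * b)) / 2.

Lemma halves_add h w : (fun b => plus_half h w b + minus_half h w b) = w.
Proof. by apply/funext => b; rewrite /plus_half /minus_half; field. Qed.

Lemma plus_halfD h w1 w2 : plus_half h (fun b => w1 b + w2 b) =
  (fun b => plus_half h w1 b + plus_half h w2 b).
Proof. by apply/funext => b; rewrite /plus_half; field. Qed.

Lemma minus_halfD h w1 w2 : minus_half h (fun b => w1 b + w2 b) =
  (fun b => minus_half h w1 b + minus_half h w2 b).
Proof. by apply/funext => b; rewrite /minus_half; field. Qed.

Lemma halves_bound h (w : B -> R) C : 0 <= C -> (forall b, `|w b| <= C * N b) ->
  forall b, (`|w b| + `|w (clip h * b)|) / 2 <= C * N b.
Proof.
move=> C0 H b; have := H b; have : `|w (clip h * b)| <= C * N b.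
  apply: (le_trans (H _)); apply: ler_wpM2l => //.
  by apply: (le_trans (N_mul _ _)); rewrite ler_piMl// clip_le.
by lra.
Qed.

Lemma plus_half_pf h w : positive_functional w ->
  positive_functional (plus_half h w).
Proof.
move=> pw; rewrite /plus_half; split.
- by move=> a b; rewrite mulrDr !(pf_add pw); field.
- by move=> r b; rewrite mulrCA !(pf_scale pw); field.
- by move=> b; have := pf_mul_le pw b (clip_le h); rewrite ler_norml; lra.
- have [C C0 HC] := pf_bound pw; exists C => // b.
  apply: le_trans (halves_bound h C0 HC b).
  by rewrite normrM [X in _ * X]gtr0_norm ?invr_gt0// ler_wpM2r// ler_normD.
Qed.

Lemma minus_half_pf h w : positive_functional w ->
  positive_functional (minus_half h w).
Proof.
move=> pw; rewrite /minus_half; split.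
- by move=> a b; rewrite mulrDr !(pf_add pw); field.
- by move=> r b; rewrite mulrCA !(pf_scale pw); field.
- by move=> b; have := pf_mul_le pw b (clip_le h); rewrite ler_norml; lra.
- have [C C0 HC] := pf_bound pw; exists C => // b.
  apply: le_trans (halves_bound h C0 HC b).
  by rewrite normrM [X in _ * X]gtr0_norm ?invr_gt0// ler_wpM2r// ler_normB.
Qed.

(** Cutting w along the members of l in turn gives 2^(size l) pieces, over
    which f is summed; recursion on l avoids listing them. *)
Fixpoint split_sum (l : seq B) (f : (B -> R) -> R) (w : B -> R) : R :=
  if l is h :: l' then
    split_sum l' f (plus_half h w) + split_sum l' f (minus_half h w)
  else f w.

Lemma split_sum_cat l1 l2 f w :
  split_sum (l1 ++ l2) f w = split_sum l1 (split_sum l2 f) w.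
Proof. by elim: l1 w => //= h l IH w; rewrite !IH. Qed.

Lemma split_sum_le l f g w : (forall v, positive_functional v -> f v <= g v) ->
  positive_functional w -> split_sum l f w <= split_sum l g w.
Proof.
move=> fg; elim: l w => [|h l IH] w pw /=; first exact: fg.
by apply: lerD; apply: IH; [exact: plus_half_pf|exact: minus_half_pf].
Qed.

Lemma split_sumD l f g w :
  split_sum l (fun v => f v + g v) w = split_sum l f w + split_sum l g w.
Proof. by elim: l w => //= h l IH w; rewrite !IH addrACA. Qed.

Lemma split_sumZ l c f w :
  split_sum l (fun v => c * f v) w = c * split_sum l f w.
Proof. by elim: l w => //= h l IH w; rewrite !IH mulrDr. Qed.

Lemma split_sum_eval l b w : split_sum l (fun v => v b) w = w b.
Proof.
elim: l w => //= h l IH w; rewrite !IH.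
by have := congr1 (@^~ b) (halves_add h w).
Qed.

Definition superadditive (f : (B -> R) -> R) := forall v w,
  positive_functional v -> positive_functional w ->
  f v + f w <= f (fun b => v b + w b).

Lemma split_sum_superadditive l f : superadditive f ->
  superadditive (split_sum l f).
Proof.
move=> sf; elim: l => //= h l IH v w pv pw.
rewrite plus_halfD minus_halfD addrACA; apply: lerD; apply: IH;
  by [exact: plus_half_pf|exact: minus_half_pf].
Qed.

(** More cuts decrease a superadditive quantity. The comparison is along
    subsequences, not prefixes, because this order on lists of cuts is
    directed: two lists are subsequences of their concatenation. *)
Lemma split_sum_subseq l l' f w : superadditive f -> positive_functional w ->
  subseq l l' -> split_sum l' f w <= split_sum l f w.
Proof.
move=> sf; elim: l' l w => [|h' l' IH] l w pw; first by rewrite subseq0 => /eqP ->.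
have drop k : subseq k l' -> split_sum (h' :: l') f w <= split_sum k f w.
  move=> kl /=; rewrite -[in leRHS](halves_add h' w).
  apply: le_trans (split_sum_superadditive k sf (plus_half_pf h' pw) (minus_half_pf h' pw)).
  by apply: lerD; apply: IH => //; [exact: plus_half_pf|exact: minus_half_pf].
case: l => [|h l]; first by move=> _; apply: drop; exact: sub0seq.
have [<-|hh] := eqVneq h h'.
  rewrite /= eqxx => kl.
  by apply: lerD; apply: IH => //; [exact: plus_half_pf|exact: minus_half_pf].
by rewrite /= (negbTE hh); exact: drop.
Qed.

(** The variance of a for w seen as a measure of mass w 1; it is 0 when w is a
    multiple of a character. *)
Definition variance a (w : B -> R) : R := w (a * a) - w a ^+ 2 / w 1.

Lemma variance_ge0 a w : positive_functional w -> 0 <= variance a w.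
Proof.
move=> pw; rewrite /variance subr_ge0; have := pf_cauchy_schwarz pw a 1.
have [w0|w0] := eqVneq (w 1) 0.
  by rewrite w0 invr0 mulr0 => _; exact: pf_sqr.
by rewrite !mulr1 ler_pdivrMr// lt_def w0 pf1_ge0.
Qed.

(** Variance does not increase under conditioning; in this form it is the
    convexity of x^2 / p. *)
Lemma variance_superadditive a : superadditive (variance a).
Proof.
move=> v w pv pw; rewrite /variance.
have := @sqr_div_le _ (v a) (w a) _ _ (pf1_ge0 pv) (pf1_ge0 pw)
  (pf_eq0 pv a) (pf_eq0 pw a).
by lra.
Qed.

(** Cutting along a lowers the variance V of a by at least V^2 / w 1. The
    tangent inequality V^2 / w 1 >= 2 c V - c^2 w 1 makes the gain an affine
    expression in V and w 1, which can be summed over pieces. *)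
Lemma variance_halves a c w : N a <= 1 -> positive_functional w ->
  variance a (plus_half a w) + variance a (minus_half a w) <=
  variance a w - (2 * c * variance a w - c ^+ 2 * w 1).
Proof.
move=> Na pw; have pp := plus_half_pf a pw; have pm := minus_half_pf a pw.
have [w0|w0] := eqVneq (w 1) 0.
  have wb b : w b = 0 by exact: pf_eq0.
  have z v b : (forall b, v b = 0) -> variance b v = 0.
    by move=> v0; rewrite /variance !v0 expr0n mul0r subrr.
  rewrite !z ?w0; first lra.
  - by move=> b; exact: pf_eq0.
  - by move=> b; rewrite /minus_half wb wb subrr mul0r.
  - by move=> b; rewrite /plus_half wb wb addr0 mul0r.
have w1 : 0 < w 1 by rewrite lt_def w0 pf1_ge0.
set Q := w 1 in w0 w1 *; set A := w a; set S := w (a * a).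
have eA : clip a = a by rewrite /clip Na.
have lA : `|A| <= Q by have := pf_le pw a; have := N_ge0 a; rewrite -/A -/Q; nra.
have VE : variance a w = S - A ^+ 2 / Q by [].
have Hp1 : plus_half a w 1 = (Q + A) / 2 by rewrite /plus_half eA mulr1.
have Hm1 : minus_half a w 1 = (Q - A) / 2 by rewrite /minus_half eA mulr1.
have Hpa : plus_half a w a = (A + S) / 2 by rewrite /plus_half eA.
have Hma : minus_half a w a = (A - S) / 2 by rewrite /minus_half eA.
have Hs : plus_half a w (a * a) + minus_half a w (a * a) = S.
  by rewrite /plus_half /minus_half /S; field.
have V0 := variance_ge0 a pw.
have tangent : 2 * c * variance a w - c ^+ 2 * Q <= variance a w ^+ 2 / Q.
  rewrite ler_pdivlMr// -subr_ge0.
  have -> : variance a w ^+ 2 - (2 * c * variance a w - c ^+ 2 * Q) * Q =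
    (variance a w - c * Q) ^+ 2 by ring.
  exact: sqr_ge0.
suff : A ^+ 2 / Q + variance a w ^+ 2 / Q <=
    ((A + S) / 2) ^+ 2 / ((Q + A) / 2) + ((A - S) / 2) ^+ 2 / ((Q - A) / 2).
  by rewrite [variance a (plus_half _ _)]/variance [variance a (minus_half _ _)]/variance Hp1 Hm1 Hpa Hma; lra.
move: lA; rewrite ler_norml => /andP[lA1 lA2].
have [qp|qp] := eqVneq (Q + A) 0.
  have := pf_eq0 pp a; rewrite Hp1 Hpa qp mul0r => /(_ erefl) AS.
  have EA : A = - Q by lra.
  have ES : S = Q by lra.
  rewrite VE ES EA.
  rewrite addNr mul0r expr0n mul0r add0r -subr_ge0.
  have -> : ((- Q - Q) / 2) ^+ 2 / ((Q - - Q) / 2) -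
    ((- Q) ^+ 2 / Q + (Q - (- Q) ^+ 2 / Q) ^+ 2 / Q) = 0 by field; lra.
  by [].
have [qm|qm] := eqVneq (Q - A) 0.
  have := pf_eq0 pm a; rewrite Hm1 Hma qm mul0r => /(_ erefl) AS.
  have EA : A = Q by lra.
  have ES : S = Q by lra.
  rewrite VE ES EA.
  rewrite subrr mul0r expr0n mul0r addr0 -subr_ge0.
  have -> : ((Q + Q) / 2) ^+ 2 / ((Q + Q) / 2) -
    (Q ^+ 2 / Q + (Q - Q ^+ 2 / Q) ^+ 2 / Q) = 0 by field; lra.
  by [].
have qp' : 0 < Q + A by rewrite lt_def qp; lra.
have qm' : 0 < Q - A by rewrite lt_def qm; lra.
rewrite VE -subr_ge0.
have -> : ((A + S) / 2) ^+ 2 / ((Q + A) / 2) +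
  ((A - S) / 2) ^+ 2 / ((Q - A) / 2) -
  (A ^+ 2 / Q + (S - A ^+ 2 / Q) ^+ 2 / Q) =
  (A * (S - A ^+ 2 / Q)) ^+ 2 / (Q * (Q + A) * (Q - A)).
  by field; rewrite w0 qp qm.
by rewrite divr_ge0 ?sqr_ge0// ltW// !mulr_gt0.
Qed.

(** If the infimum of the total variance over all lists of cuts were positive,
    one more cut along a would bring a nearly optimal list below it. *)
Lemma variance_small a w e : N a <= 1 -> positive_functional w -> 0 < e ->
  exists l, split_sum l (variance a) w < e.
Proof.
move=> Na pw e0; pose P := [set split_sum l (variance a) w | l in [set: seq B]].
have P0 : lbound P 0.
  move=> _ [l _ <-]; have <- : split_sum l (fun v => 0 * v 1) w = 0.
    by rewrite split_sumZ mul0r.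
  by apply: split_sum_le => // v pv; rewrite mul0r; exact: variance_ge0.
have hP : has_inf P by split; [exists (split_sum [::] (variance a) w), [::]|exists 0].
pose rho := inf P.
have rho0 : 0 <= rho by apply: lb_le_inf => //; case: hP.
have step c : 0 < c -> c <= 1/2 -> 2 * rho <= c * (1 + w 1).
  move=> c0 c1.
  have [_ [l _ <-] Hl] := inf_adherent (mulr_gt0 c0 c0) hP.
  have H : rho <= split_sum (l ++ [:: a]) (variance a) w.
    by apply: ge_inf; [case: hP|exists (l ++ [:: a])].
  have : split_sum (l ++ [:: a]) (variance a) w <=
      (1 - 2 * c) * split_sum l (variance a) w + c ^+ 2 * w 1.
    rewrite split_sum_cat -(split_sum_eval l 1 w) -!split_sumZ -split_sumD.
    apply: split_sum_le => // v pv /=.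
    by apply: (le_trans (variance_halves c Na pv)); lra.
  move: H; rewrite -/rho in Hl *; have := pf1_ge0 pw.
  by move: (split_sum l _ _) Hl => F; nra.
have re : rho < e.
  pose c := Num.min (1/2) (e / (1 + w 1)).
  have w1 : 0 < 1 + w 1 by have := pf1_ge0 pw; lra.
  have c0 : 0 < c by rewrite lt_min divr_gt0// divr_gt0.
  have c12 : c <= 1/2 by rewrite ge_min lexx.
  have := step c c0 c12.
  have : c * (1 + w 1) <= e by rewrite -ler_pdivlMr// ge_min lexx orbT.
  by lra.
have er : 0 < e - rho by rewrite subr_gt0.
have [_ [l _ <-] Hl] := inf_adherent er hP.
by exists l; move: Hl; rewrite -/rho; lra.
Qed.

Definition normalize (w : B -> R) (b : B) : R := w b / w 1.

(** Normalized positive functionals have this property, and so has 0; of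
    positivity it retains only that variances are nonnegative. *)
Definition quasi_character (x : B -> R) := [/\
  forall a b, x (a + b) = x a + x b,
  forall r b, x (iota r * b) = r * x b,
  forall b, `|x b| <= N b &
  forall b, x b ^+ 2 <= x (b * b)].

Lemma normalize_quasi_character w : positive_functional w ->
  quasi_character (normalize w).
Proof.
move=> pw; rewrite /normalize; split.
- by move=> a b; rewrite (pf_add pw) mulrDl.
- by move=> r b; rewrite (pf_scale pw) mulrA.
- move=> b; have [w0|w0] := eqVneq (w 1) 0; first by rewrite w0 invr0 mulr0 normr0.
  have w1 : 0 < w 1 by rewrite lt_def w0 pf1_ge0.
  by rewrite normrM normfV (gtr0_norm w1) ler_pdivrMr//; exact: pf_le.
- move=> b; have [w0|w0] := eqVneq (w 1) 0; first by rewrite w0 invr0 !mulr0 expr0n.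
  have w1 : 0 < w 1 by rewrite lt_def w0 pf1_ge0.
  have := variance_ge0 b pw; rewrite /variance subr_ge0 => H.
  have -> : (w b / w 1) ^+ 2 = w b ^+ 2 / w 1 / w 1 by field.
  by rewrite ler_wpM2r// invr_ge0 ltW.
Qed.

Lemma normalizeE w b : positive_functional w -> w 1 * normalize w b = w b.
Proof.
move=> pw; rewrite /normalize; have [w0|w0] := eqVneq (w 1) 0.
  by rewrite w0 mul0r (pf_eq0 pw).
by rewrite mulrC divfK.
Qed.

(** The discrete measure that puts the mass of each piece of w at its
    normalization. *)
Definition discrete (w : B -> R) l (E : set (B -> R)) : R :=
  split_sum l (fun v => v 1 * \1_E (normalize v)) w.

Lemma discrete_ge0 w l E : positive_functional w -> 0 <= discrete w l E.
Proof.
move=> pw; have <- : split_sum l (fun v => 0 * v 1) w = 0.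
  by rewrite split_sumZ mul0r.
by apply: split_sum_le => // v pv; rewrite mul0r mulr_ge0 ?pf1_ge0.
Qed.

Lemma discrete_le w l E : positive_functional w -> discrete w l E <= w 1.
Proof.
move=> pw; rewrite -(split_sum_eval l 1 w); apply: split_sum_le => // v pv.
by rewrite ler_piMr ?pf1_ge0// indicE lern1 leq_b1.
Qed.

Let refines : set_system (seq B) :=
  filter_from [set: seq B] (fun l0 => [set l | subseq l0 l]).

Let refines_filter : ProperFilter refines.
Proof.
apply: filter_from_proper; last by move=> l _; exists l => /=.
apply: filter_from_filter; first by exists [::].
move=> l1 l2 _ _; exists (l1 ++ l2) => // l /= H; split => /=.
  exact: subseq_trans (prefix_subseq _ _) H.
exact: subseq_trans (suffix_subseq _ _) H.
Qed.

(** The limit of the discrete measures along an ultrafilter of ever longer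
    lists of cuts. Since the total variance of a tends to 0, Chebyshev's
    inequality gives that functionals that are not multiplicative at a have
    mass 0. A pointwise bound of x b by a step function is inherited by w b,
    because v b = v 1 * x b for each piece v with normalization x. *)
Theorem positive_functional_content w : positive_functional w ->
  exists nu : set (B -> R) -> R, [/\
    [/\ forall E, 0 <= nu E,
    forall E F, E `&` F = set0 -> nu (E `|` F) = nu E + nu F,
    forall E, (forall x, quasi_character x -> ~ E x) -> nu E = 0 &
    nu setT = w 1],
    forall a e, N a <= 1 -> 0 < e ->
      nu [set x | e < x (a * a) - x a ^+ 2] = 0 &
    forall b (s : seq (R * set (B -> R))),
      (forall x, quasi_character x -> x b <= \sum_(p <- s) p.1 * \1_(p.2) x) ->
      w b <= \sum_(p <- s) p.1 * nu p.2].
Proof.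
move=> pw; have [U [UU sU]] := ultraFilterLemma refines_filter.
pose nu E := lim (discrete w l E @[l --> U]).
have nuP E : discrete w l E @[l --> U] --> nu E.
  apply: (@ultra_bounded_cvg _ _ _ _ 0 (w 1)) => //.
  by apply: nearW => l; rewrite discrete_ge0// discrete_le.
have nu_eq E r : (forall l, discrete w l E = r) -> nu E = r.
  move=> H; apply/cvg_lim => //.
  by under eq_cvg do rewrite H; exact: cvg_cst.
exists nu; split; first split.
- move=> E; apply: limr_ge; first by apply/cvg_ex; exists (nu E); exact: nuP.
  by apply: nearW => l; exact: discrete_ge0.
- move=> E F EF; apply/cvg_lim => //.
  rewrite (_ : (fun l => _) = (fun l => discrete w l E + discrete w l F)).
    by apply: cvgD; exact: nuP.
  apply/funext => l; rewrite /discrete -split_sumD; congr (split_sum _ _ _).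
  apply/funext => v; rewrite -mulrDr; congr (_ * _).
  rewrite !indicE in_setU.
  have [vE|vE] := boolP (_ \in E); have [vF|vF] := boolP (_ \in F) => //=; rewrite ?addr0 ?add0r//.
  have : (E `&` F) (normalize v) by split; exact: set_mem.
  by rewrite EF.
- move=> E HE; apply: nu_eq => l; apply/eqP; rewrite eq_le discrete_ge0// andbT.
  have <- : split_sum l (fun v => 0 * v 1) w = 0 by rewrite split_sumZ mul0r.
  apply: split_sum_le => // v pv; rewrite indicE memNset ?mulr0 ?mul0r//.
  exact/HE/normalize_quasi_character.
- apply: nu_eq => l; rewrite /discrete -[RHS](split_sum_eval l).
  by congr split_sum; apply/funext => v; rewrite indicT mulr1.
- move=> a e Na e0; apply/eqP; rewrite eq_le; apply/andP; split; last first.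
    apply: limr_ge; first by apply/cvg_ex; exists (nu [set x | e < x (a * a) - x a ^+ 2]); exact: nuP.
    by apply: nearW => l; exact: discrete_ge0.
  apply/ler_addgt0Pl => d d0; rewrite addr0.
  apply: limr_le; first by apply/cvg_ex; exists (nu [set x | e < x (a * a) - x a ^+ 2]); exact: nuP.
  have [l0 Hl0] := variance_small Na pw (mulr_gt0 d0 e0).
  apply: sU; exists l0 => // l /= ll.
  have H1 := split_sum_subseq (variance_superadditive a) pw ll.
  rewrite -(ler_pM2r e0); apply: le_trans (ltW Hl0); apply: le_trans H1.
  rewrite mulrC -split_sumZ; apply: split_sum_le => // v pv.
  have vE : variance a v = v 1 * (normalize v (a * a) - normalize v a ^+ 2).
    rewrite mulrBr normalizeE// expr2 mulrA normalizeE// /variance /normalize.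
    by rewrite mulrA expr2.
  rewrite vE indicE; have [|_] := boolP (_ \in _).
    rewrite inE /= => /ltW H; rewrite mulr1 mulrC; apply: ler_wpM2l H; exact: pf1_ge0.
  rewrite !mulr0 -vE; exact: variance_ge0.
- move=> b s H.
  have cv : (\sum_(p <- s) p.1 * discrete w l p.2) @[l --> U] -->
      (\sum_(p <- s) p.1 * nu p.2).
    elim: s {H} => [|p s IH].
      by under eq_cvg do rewrite big_nil; rewrite big_nil; exact: cvg_cst.
    under eq_cvg do rewrite big_cons; rewrite big_cons.
    by apply: cvgD => //; apply: cvgM; [exact: cvg_cst|exact: nuP].
  apply: (cvgr_to_ge cv); apply: nearW => l.
  rewrite -[leLHS](split_sum_eval l).
  have -> : \sum_(p <- s) p.1 * discrete w l p.2 =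
      split_sum l (fun v => v 1 * \sum_(p <- s) p.1 * \1_(p.2) (normalize v)) w.
    elim: s {H cv} => [|p s IH].
      rewrite big_nil; under [in RHS]eq_fun do rewrite big_nil mulr0.
      by rewrite -[LHS](mul0r (split_sum l (fun=> 0) w)) -split_sumZ; under eq_fun do rewrite mul0r.
    under [in RHS]eq_fun do rewrite big_cons mulrDr.
    rewrite big_cons split_sumD -IH; congr (_ + _).
    rewrite /discrete -split_sumZ; congr split_sum.
    by apply/funext => v; rewrite mulrCA.
  apply: split_sum_le => // v pv; rewrite -[leLHS](normalizeE b pv).
  apply: ler_wpM2l; [exact: pf1_ge0|exact/H/normalize_quasi_character].
Qed.

End Decomposition.

(** * Complex numbers and sesquilinear forms *)

Notation Re := complex.Re.
Notation Im := complex.Im.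
Notation conjC := (@conjc _).

Section ComplexNumbers.
Local Open Scope complex_scope.
Variable R : realType.
Implicit Types z w : R[i].

Definition cabs z : R := Re `|z|.

Lemma cabsE z : `|z| = (cabs z)%:C.
Proof. by rewrite RRe_real// ger0_real. Qed.

Lemma cabs_ge0 z : 0 <= cabs z.
Proof. by rewrite -ler0c -cabsE. Qed.

Lemma cabsM z w : cabs (z * w) = cabs z * cabs w.
Proof. by apply: complexI; rewrite rmorphM/= -!cabsE normrM. Qed.

Lemma cabsD z w : cabs (z + w) <= cabs z + cabs w.
Proof. by rewrite -lecR rmorphD/= -!cabsE ler_normD. Qed.

Lemma cabsN z : cabs (- z) = cabs z.
Proof. by rewrite /cabs normrN. Qed.

Lemma cabs0 : cabs 0 = 0.
Proof. by rewrite /cabs normr0. Qed.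

Lemma cabs_real (r : R) : cabs r%:C = `|r|.
Proof. by rewrite /cabs normc_def/= expr0n addr0 sqrtr_sqr. Qed.

Lemma cabs_conj z : cabs (conjC z) = cabs z.
Proof. by rewrite /cabs normcJ. Qed.

Lemma sqr_cabs z : cabs z ^+ 2 = Re z ^+ 2 + Im z ^+ 2.
Proof. by apply: complexI; rewrite rmorphXn/= -cabsE -add_Re2_Im2. Qed.

Lemma cabs_eq0 z : cabs z = 0 -> z = 0.
Proof. by move=> z0; apply/normr0_eq0; rewrite cabsE z0. Qed.

Lemma cabs_Re z : `|Re z| <= cabs z.
Proof.
by rewrite -ler_sqr ?nnegrE ?cabs_ge0// sqr_cabs real_normK ?num_real// lerDl sqr_ge0.
Qed.

Lemma cabs_Im z : `|Im z| <= cabs z.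
Proof.
by rewrite -ler_sqr ?nnegrE ?cabs_ge0// sqr_cabs real_normK ?num_real// lerDr sqr_ge0.
Qed.

Lemma cabs_le z : cabs z <= `|Re z| + `|Im z|.
Proof.
rewrite -ler_sqr ?nnegrE ?cabs_ge0 ?addr_ge0// sqr_cabs sqrrD !real_normK ?num_real//.
by rewrite addrAC lerDl mulrn_wge0// mulr_ge0.
Qed.

Lemma cabs_i : cabs 'i = 1.
Proof. by rewrite /cabs normc_def/= expr0n expr1n add0r sqrtr1. Qed.

Lemma ReD z w : Re (z + w) = Re z + Re w.
Proof. by case: z w => [a b] [c d]. Qed.
Lemma ImD z w : Im (z + w) = Im z + Im w.
Proof. by case: z w => [a b] [c d]. Qed.
Lemma ReN z : Re (- z) = - Re z.
Proof. by case: z. Qed.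
Lemma ImN z : Im (- z) = - Im z.
Proof. by case: z. Qed.
Lemma cReM z w : Re (z * w) = Re z * Re w - Im z * Im w.
Proof. by case: z w => [a b] [c d]. Qed.
Lemma cImM z w : Im (z * w) = Re z * Im w + Im z * Re w.
Proof. by case: z w => [a b] [c d]. Qed.
Lemma Re_conjc z : Re (conjC z) = Re z.
Proof. by case: z. Qed.
Lemma Im_conjc z : Im (conjC z) = - Im z.
Proof. by case: z. Qed.

Lemma conjCM z w : conjC (z * w) = conjC z * conjC w.
Proof. exact: rmorphM. Qed.
Lemma conjCD z w : conjC (z + w) = conjC z + conjC w.
Proof. exact: rmorphD. Qed.
Lemma conjCN z : conjC (- z) = - conjC z.
Proof. exact: rmorphN. Qed.
Lemma conjCX z n : conjC (z ^+ n) = conjC z ^+ n.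
Proof. exact: rmorphXn. Qed.

Lemma complex_eq z w : Re z = Re w -> Im z = Im w -> z = w.
Proof. by case: z w => [a b] [c d] /= -> ->. Qed.

Lemma ge0_complex z : 0 <= z <-> 0 <= Re z /\ Im z = 0.
Proof.
rewrite lecE; split; first by move=> /andP[/eqP -> ->].
by move=> [-> ->]; rewrite eqxx.
Qed.

Lemma conj_cabs z : conjC z * z = (cabs z ^+ 2)%:C.
Proof. by rewrite mulrC -sqr_normc cabsE -rmorphXn. Qed.

End ComplexNumbers.

Section SesquilinearForm.
Local Open Scope complex_scope.
Variables (R : realType) (V : lmodType R[i]) (s : V -> V -> R[i]).
Hypothesis sDl : forall a b c, s (a + b) c = s a c + s b c.
Hypothesis sDr : forall a b c, s a (b + c) = s a b + s a c.
Hypothesis sZl : forall z a b, s (z *: a) b = conjC z * s a b.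
Hypothesis sZr : forall z a b, s a (z *: b) = z * s a b.
Hypothesis s_ge0 : forall a, 0 <= s a a.

Lemma form_hermitian a b : s b a = conjC (s a b).
Proof.
have Im0 c : Im (s c c) = 0 by have /ge0_complex[] := s_ge0 c.
have H1 := Im0 (a + b); have H2 := Im0 (a + 'i *: b).
have H3 := Im0 a; have H4 := Im0 b.
move: H1 H2 H3 H4; rewrite !sDl !sDr !sZl !sZr.
case: (s a a) (s b b) (s a b) (s b a) => [x x'] [y y'] [p q] [p' q'] /=.
by move=> H1 H2 H3 H4; apply: complex_eq => /=; lra.
Qed.

Lemma form_cauchy_schwarz a b : cabs (s a b) ^+ 2 <= Re (s a a) * Re (s b b).
Proof.
have [->|p0] := eqVneq (cabs (s a b)) 0.
  by rewrite expr0n mulr_ge0//; have /ge0_complex[] := s_ge0 a; have /ge0_complex[] := s_ge0 b.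
set p := s a b in p0 *.
have pp : 0 < cabs p ^+ 2 by rewrite exprn_gt0// lt_def p0 cabs_ge0.
suff : (cabs p ^+ 2) ^+ 2 <= (cabs p ^+ 2 * Re (s b b)) * Re (s a a).
  rewrite [X in X <= _]expr2 -[X in _ <= X]mulrA ler_pM2l//.
  by rewrite mulrC.
(* The conjugate of p turns the cross term into the real number |p|^2. *)
apply: discriminant_le => r.
have := s_ge0 (a + (r%:C * conjC p) *: b); move/ge0_complex => [+ _].
rewrite !sDl !sDr !sZl !sZr (form_hermitian a b) -/p.
have -> : conjC (r%:C * conjC p) * (r%:C * conjC p * s b b) =
   r%:C * (r%:C * ((conjC p * p) * s b b)).
  by rewrite conjCM conjc_real conjcK; ring.
have -> : r%:C * conjC p * p = r%:C * (conjC p * p) by ring.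
have -> : conjC (r%:C * conjC p) * conjC p = r%:C * (conjC p * p).
  by rewrite conjCM conjc_real conjcK; ring.
rewrite conj_cabs !ReD !cReM /=.
by rewrite !(mul0r, mulr0, subr0, addr0); congr (_ <= _); ring.
Qed.

End SesquilinearForm.

(** * Rings of commuting elements *)

Record commuting_subring (U : nzRingType) (P : set U) : Prop := {
  cs1 : P 1;
  csB : forall a b, P a -> P b -> P (a - b);
  csM : forall a b, P a -> P b -> P (a * b);
  cscomm : forall a b, P a -> P b -> a * b = b * a }.

Section CommutingSubring.
Variables (U : nzRingType) (P : set U).
Definition comsub_pred (_ : commuting_subring P) : {pred U} := fun x => `[< P x >].
(** Commutativity of the ring rests on the proof HP, which is therefore a
    parameter of the type. *)
Definition comsub (HP : commuting_subring P) := {x : U | comsub_pred HP x}.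
Variable (HP : commuting_subring P).

Lemma comsub_closed : subring_closed (comsub_pred HP).
Proof.
split; rewrite /comsub_pred.
- exact/asboolP/(cs1 HP).
- by move=> a b /asboolP Pa /asboolP Pb; exact/asboolP/(csB HP).
- by move=> a b /asboolP Pa /asboolP Pb; exact/asboolP/(csM HP).
Qed.

HB.instance Definition _ := GRing.isSubringClosed.Build U (comsub_pred HP) comsub_closed.
HB.instance Definition _ := [isSub of comsub HP for @sval U (comsub_pred HP)].
HB.instance Definition _ := [Choice of comsub HP by <:].
HB.instance Definition _ := [SubChoice_isSubNzRing of comsub HP by <:].

Lemma comsubP (x : comsub HP) : P (val x).
Proof. by apply/asboolP; exact: (valP x). Qed.

Lemma comsub_mulC : commutative (@GRing.mul (comsub HP)).
Proof.
by move=> x y; apply: val_inj; rewrite !rmorphM/=; apply: (cscomm HP); exact: comsubP.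
Qed.

HB.instance Definition _ := GRing.PzRing_hasCommutativeMul.Build (comsub HP) comsub_mulC.

Definition to_comsub (x : U) (Px : P x) : comsub HP := exist _ x (asboolT Px).

End CommutingSubring.

(** * Norm and adjoint; the unitization as an algebra *)

Section CStarBasics.
Local Open Scope complex_scope.
Variables (R : realType) (A : cstarType R).
Implicit Types (a b c : A) (z : R[i]).

Lemma rnormE a : `|a| = (rnorm a)%:C.
Proof. by rewrite RRe_real// ger0_real. Qed.

Lemma rnorm_ge0 a : 0 <= rnorm a.
Proof. by rewrite -ler0c -rnormE. Qed.

Lemma rnorm0 : rnorm (0 : A) = 0.
Proof. by rewrite /rnorm normr0. Qed.

Lemma rnorm_eq0 a : rnorm a = 0 -> a = 0.
Proof. by move=> a0; apply/normr0_eq0; rewrite rnormE a0. Qed.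

Lemma rnormD a b : rnorm (a + b) <= rnorm a + rnorm b.
Proof. by rewrite -lecR rmorphD/= -!rnormE ler_normD. Qed.

Lemma rnormN a : rnorm (- a) = rnorm a.
Proof. by rewrite /rnorm normrN. Qed.

Lemma rnormB a b : rnorm (a - b) <= rnorm a + rnorm b.
Proof. by rewrite -(rnormN b); exact: rnormD. Qed.

Lemma rnorm_sub a b : rnorm (a - b) = rnorm (b - a).
Proof. by rewrite -rnormN opprB. Qed.

Lemma rnormZ z a : rnorm (z *: a) = cabs z * rnorm a.
Proof. by apply: complexI; rewrite rmorphM/= -!rnormE -cabsE normrZ. Qed.

Lemma rnormM a b : rnorm (a ** b) <= rnorm a * rnorm b.
Proof. by rewrite -lecR rmorphM/= -!rnormE cnormM. Qed.

Lemma rnorm_star_mul a : rnorm (cstar a ** a) = rnorm a ^+ 2.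
Proof. by apply: complexI; rewrite rmorphXn/= -!rnormE cnorm_star. Qed.

Lemma rnorm_star a : rnorm (cstar a) = rnorm a.
Proof.
have H b : rnorm b <= rnorm (cstar b).
  have [->|b0] := eqVneq (rnorm b) 0; first exact: rnorm_ge0.
  have bp : 0 < rnorm b by rewrite lt_def b0 rnorm_ge0.
  by rewrite -(ler_pM2r bp) -expr2 -rnorm_star_mul; exact: rnormM.
by apply/eqP; rewrite eq_le H -{2}(cstarK a) H.
Qed.

Lemma rnorm_mul_star a : rnorm (a ** cstar a) = rnorm a ^+ 2.
Proof. by rewrite -{1}(cstarK a) rnorm_star_mul rnorm_star. Qed.

Lemma cmul0l a : 0 ** a = 0.
Proof. by have := cmulZl 0 (0 : A) a; rewrite !scale0r. Qed.
Lemma cmul0r a : a ** 0 = 0.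
Proof. by have := cmulZr 0 a (0 : A); rewrite !scale0r. Qed.
Lemma cmulNl a b : (- a) ** b = - (a ** b).
Proof. by rewrite -scaleN1r cmulZl scaleN1r. Qed.
Lemma cmulNr a b : a ** (- b) = - (a ** b).
Proof. by rewrite -scaleN1r cmulZr scaleN1r. Qed.
Lemma cmulBl a b c : (a - b) ** c = a ** c - b ** c.
Proof. by rewrite cmulDl cmulNl. Qed.
Lemma cmulBr a b c : a ** (b - c) = a ** b - a ** c.
Proof. by rewrite cmulDr cmulNr. Qed.
Lemma cstar0 : cstar (0 : A) = 0.
Proof. by have := cstarZ 0 (0 : A); rewrite conjc0 !scale0r. Qed.
Lemma cstarN a : cstar (- a) = - cstar a.
Proof. by rewrite -scaleN1r cstarZ conjCN conjc1 scaleN1r. Qed.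
Lemma cstarB a b : cstar (a - b) = cstar a - cstar b.
Proof. by rewrite cstarD cstarN. Qed.

End CStarBasics.

(** The product type has the componentwise structure, so the product of A + C
    1 is attached to an alias. Also for unital A the unit (0, 1) is a new one. *)
Definition unitized (R : realType) (A : cstarType R) := (A * R[i]^o)%type.

Section Unitized.
Local Open Scope complex_scope.
Variables (R : realType) (A : cstarType R).
Implicit Types (a b c : A) (z : R[i]).
Local Notation uA := (unitized A).

HB.instance Definition _ := GRing.Lmodule.copy uA (A * R[i]^o)%type.

Definition umul (x y : uA) : uA :=
  (x.1 ** y.1 + (y.2 : R[i]) *: x.1 + (x.2 : R[i]) *: y.1, (x.2 : R[i]) * y.2).

Lemma unitizedP (x y : uA) : x.1 = y.1 -> x.2 = y.2 -> x = y.
Proof. by case: x y => [a z] [b w] /= -> ->. Qed.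

Let umulA : associative umul.
Proof.
move=> x y t; apply: unitizedP; rewrite /= ?mulrA//.
rewrite !cmulDl !cmulDr !cmulZl !cmulZr !scalerDr !scalerA cmulA.
rewrite [t.2 * x.2]mulrC [t.2 * y.2]mulrC !addrA.
by rewrite [LHS](ACl (1*3*5*2*4*6*7)).
Qed.

Let umul1l : left_id ((0, 1) : uA) umul.
Proof. by move=> x; apply: unitizedP => /=; rewrite ?cmul0l ?scaler0 ?scale1r ?add0r ?mul1r. Qed.
Let umul1r : right_id ((0, 1) : uA) umul.
Proof. by move=> x; apply: unitizedP => /=; rewrite ?cmul0r ?scaler0 ?scale1r ?add0r ?addr0 ?mulr1. Qed.
Let umulDl : left_distributive umul +%R.
Proof.
move=> x y t; apply: unitizedP; rewrite /= ?mulrDl//.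
by rewrite cmulDl scalerDr scalerDl !addrA [LHS](ACl (1*3*5*2*4*6)).
Qed.
Let umulDr : right_distributive umul +%R.
Proof.
move=> x y t; apply: unitizedP; rewrite /= ?mulrDr//.
by rewrite cmulDr scalerDr scalerDl !addrA [LHS](ACl (1*3*5*2*4*6)).
Qed.
Let uone_neq0 : ((0, 1) : uA) != 0.
Proof. by apply/eqP => -[] /eqP; rewrite oner_eq0. Qed.

HB.instance Definition _ := GRing.Zmodule_isNzRing.Build uA
  umulA umul1l umul1r umulDl umulDr uone_neq0.

Definition uin a : uA := (a, 0).

Lemma umulE (x y : uA) : x * y = umul x y. Proof. by []. Qed.

Lemma uone1 : (1 : uA) = (0, 1). Proof. by []. Qed.

Lemma uscalel z (x y : uA) : (z *: x) * y = z *: (x * y).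
Proof.
apply: unitizedP => /=; last by rewrite /GRing.scale/= mulrA.
by rewrite cmulZl !scalerDr !scalerA [z * y.2]mulrC.
Qed.

Lemma uscaler z (x y : uA) : x * (z *: y) = z *: (x * y).
Proof.
apply: unitizedP => /=; last by rewrite /GRing.scale/= mulrCA.
by rewrite cmulZr !scalerDr !scalerA [z * x.2]mulrC.
Qed.

Lemma uinD a b : uin (a + b) = uin a + uin b.
Proof. by apply: unitizedP; rewrite /= ?addr0. Qed.
Lemma uinN a : uin (- a) = - uin a.
Proof. by apply: unitizedP; rewrite /= ?oppr0. Qed.
Lemma uinB a b : uin (a - b) = uin a - uin b.
Proof. by rewrite uinD uinN. Qed.
Lemma uinZ z a : uin (z *: a) = z *: uin a.
Proof. by apply: unitizedP; rewrite /= ?scaler0. Qed.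
Lemma uinM a b : uin (a ** b) = uin a * uin b.
Proof. by apply: unitizedP; rewrite /= ?scale0r ?addr0 ?mulr0. Qed.
Lemma uin_inj : injective uin. Proof. by move=> a b []. Qed.

Lemma uactE (x : uA) b : uin (uact x b) = x * uin b.
Proof. by apply: unitizedP; rewrite /= ?mulr0// scale0r addr0. Qed.

Lemma ustarK (x : uA) : ustar (ustar x) = x :> uA.
Proof. by apply: unitizedP; rewrite /= ?cstarK ?conjcK. Qed.
Lemma ustarD (x y : uA) : ustar (x + y) = (ustar x : uA) + ustar y.
Proof. by apply: unitizedP; rewrite /= ?cstarD ?rmorphD. Qed.
Lemma ustarN (x : uA) : ustar (- x) = - (ustar x : uA).
Proof. by apply: unitizedP => /=; [exact: cstarN|exact: conjCN]. Qed.
Lemma ustarB (x y : uA) : ustar (x - y) = (ustar x : uA) - ustar y.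
Proof. by rewrite ustarD ustarN. Qed.
Lemma ustarZ z (x : uA) : ustar (z *: x) = conjC z *: (ustar x : uA).
Proof. by apply: unitizedP => /=; [exact: cstarZ|exact: conjCM]. Qed.
Lemma ustarM (x y : uA) : ustar (x * y) = (ustar y : uA) * ustar x.
Proof.
apply: unitizedP => /=; last by rewrite mulrC; exact: conjCM.
by rewrite !cstarD !cstarZ cstarM addrAC.
Qed.
Lemma ustar1 : ustar (1 : uA) = 1 :> uA.
Proof. by rewrite uone1; apply: unitizedP; [exact: cstar0|exact: conjc1]. Qed.
Lemma ustar_in a : ustar (uin a) = uin (cstar a) :> uA.
Proof. by apply: unitizedP => //; exact: conjc0. Qed.

(** The l1-norm, a submultiplicative substitute for the C*-norm wherever mere
    boundedness matters. *)
Definition unorm1 (x : uA) : R := rnorm x.1 + cabs x.2.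

Lemma unorm1_ge0 x : 0 <= unorm1 x.
Proof. by rewrite addr_ge0 ?rnorm_ge0 ?cabs_ge0. Qed.

Lemma unorm1M x y : unorm1 (x * y) <= unorm1 x * unorm1 y.
Proof.
rewrite /unorm1 /= mulrDl !mulrDr cabsM addrA lerD2r.
apply: (le_trans (rnormD _ _)).
apply: lerD; last by rewrite rnormZ.
apply: (le_trans (rnormD _ _)); apply: lerD; first exact: rnormM.
by rewrite rnormZ mulrC.
Qed.

Lemma unorm1D x y : unorm1 (x + y) <= unorm1 x + unorm1 y.
Proof. by rewrite /unorm1 /= addrACA; apply: lerD; [exact: rnormD|exact: cabsD]. Qed.

Lemma unorm1Z z x : unorm1 (z *: x) = cabs z * unorm1 x.
Proof. by rewrite /unorm1 /= rnormZ /GRing.scale/= cabsM mulrDr. Qed.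

Lemma unorm1_star (x : uA) : unorm1 (ustar x) = unorm1 x.
Proof. by rewrite /unorm1 /= rnorm_star cabs_conj. Qed.

Lemma unorm1_in a : unorm1 (uin a) = rnorm a.
Proof. by rewrite /unorm1 /= cabs0 addr0. Qed.

Lemma uact_le (x : uA) b : rnorm (uact x b) <= unorm1 x * rnorm b.
Proof.
rewrite -(unorm1_in (uact x b)) uactE; apply: (le_trans (unorm1M _ _)).
by rewrite unorm1_in.
Qed.

(** By the C*-identity both squared norms are the norm of b* x* x b. *)
Lemma normal_rnorm (x : uA) b : (ustar x : uA) * x = x * ustar x ->
  rnorm (uact (ustar x) b) = rnorm (uact x b).
Proof.
move=> nx.
have : cstar (uact (ustar x) b) ** uact (ustar x) b =
    cstar (uact x b) ** uact x b.
  apply: uin_inj; rewrite !uinM -!ustar_in !uactE !ustarM ustarK.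
  by rewrite -!mulrA; congr (_ * _); rewrite !mulrA nx.
move/(congr1 (@rnorm _ _)); rewrite !rnorm_star_mul => /eqP.
by rewrite eqrXn2 ?rnorm_ge0// => /eqP.
Qed.

End Unitized.

(** * Contractions, resolvents and approximate units *)

Section FixedPoint.
Variables (R : realType) (A : cstarType R).
Local Open Scope complex_scope.

Lemma rnorm_cvg (u : nat -> A) (l : A) : u @ \oo --> l ->
  forall e : R, 0 < e -> \forall n \near \oo, rnorm (l - u n) < e.
Proof.
move=> ul e e0; have ec : 0 < e%:C by rewrite ltcR.
move/cvgrPdist_lt : ul => /(_ _ ec); apply: filterS => n; rewrite rnormE ltcR.
by [].
Qed.

Lemma geometric_small (q C e : R) : 0 <= q -> q < 1 -> 0 < e ->
  \forall n \near \oo, C * q ^+ n < e.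
Proof.
move=> q0 q1 e0.
have H : (fun n => C * q ^+ n) @ \oo --> (0 : R).
  rewrite -[X in _ --> X](mulr0 C); apply: cvgM; first exact: cvg_cst.
  by apply: cvg_expr; rewrite ger0_norm.
by move/cvgr_lt : H => /(_ _ e0).
Qed.

(** Banach's fixed point theorem; it solves equations such as c = b + b c, for
    which a Neumann series would need a unit. *)
Theorem contraction_fixed_point (M : set A) (F : A -> A) (q : R) :
  closed M -> M !=set0 -> (forall a, M a -> M (F a)) -> 0 <= q -> q < 1 ->
  (forall a b, M a -> M b -> rnorm (F a - F b) <= q * rnorm (a - b)) ->
  exists2 a, M a & F a = a.
Proof.
move=> cM [a0 Ma0] FM q0 q1 Fq.
pose u n := iter n F a0; pose d := rnorm (F a0 - a0).
have Mu n : M (u n) by elim: n => //= n; exact: FM.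
have uS n : rnorm (u n.+1 - u n) <= d * q ^+ n.
  elim: n => [|n IH]; first by rewrite expr0 mulr1.
  apply: (@le_trans _ _ (q * rnorm (u n.+1 - u n))); first exact: (Fq _ _ (Mu n.+1) (Mu n)).
  by rewrite exprS mulrCA ler_wpM2l.
have q1' : 0 < 1 - q by rewrite subr_gt0.
have um n m : rnorm (u (n + m)%N - u n) <= d / (1 - q) * q ^+ n * (1 - q ^+ m).
  elim: m => [|m IH]; first by rewrite addn0 subrr rnorm0 expr0 subrr mulr0.
  rewrite addnS -(subrKA (u (n + m)%N)).
  apply: (le_trans (rnormD _ _)); apply: (le_trans (lerD (uS _) IH)).
  rewrite exprD exprS -subr_ge0.
  by have -> : d / (1 - q) * q ^+ n * (1 - q * q ^+ m) -
     (d * (q ^+ n * q ^+ m) + d / (1 - q) * q ^+ n * (1 - q ^+ m)) = 0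
     by field; rewrite gt_eqF.
have d0 : 0 <= d by exact: rnorm_ge0.
have um' n m : rnorm (u (n + m)%N - u n) <= d / (1 - q) * q ^+ n.
  apply: (le_trans (um n m)); rewrite ler_piMr//.
    by rewrite mulr_ge0 ?exprn_ge0// divr_ge0// ltW.
  by rewrite gerBl exprn_ge0.
have cu : cvg (u @ \oo).
  apply: cauchy_cvg; apply: cauchy_exP => e.
  move=> e0; have eR : e = (Re e)%:C by rewrite RRe_real// gtr0_real.
  have e0' : 0 < Re e by rewrite -ltcR -eR.
  have [n _ Hn] := geometric_small (d / (1 - q)) q0 q1 e0'.
  exists (u n); exists n => // m /= nm.
  rewrite -ball_normE /= eR rnormE ltcR rnorm_sub -(subnKC nm).
  by apply: (le_lt_trans (um' _ _)); apply: Hn => /=.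
have [l ul] := (cvg_ex (u @ \oo)).1 cu.
have Ml : M l by apply: (@closed_cvg _ _ \oo _ u M cM _ l ul); exact: nearW.
exists l => //; apply/eqP; rewrite -subr_eq0; apply/eqP; apply: rnorm_eq0.
apply/eqP; rewrite eq_le rnorm_ge0 andbT; apply/ler_addgt0Pl => e e0; rewrite addr0.
have e2 : 0 < e / 2 by rewrite divr_gt0.
have [n _ Hn] := rnorm_cvg ul e2.
have H1 := Hn n (leqnn n); have H2 := Hn n.+1 (leqnSn n).
rewrite -(subrKA (u n.+1)).
apply: (le_trans (rnormD _ _)); rewrite [rnorm (u _ - l)]rnorm_sub.
have := Fq l (u n) Ml (Mu n).
have := rnorm_ge0 (l - u n).
by move: H1 H2; rewrite /= => H1 H2 H3 H4; nra.
Qed.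

End FixedPoint.

Section Resolvent.
Local Open Scope complex_scope.
Variables (R : realType) (A : cstarType R) (M : set A).
Hypothesis HM : abelian_csubalgebra M.
Implicit Types (a b c h y : A) (d : R).
Local Notation uA := (unitized A).

Lemma csubN a : M a -> M (- a).
Proof. by move=> Ma; rewrite -scaleN1r; exact: csubZ. Qed.

Lemma csubB a b : M a -> M b -> M (a - b).
Proof. by move=> Ma Mb; apply: csubD => //; exact: csubN. Qed.

(** The element h + id of the unitization. *)
Definition ishift h d : uA := (h, d *i).

Lemma cabs_im d : cabs (d *i) = `|d|.
Proof. by rewrite /cabs normc_def/= expr0n add0r sqrtr_sqr. Qed.

Lemma uact_ishift h d y : uact (ishift h d) y = h ** y + d *i *: y.
Proof. by []. Qed.

Lemma uactBr (x : uA) a b : uact x (a - b) = uact x a - uact x b.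
Proof. by rewrite /uact cmulBr scalerBr opprD addrACA. Qed.

Lemma uact_mulr (x : uA) a b : uact x (a ** b) = uact x a ** b.
Proof. by rewrite /uact cmulDl cmulA cmulZl. Qed.

Lemma uactM (x : uA) a : M x.1 -> M a -> M (uact x a).
Proof. by move=> Mx Ma; apply: (csubD HM); [exact: csubM|exact: csubZ]. Qed.

(** The elements h + id and h - id are adjoint to each other and commute, so
    they multiply y to elements of equal norm; h y and i d y are half the sum
    and half the difference of these. *)
Lemma ishift_norm h d y : cstar h = h ->
  rnorm (h ** y) <= rnorm (uact (ishift h d) y) /\
  `|d| * rnorm y <= rnorm (uact (ishift h d) y).
Proof.
move=> sh; have E : rnorm (uact (ustar (ishift h d)) y) = rnorm (uact (ishift h d) y).
  apply: normal_rnorm; apply: unitizedP => /=; last by rewrite mulrC.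
  by rewrite sh -!addrA [X in _ + X]addrC.
have H1 : (2%:R : R)%:C *: (h ** y) = uact (ishift h d) y + uact (ustar (ishift h d)) y.
  rewrite /uact /= sh addrACA -scalerDl.
  have -> : (d *i : R[i]) + (0 -i* d) = 0 by apply: complex_eq => /=; rewrite ?addr0// subrr.
  by rewrite scale0r addr0 -mulr2n -[RHS]scaler_nat; congr (_ *: _); rewrite [LHS](rmorph_nat (real_complex R)).
have H2 : (2%:R * d) *i *: y = uact (ishift h d) y - uact (ustar (ishift h d)) y.
  rewrite /uact /= sh opprD addrACA subrr add0r -scalerBl.
  by congr (_ *: _); apply: complex_eq => /=; rewrite ?subr0// opprK mulrDl mul1r.
have := rnormD (uact (ishift h d) y) (uact (ustar (ishift h d)) y).
have := rnormB (uact (ishift h d) y) (uact (ustar (ishift h d)) y).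
rewrite -H1 -H2 !rnormZ E cabs_im cabs_real normrM !(ger0_norm (ler0n _ 2)).
by move=> K1 K2; split; lra.
Qed.

Lemma ishift_solve_large h d c : cstar h = h -> M h -> rnorm h < d -> M c ->
  exists2 y, M y & uact (ishift h d) y = c.
Proof.
move=> sh Mh hd Mc; have d0 : 0 < d by exact: le_lt_trans (rnorm_ge0 h) hd.
have di0 : (d *i : R[i]) != 0.
  by rewrite eq_complex /= eqxx andTb gt_eqF.
have cd : cabs (d *i)^-1 = d^-1.
  have : cabs (d *i)^-1 * d = 1.
    by rewrite -{2}(gtr0_norm d0) -cabs_im -cabsM mulVf// cabs_real normr1.
  by move/(congr1 (fun x => x / d)); rewrite mulfK ?gt_eqF// mul1r.
have [||||a b Ma Mb|y My Fy] := @contraction_fixed_point R A M (fun y => (d *i)^-1 *: (c - h ** y)) (rnorm h / d) (csub_closed HM).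
- by exists 0; exact: csub0.
- by move=> a Ma; apply: (csubZ HM); apply: csubB => //; exact: csubM.
- by rewrite divr_ge0 ?rnorm_ge0// ltW.
- by rewrite ltr_pdivrMr// mul1r.
- rewrite -scalerBr rnormZ cd opprD addrACA subrr add0r opprK -[- _ + _]addrC -cmulBr.
  rewrite [rnorm h / d]mulrC -mulrA ler_wpM2l ?invr_ge0 ?(ltW d0)//.
  by rewrite (rnorm_sub a); exact: rnormM.
exists y => //; rewrite uact_ishift -{2}Fy scalerA divff// scale1r.
by rewrite addrC subrK.
Qed.

(** For D above the norm of h, h + iD is invertible on M with inverse bounded
    by 1 / D. The equation (h + id) y = c is the fixed point equation y = (h +
    iD)^-1 (c + i (D - d) y), a contraction of ratio (D - d) / D. *)
Lemma ishift_solve h d c : cstar h = h -> M h -> 0 < d -> M c ->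
  exists2 y, M y & uact (ishift h d) y = c.
Proof.
move=> sh Mh d0 Mc.
have [hd|hd] := ltP (rnorm h) d; first exact: ishift_solve_large.
pose D := rnorm h + 1; have hD : rnorm h < D by rewrite ltrDl.
have D0 : 0 < D by exact: lt_trans (le_lt_trans hd hD).
have [S HS] : {S : A -> A & forall a, M a -> M (S a) /\ uact (ishift h D) (S a) = a}.
  apply: (@choice _ _ (fun a y => M a -> M y /\ uact (ishift h D) y = a)) => a.
  have [Ma|nMa] := EM (M a); last by exists 0.
  by have [y My Hy] := ishift_solve_large sh Mh hD Ma; exists y.
have MS a : M a -> M (S a) by move=> /HS[].
have SE a : M a -> uact (ishift h D) (S a) = a by move=> /HS[].
have Sl a b : M a -> M b -> D * rnorm (S a - S b) <= rnorm (a - b).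
  move=> Ma Mb; have [_] := ishift_norm D (S a - S b) sh.
  by rewrite uactBr !SE// gtr0_norm.
have MF a : M a -> M (c + (D - d) *i *: a).
  by move=> Ma; apply: (csubD HM) => //; exact: csubZ.
have [||||a b Ma Mb|y My Fy] := @contraction_fixed_point R A M (fun y => S (c + (D - d) *i *: y)) ((D - d) / D) (csub_closed HM).
- by exists 0; exact: csub0.
- by move=> a Ma; apply: MS; exact: MF.
- by rewrite divr_ge0 ?(ltW D0)//; lra.
- by rewrite ltr_pdivrMr// mul1r; lra.
- have := Sl _ _ (MF a Ma) (MF b Mb).
  rewrite opprD addrACA subrr add0r -scalerBr rnormZ cabs_im.
  rewrite ger0_norm; last by lra.
  by rewrite mulrAC ler_pdivlMr// mulrC.
exists y => //; have := SE _ (MF y My); rewrite Fy !uact_ishift => /eqP.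
rewrite -subr_eq -addrA -scalerBl => /eqP <-.
by congr (_ + _ *: _); apply: complex_eq => /=; lra.
Qed.

Lemma ishift_inj h d a b : cstar h = h -> 0 < d ->
  uact (ishift h d) a = uact (ishift h d) b -> a = b.
Proof.
move=> sh d0 E; apply/eqP; rewrite -subr_eq0; apply/eqP/rnorm_eq0.
have [_] := ishift_norm d (a - b) sh; rewrite uactBr E subrr rnorm0 gtr0_norm//.
by rewrite pmulr_rle0// => H; apply/eqP; rewrite eq_le H rnorm_ge0.
Qed.

(** The element y = h (h + id)^-1. With (h + id) y' = y* one has y y* = h y',
    hence |y|^2 = |h y'| <= |(h + id) y'| = |y|. *)
Lemma cayley h d : cstar h = h -> M h -> 0 < d ->
  exists y, [/\ M y, rnorm y <= 1 & uact (ishift h d) y = h].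
Proof.
move=> sh Mh d0; have [y My Hy] := ishift_solve sh Mh d0 Mh.
exists y; split => //.
have Msy : M (cstar y) by exact: csub_star.
have [y' My' Hy'] := ishift_solve sh Mh d0 Msy.
have E : y ** cstar y = h ** y'.
  apply: (ishift_inj sh d0); rewrite uact_mulr Hy -[in LHS]Hy' /uact /=.
  by rewrite !cmulDr !cmulZr.
have : rnorm y ^+ 2 <= rnorm y.
  rewrite -rnorm_mul_star E -[X in _ <= X]rnorm_star -Hy'.
  by have [] := ishift_norm d y' sh.
have [->|y0] := eqVneq (rnorm y) 0; first by rewrite ler01.
have yp : 0 < rnorm y by rewrite lt_def y0 rnorm_ge0.
by rewrite expr2 -{3}(mul1r (rnorm y)) ler_pM2r.
Qed.

Lemma cayley_unit h d y : cstar h = h -> 0 < d -> rnorm y <= 1 ->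
  uact (ishift h d) y = h -> rnorm (h - h ** y) <= d.
Proof.
move=> sh d0 y1 E; rewrite -{1}E uact_ishift addrC addKr rnormZ cabs_im.
by rewrite gtr0_norm// ler_piMr// ltW.
Qed.

(** The members of an approximate identity need not be bounded. For u among
    them and h = u u*, the contraction h (h + id)^-1 acts almost as a unit on
    u, and therefore on a, which is close to u a. *)
Lemma approximate_unit a (e : R) : has_approximate_identity M -> 0 < e ->
  exists y, [/\ M y, rnorm y <= 1 & rnorm (y ** a - a) <= e].
Proof.
move=> [F [FF FM Fa]] e0.
have e4 : 0 < e / 4 by rewrite divr_gt0.
have [u [Mu Hu]] : exists u, M u /\ rnorm (a - u ** a) < e / 4.
  have ec : 0 < (e / 4)%:C by rewrite ltcR.
  have [/cvgrPdist_lt /(_ _ ec) H _] := Fa a.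
  have [u [Mu Hu]] := filter_ex (filterI FM H).
  by exists u; split => //; move: Hu; rewrite rnormE ltcR.
pose h := u ** cstar u.
have sh : cstar h = h by rewrite /h cstarM cstarK.
have Msu : M (cstar u) by exact: csub_star.
have Mh : M h by exact: csubM.
(* With this n, |u - y u| <= n gives |(u - y u) a| <= e / 4. *)
pose n := e / (4 * (rnorm a + 1)).
have n0 : 0 < n by rewrite divr_gt0// mulr_gt0// ltr_wpDl// rnorm_ge0.
have d0 : 0 < n ^+ 2 / 2 by rewrite divr_gt0// exprn_gt0.
have [y [My y1 Hy]] := cayley sh Mh d0.
exists y; split => //.
have hy := cayley_unit sh d0 y1 Hy.
have uy : rnorm (u - y ** u) <= n.
  have : rnorm (u - y ** u) ^+ 2 <= n ^+ 2.
    rewrite -rnorm_mul_star.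
    have -> : (u - y ** u) ** cstar (u - y ** u) =
        (h - h ** y) - (h - h ** y) ** cstar y.
      rewrite cstarB cstarM cmulBl !cmulBr !cmulBl.
      rewrite (csub_comm HM Mh My) /h !cmulA.
      by rewrite !opprB !addrA [LHS](ACl (1*4*3*2)).
    apply: (le_trans (rnormB _ _)).
    have := rnormM (h - h ** y) (cstar y); rewrite rnorm_star.
    have := rnorm_ge0 (h - h ** y); have := rnorm_ge0 y; nra.
  by rewrite ler_sqr ?nnegrE ?rnorm_ge0// ltW.
have -> : y ** a - a = y ** (a - u ** a) - (u - y ** u) ** a - (a - u ** a).
  by rewrite cmulBr cmulBl cmulA !opprB !addrA !subrK.
apply: (le_trans (rnormB _ _)); apply: (@le_trans _ _ (e/4 + e/4 + e/4)); last by lra.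
apply: lerD; last exact: ltW.
apply: (le_trans (rnormB _ _)); apply: lerD.
  apply: (le_trans (rnormM _ _)); apply: le_trans (ltW Hu).
  by rewrite ler_piMl// rnorm_ge0.
apply: (le_trans (rnormM _ _)); have ra := rnorm_ge0 a.
apply: (@le_trans _ _ (n * rnorm a)); first by rewrite ler_wpM2r.
have -> : e / 4 = n * (rnorm a + 1) by rewrite /n; field; lra.
by rewrite ler_wpM2l ?(ltW n0)// lerDl.
Qed.

End Resolvent.

(** * States and their extension to the unitization *)

Section States.
Local Open Scope complex_scope.
Variables (R : realType) (A : cstarType R) (M : set A).
Hypothesis HM : abelian_csubalgebra M.
Hypothesis HI : has_approximate_identity M.
Local Notation uA := (unitized A).
Variable phi : A -> R[i].
Hypothesis phi_state : @states R A phi.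
Implicit Types (a b : A) (x y : uA) (z : R[i]).

Lemma state_lin z a b : phi (z *: a + b) = z * phi a + phi b.
Proof. by case: phi_state => -[+ _] _ _; apply. Qed.

Lemma state0 : phi 0 = 0.
Proof. by have := state_lin (-1) 0 0; rewrite scaler0 addr0 mulN1r addNr. Qed.

Lemma stateD a b : phi (a + b) = phi a + phi b.
Proof. by have := state_lin 1 a b; rewrite scale1r mul1r. Qed.

Lemma stateZ z a : phi (z *: a) = z * phi a.
Proof. by have := state_lin z a 0; rewrite !addr0 state0 addr0. Qed.

Lemma stateN a : phi (- a) = - phi a.
Proof. by rewrite -scaleN1r stateZ mulN1r. Qed.

Lemma stateB a b : phi (a - b) = phi a - phi b.
Proof. by rewrite stateD stateN. Qed.

Lemma state_has_sup : has_sup [set complex.Re `|phi a| | a in [set a | rnorm a <= 1]].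
Proof.
apply: contrapT => /sup_out; case: phi_state => _ _; rewrite /dual_norm => -> /eqP.
by rewrite oner_eq0.
Qed.

Lemma state_le a : cabs (phi a) <= rnorm a.
Proof.
have H b : rnorm b <= 1 -> cabs (phi b) <= 1.
  move=> b1; have [_ _ <-] := phi_state; apply: ub_le_sup.
    by case: state_has_sup.
  by exists b.
have [a0|a0] := eqVneq (rnorm a) 0.
  by rewrite a0 (rnorm_eq0 a0) state0 cabs0.
have ap : 0 < rnorm a by rewrite lt_def a0 rnorm_ge0.
have := H ((rnorm a)^-1%:C *: a).
rewrite rnormZ stateZ cabsM cabs_real gtr0_norm ?invr_gt0// mulVf// => /(_ (lexx _)).
by rewrite mulrC ler_pdivrMr// mul1r.
Qed.

Lemma state_near1 (e : R) : 0 < e -> exists a, rnorm a <= 1 /\ 1 - e < Re (phi a).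
Proof.
move=> e0; have [_ [a a1 <-]] := sup_adherent e0 state_has_sup.
rewrite -/(dual_norm phi); have [_ _ ->] := phi_state => Ha.
have [p0|p0] := eqVneq (phi a) 0.
  by exists 0; rewrite rnorm0 state0 ler01; move: Ha; rewrite p0 normr0.
have c0 : cabs (phi a) != 0 by apply: contra_neq p0 => /cabs_eq0.
exists ((cabs (phi a))^-1%:C * conjC (phi a) *: a); rewrite rnormZ cabsM cabs_conj.
rewrite cabs_real ger0_norm ?invr_ge0 ?cabs_ge0// mulVf// mul1r; split => //.
rewrite stateZ -mulrA conj_cabs -rmorphM/= expr2 mulKf//.
Qed.

Lemma state_pos a : 0 <= phi (cstar a ** a).
Proof. by have [_ + _] := phi_state; apply. Qed.

Let s a b := phi (cstar a ** b).
Let sDl a b c : s (a + b) c = s a c + s b c.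
Proof. by rewrite /s cstarD cmulDl stateD. Qed.
Let sDr a b c : s a (b + c) = s a b + s a c.
Proof. by rewrite /s cmulDr stateD. Qed.
Let sZl z a b : s (z *: a) b = conjC z * s a b.
Proof. by rewrite /s cstarZ cmulZl stateZ. Qed.
Let sZr z a b : s a (z *: b) = z * s a b.
Proof. by rewrite /s cmulZr stateZ. Qed.

(** Positivity gives this for products; multiplying by an approximate unit
    brings a into this form. *)
Lemma state_hermitian a : phi (cstar a) = conjC (phi a).
Proof.
apply/eqP; rewrite -subr_eq0; apply/eqP/cabs_eq0; apply/eqP.
rewrite eq_le cabs_ge0 andbT; apply/ler_addgt0Pl => e e0; rewrite addr0.
have e2 : 0 < e / 2 by rewrite divr_gt0.
have [y [My y1 Hy]] := approximate_unit HM a HI e2.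
have H1 : cabs (phi (y ** a) - phi a) <= e / 2.
  by rewrite -stateB; apply: le_trans (state_le _) Hy.
have H2 : cabs (phi (cstar a ** cstar y) - phi (cstar a)) <= e / 2.
  rewrite -stateB -cstarM -cstarB; apply: le_trans (state_le _) _.
  by rewrite rnorm_star.
have H3 : phi (cstar a ** cstar y) = conjC (phi (y ** a)).
  have := @form_hermitian R A s sDl sDr sZl sZr state_pos (cstar y) a.
  by rewrite /s cstarK.
have -> : phi (cstar a) - conjC (phi a) =
    - (phi (cstar a ** cstar y) - phi (cstar a)) + conjC (phi (y ** a) - phi a).
  by rewrite conjCD conjCN H3; ring.
apply: (le_trans (cabsD _ _)); rewrite cabsN cabs_conj; lra.
Qed.

Lemma state_cauchy_schwarz a b :
  cabs (phi (cstar a ** b)) ^+ 2 <= Re (phi (cstar a ** a)) * Re (phi (cstar b ** b)).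
Proof. exact: (@form_cauchy_schwarz R A s sDl sDr sZl sZr state_pos). Qed.

(** Cauchy-Schwarz for y a, with y an approximate unit of norm at most 1. *)
Lemma state_sqr_le a : cabs (phi a) ^+ 2 <= Re (phi (cstar a ** a)).
Proof.
have p0 : 0 <= Re (phi (cstar a ** a)) by have /ge0_complex[] := state_pos a.
have H e : 0 < e -> cabs (phi a) <= Num.sqrt (Re (phi (cstar a ** a))) + e.
  move=> e0; have [y [My y1 Hy]] := approximate_unit HM a HI e0.
  have H1 : cabs (phi (y ** a) - phi a) <= e.
    by rewrite -stateB; apply: le_trans (state_le _) Hy.
  have -> : phi a = phi (y ** a) - (phi (y ** a) - phi a) by rewrite opprB addrC subrK.
  apply: (le_trans (cabsD _ _)); rewrite cabsN; apply: lerD => //.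
  rewrite -ler_sqr ?nnegrE ?cabs_ge0 ?sqrtr_ge0// sqr_sqrtr//.
  have := state_cauchy_schwarz (cstar y) a; rewrite cstarK => /le_trans; apply.
  rewrite -[leRHS]mul1r ler_wpM2r//.
  have := state_le (y ** cstar y); rewrite rnorm_mul_star => H2.
  apply: (le_trans (ler_norm _)); apply: (le_trans (cabs_Re _)).
  by apply: (le_trans H2); rewrite expr_le1 ?rnorm_ge0.
rewrite -[leRHS](sqr_sqrtr p0) ler_sqr ?nnegrE ?cabs_ge0 ?sqrtr_ge0//.
by apply/ler_addgt0Pl => e e0; rewrite addrC; exact: H.
Qed.

Lemma uextD x y : uext phi (x + y) = uext phi x + uext phi y.
Proof. by rewrite /uext /= stateD addrACA. Qed.

Lemma uextZ z x : uext phi (z *: x) = z * uext phi x.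
Proof. by rewrite /uext /= stateZ mulrDr. Qed.

Lemma uextN x : uext phi (- x) = - uext phi x.
Proof. by rewrite -scaleN1r uextZ mulN1r. Qed.

Lemma uext1 : uext phi (1 : uA) = 1.
Proof. by rewrite /uext uone1 /= state0 add0r. Qed.

Lemma uext_in a : uext phi (uin a) = phi a.
Proof. by rewrite /uext /= addr0. Qed.

(** For x = a + z the value is phi (a* a) + 2 Re (conj z phi a) + |z|^2, which
    is at least |phi a + z|^2 by state_sqr_le. *)
Lemma uext_ge0 x : 0 <= uext phi ((ustar x : uA) * x).
Proof.
case: x => a z; rewrite /uext umulE /umul /= !stateD !stateZ state_hermitian.
have [p0 pi0] := (ge0_complex _).1 (state_pos a).
have H := state_sqr_le a.
apply/ge0_complex; move: H p0 pi0; rewrite sqr_cabs.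
case: (phi (cstar a ** a)) (phi a) z => [p p'] [q q'] [u v] /= H p0 ->.
split; last by ring.
have -> : p + (u * q - v * - q') + (u * q - - v * q') + (u * u - - v * v) =
  (p - (q ^+ 2 + q' ^+ 2)) + (q + u) ^+ 2 + (q' + v) ^+ 2 by ring.
by rewrite addr_ge0 ?sqr_ge0// addr_ge0 ?sqr_ge0// subr_ge0.
Qed.

Lemma uext_le x : cabs (uext phi x) <= unorm1 x.
Proof. by rewrite (le_trans (cabsD _ _))// lerD2r state_le. Qed.

Definition uform x y := uext phi ((ustar x : uA) * y).

Lemma uformDl x y w : uform (x + y) w = uform x w + uform y w.
Proof. by rewrite /uform ustarD mulrDl uextD. Qed.
Lemma uformDr x y w : uform x (y + w) = uform x y + uform x w.
Proof. by rewrite /uform mulrDr uextD. Qed.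
Lemma uformZl z x y : uform (z *: x) y = conjC z * uform x y.
Proof. by rewrite /uform ustarZ uscalel uextZ. Qed.
Lemma uformZr z x y : uform x (z *: y) = z * uform x y.
Proof. by rewrite /uform uscaler uextZ. Qed.

Lemma uext_cauchy_schwarz x y :
  cabs (uext phi ((ustar x : uA) * y)) ^+ 2 <=
  Re (uext phi ((ustar x : uA) * x)) * Re (uext phi ((ustar y : uA) * y)).
Proof.
exact: (@form_cauchy_schwarz R uA uform uformDl uformDr uformZl uformZr uext_ge0).
Qed.

Lemma uext_hermitian x : uext phi (ustar x) = conjC (uext phi x).
Proof.
have := @form_hermitian R uA uform uformDl uformDr uformZl uformZr uext_ge0 1 x.
by rewrite /uform ustar1 mul1r mulr1.
Qed.

(** The bound is the norm of x as a multiplier of A, possibly smaller than its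
    l1-norm. In x = x b + x (1 - b), with b in the unit ball and phi b near 1,
    the second term is small by Cauchy-Schwarz. *)
Lemma uext_opnorm x (q : R) : (forall b, rnorm (uact x b) <= q * rnorm b) ->
  cabs (uext phi x) <= q.
Proof.
move=> Hq; set P := uext phi (x * ustar x).
have HP : 0 <= Re P.
  by have := uext_ge0 (ustar x); rewrite ustarK => /ge0_complex[].
have q0 : 0 <= q.
  have [b [b1 Hb]] := state_near1 ltr01.
  have bn : 0 < rnorm b.
    rewrite lt_def rnorm_ge0 andbT; apply/eqP => /rnorm_eq0 b0.
    by move: Hb; rewrite b0 state0 /= subrr ltxx.
  by have := le_trans (rnorm_ge0 _) (Hq b); rewrite pmulr_lge0.
apply/ler_addgt0Pl => e e0; rewrite addrC.
pose f := e ^+ 2 / (2 * (Re P + 1)).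
have f0 : 0 < f by rewrite divr_gt0 ?exprn_gt0// mulr_gt0//; lra.
have [b [b1 Hb]] := state_near1 f0.
have E : uext phi x = phi (uact x b) + uext phi (x * (1 - uin b)).
  by rewrite mulrBr mulr1 -uactE uextD uextN uext_in addrC subrK.
rewrite E; apply: (le_trans (cabsD _ _)); apply: lerD.
  apply: (le_trans (state_le _)); apply: (le_trans (Hq b)).
  by rewrite ler_piMr.
rewrite -ler_sqr ?nnegrE ?cabs_ge0 ?(ltW e0)//.
have := uext_cauchy_schwarz (ustar x) (1 - uin b); rewrite ustarK -/P => H.
apply: (le_trans H).
have -> : Re (uext phi ((ustar (1 - uin b) : uA) * (1 - uin b))) =
    1 - Re (phi b) - Re (phi b) + Re (phi (cstar b ** b)).
  rewrite ustarB ustar1 ustar_in mulrBl !mulrBr !mul1r mulr1 -uinM.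
  rewrite !(uextD, uextN) uext1 !uext_in state_hermitian.
  by rewrite !(ReD, ReN, Re_conjc) /= opprD opprK !addrA.
have : Re (phi (cstar b ** b)) <= 1.
  apply: (le_trans (ler_norm _)); apply: (le_trans (cabs_Re _)).
  by apply: (le_trans (state_le _)); rewrite rnorm_star_mul expr_le1 ?rnorm_ge0.
have : Re P * f * 2 <= e ^+ 2.
  rewrite /f mulrAC -mulrA.
  have -> : Re P * (2 * (e ^+ 2 / (2 * (Re P + 1)))) = e ^+ 2 * (Re P / (Re P + 1)).
    by field; lra.
  by rewrite ler_piMr ?sqr_ge0// ler_pdivrMr ?mul1r; lra.
move=> H1 H2; apply: le_trans H1; rewrite -mulrA; apply: ler_wpM2l => //; lra.
Qed.

End States.

(** * Limits of complex-valued functions *)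

(** This makes spaces of functions pointed uniform spaces, to which
    content_radon applies. *)
HB.instance Definition _ (I : Type) (T : I -> puniformType) :=
  Pointed.copy (prod_topology T) (forall i, T i).

Section ComplexLimits.
Local Open Scope complex_scope.
Variables (R : realType) (J : Type) (F : set_system J).
Context {FF : ProperFilter F}.
Implicit Types (f g : J -> R[i]^o) (p q : R[i]^o).

Lemma ccvgP f p : f @ F --> p <->
  forall e : R, 0 < e -> \forall j \near F, cabs (p - f j) < e.
Proof.
split=> [/cvgrPdist_lt fp e e0|H].
  have ec : 0 < e%:C by rewrite ltcR.
  by apply: filterS (fp _ ec) => j; rewrite cabsE ltcR.
apply/cvgrPdist_lt => e e0; have eR : e = (Re e)%:C by rewrite RRe_real// gtr0_real.
have e0' : 0 < Re e by rewrite -ltcR -eR.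
by apply: filterS (H _ e0') => j; rewrite cabsE eR ltcR.
Qed.

Lemma ccvg_Re f p : f @ F --> p -> Re (f j) @[j --> F] --> Re p.
Proof.
move=> /ccvgP H; apply/cvgrPdist_lt => e e0; apply: filterS (H e e0) => j.
by apply: le_lt_trans; rewrite -ReN -ReD; exact: cabs_Re.
Qed.

Lemma ccvg_Im f p : f @ F --> p -> Im (f j) @[j --> F] --> Im p.
Proof.
move=> /ccvgP H; apply/cvgrPdist_lt => e e0; apply: filterS (H e e0) => j.
by apply: le_lt_trans; rewrite -ImN -ImD; exact: cabs_Im.
Qed.

Lemma ccvg_ReIm f (a b : R) : Re (f j) @[j --> F] --> a ->
  Im (f j) @[j --> F] --> b -> f @ F --> (a +i* b : R[i]^o).
Proof.
move=> /cvgrPdist_lt Ha /cvgrPdist_lt Hb; apply/ccvgP => e e0.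
have e2 : 0 < e / 2 by rewrite divr_gt0.
near=> j.
have ha : `|a - Re (f j)| < e / 2 by near: j; exact: Ha.
have hb : `|b - Im (f j)| < e / 2 by near: j; exact: Hb.
apply: (le_lt_trans (cabs_le _)); rewrite ReD ImD ReN ImN /=; lra.
Unshelve. all: by end_near. Qed.

Lemma ccvg_unique f p q : f @ F --> p -> f @ F --> q -> p = q.
Proof. by move=> fp fq; apply: (cvg_unique _ fp fq); exact: norm_hausdorff. Qed.

Lemma ccvgD f g p q : f @ F --> p -> g @ F --> q ->
  (fun j => f j + g j) @ F --> (p + q : R[i]^o).
Proof. exact: cvgD. Qed.

Lemma ccvgM f g p q : f @ F --> p -> g @ F --> q ->
  (fun j => (f j : R[i]) * g j : R[i]^o) @ F --> ((p : R[i]) * q : R[i]^o).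
Proof.
move=> fp gq.
have fRe := ccvg_Re fp; have fIm := ccvg_Im fp.
have gRe := ccvg_Re gq; have gIm := ccvg_Im gq.
have -> : ((p : R[i]) * q : R[i]^o) =
   (Re p * Re q - Im p * Im q) +i* (Re p * Im q + Im p * Re q).
  by apply: complex_eq; [exact: cReM|exact: cImM].
apply: ccvg_ReIm.
- by under eq_cvg do rewrite cReM; apply: cvgB; exact: cvgM.
- by under eq_cvg do rewrite cImM; apply: cvgD; exact: cvgM.
Qed.

Lemma ccvgZ f p (z : R[i]) : f @ F --> p ->
  (fun j => z * f j : R[i]^o) @ F --> (z * p : R[i]^o).
Proof.
move=> fp; have cz : (fun=> z : R[i]^o) @ F --> (z : R[i]^o) by exact: cvg_cst.
exact: (ccvgM cz fp).
Qed.

Lemma ccvg_conj f p : f @ F --> p ->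
  (fun j => conjC (f j) : R[i]^o) @ F --> (conjC p : R[i]^o).
Proof.
move=> fp.
have -> : (conjC p : R[i]^o) = Complex (Re p) (- Im p) by case: (p).
apply: ccvg_ReIm.
- have -> : (fun j => Re (conjC (f j))) = (fun j => Re (f j)).
    by apply/funext => j; exact: Re_conjc.
  exact: ccvg_Re.
- have -> : (fun j => Im (conjC (f j))) = (fun j => - Im (f j)).
    by apply/funext => j; exact: Im_conjc.
  by apply: cvgN; exact: ccvg_Im.
Qed.

Lemma ccvg_le f p (c : R) : f @ F --> p ->
  (\forall j \near F, cabs (f j) <= c) -> cabs p <= c.
Proof.
move=> /ccvgP H Hc; apply/ler_addgt0Pl => e e0.
have [j [H1 H2]] := filter_ex (filterI (H e e0) Hc).
have -> : p = (p - f j) + f j by rewrite subrK.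
by apply: (le_trans (cabsD _ _)); apply: lerD => //; exact: ltW.
Qed.

Lemma ccvg_ge0 f p : f @ F --> p ->
  (\forall j \near F, 0 <= (f j : R[i])) -> 0 <= (p : R[i]).
Proof.
move=> fp H; apply/ge0_complex; split.
  apply: (cvgr_to_ge (ccvg_Re fp)); apply: filterS H => j.
  by move=> /ge0_complex[].
apply: (@cvg_unique _ (@Rhausdorff R) _ _ _ _ (ccvg_Im fp)).
apply: (@cvg_trans _ ((fun=> 0 : R) @ F)); last exact: cvg_cst.
by apply: near_eq_cvg; apply: filterS H => j /ge0_complex[_ ->].
Qed.

Lemma ccvg_ge_Re f p (c : R) : f @ F --> p ->
  (\forall j \near F, c <= Re (f j)) -> c <= Re p.
Proof. by move=> fp H; apply: (cvgr_to_ge (ccvg_Re fp)). Qed.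

Lemma ccvg_near f g p : f @ F --> p -> (\forall j \near F, f j = g j) -> g @ F --> p.
Proof.
move=> fp fg; apply: cvg_trans fp; apply: near_eq_cvg.
by apply: filterS fg.
Qed.

End ComplexLimits.

Arguments ccvg_ReIm {R J F FF f a b} _ _.
Arguments ccvgM {R J F FF f g p q} _ _.
Arguments ccvgD {R J F FF f g p q} _ _.
Arguments ccvgZ {R J F FF f p} z _.
Arguments ccvg_conj {R J F FF f p} _.
Arguments ccvg_Re {R J F FF f p} _.
Arguments ccvg_Im {R J F FF f p} _.
Arguments ccvg_near {R J F FF f g p} _ _.

Lemma ultra_ccvg (R : realType) (J : Type) (U : set_system J)
    (f : J -> R[i]^o) (c : R) : UltraFilter U ->
  (\forall j \near U, cabs (f j) <= c) ->
  exists2 p : R[i]^o, cabs p <= c & f @ U --> p.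
Proof.
move=> UU H; have PU : ProperFilter U by exact: ultra_proper.
have HR : cvg (Re (f j) @[j --> U]).
  apply: (@ultra_bounded_cvg _ _ _ _ (- c) c); apply: filterS H => j Hj.
  by rewrite -ler_norml; apply: le_trans (cabs_Re _) Hj.
have HI : cvg (Im (f j) @[j --> U]).
  apply: (@ultra_bounded_cvg _ _ _ _ (- c) c); apply: filterS H => j Hj.
  by rewrite -ler_norml; apply: le_trans (cabs_Im _) Hj.
have [a fa] := (cvg_ex _).1 HR; have [b fb] := (cvg_ex _).1 HI.
have fp : f @ U --> (Complex a b : R[i]^o) by exact: (ccvg_ReIm fa fb).
by exists (Complex a b) => //; exact: (ccvg_le fp H).
Qed.

(** * Characters of an abelian subalgebra *)

Section Characters.
Local Open Scope complex_scope.
Variables (R : realType) (A : cstarType R) (M : set A).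
Hypothesis HM : abelian_csubalgebra M.
Local Notation T := {ptws M -> R[i]^o}.
Implicit Types (x y : T) (a b c h : A) (z : R[i]).

(** The default value 0 outside M allows evaluation at algebraic expressions
    without carrying membership proofs in the terms. *)
Definition ev (x : T) (a : A) : R[i]^o :=
  if pselect (M a) is left Ma then x (SigSub (mem_set Ma)) else 0.

Lemma evE x (a : M) : ev x (val a) = x a.
Proof.
rewrite /ev; case: pselect => [Ma|]; first by congr (x _); exact: val_inj.
by move=> nMa; have := set_valP a.
Qed.

Lemma inMP a : M a -> exists a' : M, val a' = a.
Proof. by move=> Ma; exists (SigSub (mem_set Ma)). Qed.

Lemma ev_continuous a : continuous (fun x : T => ev x a).
Proof.
have [Ma|nMa] := EM (M a).
  have -> : (fun x : T => ev x a) = proj (SigSub (mem_set Ma)).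
    apply/funext => x; rewrite /ev /proj; case: pselect => // Ma'.
    by congr (x _); exact: val_inj.
  exact: proj_continuous.
have -> : (fun x : T => ev x a) = cst (0 : R[i]^o).
  by apply/funext => x; rewrite /ev; case: pselect.
exact: cst_continuous.
Qed.

Lemma evP x y : (forall a, M a -> ev x a = ev y a) -> x = y.
Proof.
move=> H; apply/funext => a; rewrite -(evE x a) -(evE y a).
by apply: H; exact: set_valP.
Qed.

Lemma T_hausdorff : hausdorff_space T.
Proof. by apply: hausdorff_product => _; exact: norm_hausdorff. Qed.

Lemma T_cvg (F : set_system T) x : Filter F ->
  (forall a, M a -> (fun y => ev y a) @ F --> ev x a) -> F --> x.
Proof.
move=> FF H; apply/pointwise_cvgP => a.
rewrite -(evE x a); apply: cvg_trans (H _ (set_valP a)).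
by apply: near_eq_cvg; apply: nearW => y; rewrite evE.
Qed.

(** The factor 2 accommodates functionals that are given by contractive real
    functionals on self-adjoint elements. *)
Record hermitian_functional x : Prop := {
  hfD : forall a b, M a -> M b -> ev x (a + b) = ev x a + ev x b ;
  hfZ : forall z a, M a -> ev x (z *: a) = z * ev x a ;
  hf_star : forall a, M a -> ev x (cstar a) = conjC (ev x a) ;
  hf_le : forall a, M a -> cabs (ev x a) <= 2 * rnorm a }.

Definition hermitian_ball : set T := [set x | hermitian_functional x].

Definition multiplicative_on x :=
  forall a b, M a -> M b -> ev x (a ** b) = (ev x a : R[i]) * ev x b.

(** The spectrum and the zero functional, which together are compact. *)
Definition characters : set T := hermitian_ball `&` [set x | multiplicative_on x].

Lemma ultra_hermitian (F : set_system T) : UltraFilter F -> F hermitian_ball ->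
  exists2 x, hermitian_ball x & F --> x.
Proof.
move=> UF HF; have PF : ProperFilter F by exact: ultra_proper.
have H a : exists p : R[i]^o, (M a -> (fun y => ev y a) @ F --> p) /\ (M a -> cabs p <= 2 * rnorm a).
  have [Ma|nMa] := EM (M a); last by exists 0.
  have [|p p1 p2] := @ultra_ccvg _ _ _ (fun y => ev y a) (2 * rnorm a) UF; last by exists p.
  by apply: filterS HF => y /hf_le; apply.
have [p pP] := @choice _ _ (fun a p => (M a -> (fun y => ev y a) @ F --> (p : R[i]^o)) /\ (M a -> cabs p <= 2 * rnorm a)) H.
pose x : T := fun a0 : M => p (val a0).
have xE a : M a -> ev x a = p a.
  by move=> Ma; have [a' <-] := inMP Ma; rewrite (evE x a').
have xF a : M a -> (fun y => ev y a) @ F --> ev x a.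
  by move=> Ma; rewrite xE//; have [H1 _] := pP a; exact: H1.
exists x; last exact: T_cvg xF.
split.
- move=> a b Ma Mb; have Mab := csubD HM Ma Mb.
  apply: (ccvg_unique (xF _ Mab)).
  apply: ccvg_near (ccvgD (xF _ Ma) (xF _ Mb)) _.
  by apply: filterS HF => y /hfD ->.
- move=> z a Ma; have Mza := csubZ HM z Ma.
  apply: (ccvg_unique (xF _ Mza)).
  apply: ccvg_near (ccvgZ z (xF _ Ma)) _.
  by apply: filterS HF => y /hfZ ->.
- move=> a Ma; have Msa := csub_star HM Ma.
  apply: (ccvg_unique (xF _ Msa)).
  apply: ccvg_near (ccvg_conj (xF _ Ma)) _.
  by apply: filterS HF => y /hf_star ->.
- by move=> a Ma; rewrite xE//; have [_] := pP a; apply.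
Qed.

Lemma compact_hermitian_ball : compact hermitian_ball.
Proof.
rewrite compact_ultra => F UF HF.
by have [x Hx Fx] := ultra_hermitian UF HF; exists x.
Qed.

Lemma compact_characters : compact characters.
Proof.
rewrite compact_ultra => F UF HF; have PF : ProperFilter F by exact: ultra_proper.
have HF1 : F hermitian_ball by apply: filterS HF => x [].
have [x Hx Fx] := ultra_hermitian UF HF1; exists x; split => //.
split => // a b Ma Mb.
have FF' : Filter F by exact: filter_filter.
have E c : (fun y : T => ev y c) @ F --> ev x c.
  apply: cvg_trans (@ev_continuous c x). exact: (@cvg_app _ _ _ _ (fun y : T => ev y c) Fx).
apply: (ccvg_unique (E (a ** b))).
apply: ccvg_near (ccvgM (E a) (E b)) _.
by apply: filterS HF => y [_ ->].
Qed.

Lemma closed_characters : closed characters.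
Proof. exact: compact_closed T_hausdorff compact_characters. Qed.

Section SpectrumElement.
Variable x : T.
Hypothesis xs : spectrum x.

Lemma specD a b : M a -> M b -> ev x (a + b) = ev x a + ev x b.
Proof.
move=> Ma Mb; have [a' Ea] := inMP Ma; have [b' Eb] := inMP Mb.
have [c' Ec] := inMP (csubD HM Ma Mb).
have [_ H _ _] := xs; rewrite -Ec -Ea -Eb (evE x a') (evE x b') (evE x c'); apply: H.
by rewrite Ec Ea Eb.
Qed.

Lemma specZ z a : M a -> ev x (z *: a) = z * ev x a.
Proof.
move=> Ma; have [a' Ea] := inMP Ma; have [c' Ec] := inMP (csubZ HM z Ma).
have [_ _ H _] := xs; rewrite -Ec -Ea (evE x a') (evE x c'); apply: H.
by rewrite Ec Ea.
Qed.

Lemma specM a b : M a -> M b -> ev x (a ** b) = (ev x a : R[i]) * ev x b.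
Proof.
move=> Ma Mb; have [a' Ea] := inMP Ma; have [b' Eb] := inMP Mb.
have [c' Ec] := inMP (csubM HM Ma Mb).
have [_ _ _ H] := xs; rewrite -Ec -Ea -Eb (evE x a') (evE x b') (evE x c'); apply: H.
by rewrite Ec Ea Eb.
Qed.

(** If |x a| > |a|, then b = a / x a has norm below 1 and x b = 1, although c
    = b + b c has a solution. *)
Lemma spec_le a : M a -> cabs (ev x a) <= rnorm a.
Proof.
move=> Ma; rewrite leNgt; apply/negP => lt.
have e0 : (ev x a : R[i]) != 0.
  apply/eqP => e0; move: lt; rewrite e0 cabs0 ltNge rnorm_ge0.
  by [].
pose b := (ev x a : R[i])^-1 *: a.
have Mb : M b by exact: csubZ.
have xb : ev x b = 1 by rewrite specZ// mulVf.
have cinv : cabs (ev x a : R[i])^-1 = (cabs (ev x a))^-1.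
  have cn : cabs (ev x a) != 0 by apply: contra_neq e0 => /cabs_eq0.
  have : cabs (ev x a : R[i])^-1 * cabs (ev x a) = 1.
    by rewrite -cabsM mulVf// cabs_real normr1.
  by move/(congr1 (fun r => r / cabs (ev x a))); rewrite mulfK// mul1r.
have cp : 0 < cabs (ev x a) by apply: le_lt_trans lt; exact: rnorm_ge0.
have b1 : rnorm b < 1 by rewrite rnormZ cinv mulrC ltr_pdivrMr// mul1r.
have [||||u v Mu Mv|c Mc Ec] := @contraction_fixed_point R A M (fun c => b + b ** c) (rnorm b) (csub_closed HM).
- by exists 0; exact: csub0.
- by move=> c Mc; apply: (csubD HM) => //; exact: csubM.
- exact: rnorm_ge0.
- by [].
- by rewrite opprD addrACA subrr add0r -cmulBr; exact: rnormM.
have := congr1 (ev x) Ec; rewrite specD//; last exact: csubM.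
rewrite specM// xb mul1r => /eqP.
by rewrite -subr_eq0 addrK oner_eq0.
Qed.

End SpectrumElement.

(** Geometric sequences with a larger ratio eventually dominate. *)
Lemma growth_rate_le (r s k g : R) : 0 < k -> 0 <= s ->
  (forall n, r ^+ n * k <= s ^+ n * g) -> r <= s.
Proof.
move=> k0 s0 H; rewrite leNgt; apply/negP => sr.
have r0 : 0 < r by exact: le_lt_trans s0 sr.
have g0 : k <= g by have := H 0%N; rewrite !expr0 !mul1r.
pose q := s / r.
have q0 : 0 <= q by rewrite divr_ge0// ltW.
have q1 : q < 1 by rewrite ltr_pdivrMr// mul1r.
have [n _ Hn] := geometric_small g q0 q1 k0.
have := Hn n (leqnn n); rewrite /= ltNge => /negP; apply.
rewrite /q expr_div_n mulrA ler_pdivlMr ?exprn_gt0// mulrC [g * _]mulrC.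
exact: H.
Qed.

(** Arens's argument: applying h + il repeatedly to some g with x g != 0 shows
    |x h + il|^2 <= |h|^2 + l^2 for every real l, which for large l of either
    sign forces Im (x h) = 0. *)
Lemma spec_real x h : spectrum x -> M h -> cstar h = h -> Im (ev x h) = 0.
Proof.
move=> xs Mh sh; have [[g0 g0n] _ _ _] := xs.
pose g := val g0; have Mg : M g by exact: set_valP.
have gn : 0 < cabs (ev x g) ^+ 2.
  rewrite exprn_gt0// lt_def cabs_ge0 andbT; apply: contra_neq g0n => /cabs_eq0.
  by rewrite (evE x g0).
have H (l : R) : Re (ev x h) ^+ 2 + (Im (ev x h) + l) ^+ 2 <= rnorm h ^+ 2 + l ^+ 2.
  apply: (@growth_rate_le _ _ _ (rnorm g ^+ 2) gn); first by rewrite addr_ge0 ?sqr_ge0.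
  move=> n; pose u := iter n (uact (ishift h l)) g.
  have Mv k : M (iter k (uact (ishift h l)) g).
    by elim: k => //= k IH; exact: uactM.
  have Mu : M u by exact: Mv.
  have E1 : cabs (ev x u) ^+ 2 =
      (Re (ev x h) ^+ 2 + (Im (ev x h) + l) ^+ 2) ^+ n * cabs (ev x g) ^+ 2.
    rewrite /u; elim: n {u Mu} => [|n IH] /=; first by rewrite expr0 mul1r.
    set v := iter n _ g in IH *.
    have Mv' : M v by exact: Mv.
    rewrite uact_ishift specD ?specM ?specZ//; [|exact: csubM|exact: csubZ].
    rewrite -mulrDl cabsM exprMn IH [in RHS]exprS -[RHS]mulrA; congr (_ * _).
    by rewrite sqr_cabs ReD ImD /= addr0.
  rewrite -E1; apply: (@le_trans _ _ (rnorm u ^+ 2)).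
    by rewrite ler_sqr ?nnegrE ?cabs_ge0 ?rnorm_ge0//; exact: spec_le.
  rewrite /u; elim: n {u Mu E1} => [|n IH] /=; first by rewrite expr0 mul1r.
  set v := iter n _ g in IH *.
  apply: (@le_trans _ _ ((rnorm h ^+ 2 + l ^+ 2) * rnorm v ^+ 2)); last first.
    rewrite [(_ + _) ^+ n.+1]exprS -mulrA; apply: ler_wpM2l => //.
    by rewrite addr_ge0 ?sqr_ge0.
  rewrite -rnorm_star_mul.
  have -> : cstar (uact (ishift h l) v) ** uact (ishift h l) v =
      cstar v ** uact ((h ** h, (l ^+ 2)%:C) : unitized A) v.
    apply: uin_inj; rewrite !uinM -!ustar_in !uactE ustarM -!mulrA; congr (_ * _).
    rewrite mulrA; congr (_ * _); apply: unitizedP => /=.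
      rewrite sh -addrA -scalerDl.
      have -> : (l *i + (0 -i* l) : R[i]) = 0 by apply: complex_eq => /=; rewrite ?addr0// subrr.
      by rewrite scale0r addr0.
    by apply: complex_eq => /=; ring.
  apply: (le_trans (rnormM _ _)); rewrite rnorm_star expr2 mulrCA.
  rewrite ler_wpM2l ?rnorm_ge0//; apply: (le_trans (uact_le _ _)).
  rewrite ler_wpM2r ?rnorm_ge0// /unorm1 /= cabs_real ger0_norm ?sqr_ge0//.
  by rewrite lerD2r expr2; exact: rnormM.
set q := Im (ev x h) in H *; set p := Re _ in H.
have H2 l : 2 * q * l <= rnorm h ^+ 2.
  by have := H l; have := sqr_ge0 p; have := sqr_ge0 q; nra.
apply/eqP; apply: contraT => q0.
have := H2 ((rnorm h ^+ 2 + 1) / (2 * q)).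
have -> : 2 * q * ((rnorm h ^+ 2 + 1) / (2 * q)) = rnorm h ^+ 2 + 1 by field.
by rewrite gerDl ler10.
Qed.

Definition sreal a : A := (2^-1)%:C *: (a + cstar a).
Definition simag a : A := (- 2^-1) *i *: (a - cstar a).

Lemma sreal_sa a : cstar (sreal a) = sreal a.
Proof. by rewrite /sreal cstarZ conjc_real cstarD cstarK addrC. Qed.

Lemma simag_sa a : cstar (simag a) = simag a.
Proof.
rewrite /simag cstarZ cstarB cstarK -opprB scalerN -scaleNr; congr (_ *: _).
by apply: complex_eq => /=; rewrite ?oppr0// opprK.
Qed.

Lemma srealM a : M a -> M (sreal a).
Proof. by move=> Ma; apply: (csubZ HM); apply: (csubD HM) => //; exact: csub_star. Qed.

Lemma simagM a : M a -> M (simag a).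
Proof. by move=> Ma; apply: (csubZ HM); apply: csubB => //; exact: csub_star. Qed.

Lemma sreal_imag a : a = sreal a + 'i *: simag a.
Proof.
rewrite /sreal /simag scalerA.
have -> : ('i * (- 2^-1) *i : R[i]) = (2^-1)%:C.
  by apply: complex_eq => /=; ring.
rewrite -scalerDr addrACA subrr addr0 -mulr2n -[a *+ 2]scaler_nat scalerA.
have -> : (2^-1)%:C * 2%:R = 1 :> R[i].
  by rewrite -(rmorph_nat (real_complex R)) -rmorphM/= mulVf// pnatr_eq0.
by rewrite scale1r.
Qed.

Lemma spectrum_characters : @spectrum R A M `<=` characters.
Proof.
move=> x xs; split; last by move=> a b Ma Mb; exact: specM.
split.
- by move=> a b; exact: specD.
- by move=> z a; exact: specZ.
- move=> a Ma; have Mr := srealM Ma; have Mi := simagM Ma.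
  have Hr := spec_real xs Mr (sreal_sa a); have Hi := spec_real xs Mi (simag_sa a).
  have -> : cstar a = sreal a + (- 'i) *: simag a.
    have := congr1 (@cstar R A) (sreal_imag a).
    rewrite cstarD (cstarZ 'i (simag a)) sreal_sa simag_sa => ->.
    by congr (_ + _ *: _); apply: complex_eq => /=; rewrite ?oppr0.
  have E : ev x a = ev x (sreal a) + 'i * ev x (simag a).
    rewrite {1}(sreal_imag a) (specD xs Mr) ?(specZ xs 'i Mi)//.
    exact: (csubZ HM 'i Mi).
  rewrite E (specD xs Mr); last exact: (csubZ HM (- 'i) Mi).
  rewrite (specZ xs (- 'i) Mi).
  apply: complex_eq; rewrite ?Re_conjc ?Im_conjc !(ReD, ImD, cReM, cImM) ?Hr ?Hi /=; ring.
- move=> a Ma; apply: (le_trans (spec_le xs Ma)).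
  by have := rnorm_ge0 a; lra.
Qed.

Lemma characters_spectrum x : characters x -> (exists2 a, M a & ev x a != 0) -> spectrum x.
Proof.
move=> [[xD xZ _ _] xM] [a Ma a0]; split.
- by have [a' Ea] := inMP Ma; exists a'; rewrite -(evE x a') Ea.
- move=> u v w E; rewrite -(evE x u) -(evE x v) -(evE x w) E xD//; exact: set_valP.
- move=> z u w E; rewrite -(evE x u) -(evE x w) E xZ//; exact: set_valP.
- move=> u v w E; rewrite -(evE x u) -(evE x v) -(evE x w) E xM//; exact: set_valP.
Qed.

Definition zeroT : T := fun=> 0.

Lemma ev_zero a : ev zeroT a = 0.
Proof. by rewrite /ev; case: pselect. Qed.

Lemma zero_character : characters zeroT.
Proof.
split; last by move=> a b Ma Mb; rewrite !ev_zero mulr0.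
split=> [a b Ma Mb|z a Ma|a Ma|a Ma].
- by rewrite !ev_zero addr0.
- by rewrite !ev_zero mulr0.
- by rewrite !ev_zero conjc0.
- by rewrite ev_zero cabs0 mulr_ge0// rnorm_ge0.
Qed.

Lemma spectrumE : @spectrum R A M = characters `\ zeroT.
Proof.
apply/seteqP; split=> x.
  move=> xs; split; first exact: spectrum_characters.
  by move=> x0; have [[a]] := xs; rewrite x0 eqxx.
move=> [xc xn]; apply: characters_spectrum => //.
apply: contrapT => H; apply: xn; apply: evP => a Ma; rewrite ev_zero.
by apply: contrapT => /eqP ne; apply: H; exists a.
Qed.

End Characters.

(** * Cutoffs *)

Section Urysohn.
Local Open Scope complex_scope.
Variables (R : realType) (A : cstarType R) (M : set A).
Hypothesis HM : abelian_csubalgebra M.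
Local Notation T := {ptws M -> R[i]^o}.
Local Notation characters := (@characters R A M).
Implicit Types (x y : T) (a b c h : A) (z : R[i]).

Lemma ev_Re_nbhs (x : T) h (e : R) : 0 < e ->
  nbhs x [set t : T | `|Re (ev x h) - Re (ev t h)| < e].
Proof.
move=> e0; have ec : 0 < e%:C by rewrite ltcR.
have /cvgrPdist_lt /(_ _ ec) := @ev_continuous R A M h x.
apply: filterS => t; rewrite cabsE ltcR /=.
by apply: le_lt_trans; rewrite -ReN -ReD; exact: cabs_Re.
Qed.

Lemma chD x a b : characters x -> M a -> M b -> ev x (a + b) = ev x a + ev x b.
Proof. by move=> [xh _]; exact: hfD. Qed.
Lemma chZ x z a : characters x -> M a -> ev x (z *: a) = z * ev x a.
Proof. by move=> [xh _]; exact: hfZ. Qed.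
Lemma chM x a b : characters x -> M a -> M b ->
  ev x (a ** b) = (ev x a : R[i]) * ev x b.
Proof. by move=> [_]; exact. Qed.
Lemma ch_star x a : characters x -> M a -> ev x (cstar a) = conjC (ev x a).
Proof. by move=> [xh _]; exact: hf_star. Qed.

Lemma hf_real x h : hermitian_functional x -> M h -> cstar h = h ->
  ev x h = (Re (ev x h))%:C.
Proof.
move=> xh Mh sh; have := hf_star xh Mh; rewrite sh => E.
have E2 := congr1 (@complex.Im R) E; rewrite Im_conjc in E2.
by apply: complex_eq => //=; lra.
Qed.

Lemma ch_real x h : characters x -> M h -> cstar h = h ->
  ev x h = (Re (ev x h))%:C.
Proof. by move=> [xh _]; exact: hf_real. Qed.

Lemma star_mulE a : M a -> M (cstar a ** a) /\ cstar (cstar a ** a) = cstar a ** a.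
Proof.
move=> Ma; split; last by rewrite cstarM cstarK.
by apply: (csubM HM) => //; exact: csub_star.
Qed.

Lemma ch_star_mul x a : characters x -> M a ->
  ev x (cstar a ** a) = (cabs (ev x a) ^+ 2)%:C.
Proof.
by move=> xc Ma; rewrite chM ?ch_star ?conj_cabs//; exact: csub_star.
Qed.

(** For y = h (h + id)^-1 the element y* y is the function t^2 / (t^2 + d^2)
    of h. *)
Lemma cayley_cutoff h d : M h -> cstar h = h -> 0 < d ->
  exists f, [/\ M f, cstar f = f, rnorm f <= 1 &
    forall x, characters x ->
      Re (ev x f) = Re (ev x h) ^+ 2 / (Re (ev x h) ^+ 2 + d ^+ 2)].
Proof.
move=> Mh sh d0; have [y [My y1 Hy]] := cayley HM sh Mh d0.
have [Mf sf] := star_mulE My.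
exists (cstar y ** y); split => //.
  by rewrite rnorm_star_mul expr_le1 ?rnorm_ge0.
move=> x xc; rewrite ch_star_mul//=.
have := congr1 (ev x) Hy; rewrite uact_ishift (chD xc); last 2 first.
- exact: (csubM HM).
- exact: (csubZ HM (d *i) My).
rewrite (chM xc Mh My) (chZ (d *i) xc My) (ch_real xc Mh sh).
set p := Re (ev x h); rewrite -mulrDl => E.
have E2 : (p ^+ 2 + d ^+ 2) * cabs (ev x y) ^+ 2 = p ^+ 2.
  have := congr1 (fun z => cabs z ^+ 2) E; rewrite cabsM exprMn.
  rewrite [cabs (_ + _) ^+ 2]sqr_cabs [cabs p%:C ^+ 2]sqr_cabs ReD ImD /=.
  by rewrite addr0 add0r expr0n addr0.
have pos : 0 < p ^+ 2 + d ^+ 2 by rewrite ltr_wpDl ?sqr_ge0// exprn_gt0.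
by rewrite -{1}E2 mulrAC divff ?gt_eqF// mul1r.
Qed.

(** The power n + 1, as there is no unit for exponent 0. *)
Fixpoint cpow h n : A := if n is n'.+1 then h ** cpow h n' else h.

Lemma cpowM h n : M h -> M (cpow h n).
Proof. by move=> Mh; elim: n => //= n; exact: csubM. Qed.

Lemma cpow_sa h n : M h -> cstar h = h -> cstar (cpow h n) = cpow h n.
Proof.
move=> Mh sh; elim: n => //= n IH; rewrite cstarM IH sh.
by apply: (csub_comm HM) => //; exact: cpowM.
Qed.

Lemma ch_cpow x h n : characters x -> M h -> cstar h = h ->
  Re (ev x (cpow h n)) = Re (ev x h) ^+ n.+1.
Proof.
move=> xc Mh sh; elim: n => [|n IH] /=; first by rewrite expr1.
rewrite (chM xc Mh (cpowM n Mh)) cReM IH (ch_real xc Mh sh) /= mul0r subr0.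
by rewrite -exprS.
Qed.

(** Elements of the unit ball of M that are continuous functions from the
    spectrum to [0, 1]. *)
Definition cutoff g := [/\ M g, cstar g = g, rnorm g <= 1 &
  forall x, characters x -> 0 <= Re (ev x g) <= 1].

Lemma cutoffM f g : cutoff f -> cutoff g -> cutoff (f ** g).
Proof.
move=> [Mf sf f1 xf] [Mg sg g1 xg]; split.
- exact: csubM.
- by rewrite cstarM sf sg; exact: (csub_comm HM Mg Mf).
- by apply: (le_trans (rnormM _ _)); rewrite mulr_ile1 ?rnorm_ge0.
- move=> x xc; rewrite (chM xc Mf Mg) (ch_real xc Mf sf) (ch_real xc Mg sg) /=.
  rewrite mulr0 subr0; have /andP[? ?] := xf x xc; have /andP[? ?] := xg x xc.
  by rewrite mulr_ge0// mulr_ile1.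
Qed.

Lemma ch_cutoffM x f g : characters x -> cutoff f -> cutoff g ->
  Re (ev x (f ** g)) = Re (ev x f) * Re (ev x g).
Proof.
move=> xc [Mf sf _ _] [Mg sg _ _].
by rewrite (chM xc Mf Mg) (ch_real xc Mf sf) (ch_real xc Mg sg) /= mulr0 subr0.
Qed.

(** With t = h^2 and be > ga > al, the functions t^n / (t^n + ga^n) tend to 1
    where t >= be and to 0 where t <= al. *)
Lemma cutoff_separate h (al be e : R) : M h -> cstar h = h -> 0 < al -> al < be -> 0 < e ->
  exists2 f, cutoff f & forall x, characters x ->
    (be <= Re (ev x h) ^+ 2 -> 1 - e <= Re (ev x f)) /\
    (Re (ev x h) ^+ 2 <= al -> Re (ev x f) <= e).
Proof.
move=> Mh sh al0 ab e0; pose ga := (al + be) / 2.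
have be0 : 0 < be by lra.
have ga0 : 0 < ga by rewrite /ga; lra.
have gb : ga < be by rewrite /ga; lra.
have ag : al < ga by rewrite /ga; lra.
have q1 : 0 <= ga / be by rewrite divr_ge0// ltW.
have q2 : 0 <= al / ga by rewrite divr_ge0// ltW.
have q1' : ga / be < 1 by rewrite ltr_pdivrMr// mul1r.
have q2' : al / ga < 1 by rewrite ltr_pdivrMr// mul1r.
have [n [Hn1 Hn2]] : exists n, (ga / be) ^+ n.+1 < e /\ (al / ga) ^+ n.+1 < e.
  have G1 := geometric_small 1 q1 q1' e0; have G2 := geometric_small 1 q2 q2' e0.
  have [N _ HN] := filterI G1 G2; exists N.
  by have := HN N.+1 (leqnSn N); rewrite /= !mul1r.
have d0 : 0 < Num.sqrt (ga ^+ n.+1) by rewrite sqrtr_gt0 exprn_gt0.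
have [f [Mf sf f1 fE]] := cayley_cutoff (cpowM n Mh) (cpow_sa n Mh sh) d0.
have fE' x : characters x -> Re (ev x f) =
    (Re (ev x h) ^+ 2) ^+ n.+1 / ((Re (ev x h) ^+ 2) ^+ n.+1 + ga ^+ n.+1).
  move=> xc; rewrite fE// ch_cpow// sqr_sqrtr; last by rewrite exprn_ge0// ltW.
  by rewrite exprAC.
have gn0 : 0 < ga ^+ n.+1 by rewrite exprn_gt0.
exists f.
  split => // x xc; rewrite fE'//; set s := Re _ ^+ 2.
  have s0 : 0 <= s ^+ n.+1 by rewrite exprn_ge0// sqr_ge0.
  have p0 : 0 < s ^+ n.+1 + ga ^+ n.+1 by rewrite ltr_wpDl.
  by rewrite divr_ge0 ?(ltW p0)//= ler_pdivrMr// mul1r lerDl ltW.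
move=> x xc; rewrite fE'//; set s := Re _ ^+ 2.
have s0 : 0 <= s by exact: sqr_ge0.
have sn0 : 0 <= s ^+ n.+1 by rewrite exprn_ge0.
have p0 : 0 < s ^+ n.+1 + ga ^+ n.+1 by rewrite ltr_wpDl.
split=> [bs|sa].
  have bn : be ^+ n.+1 <= s ^+ n.+1 by rewrite lerXn2r ?nnegrE// ltW.
  have bn0 : 0 < be ^+ n.+1 by rewrite exprn_gt0.
  move: Hn1; rewrite expr_div_n ltr_pdivrMr// => H1.
  rewrite ler_pdivlMr//; nra.
move: Hn2; rewrite expr_div_n ltr_pdivrMr// => H1.
have an : s ^+ n.+1 <= al ^+ n.+1 by rewrite lerXn2r ?nnegrE// ltW.
rewrite ler_pdivrMr//; nra.
Qed.

(** For x in K choose a with x a != y a and c with x c != 0. Then d = (y a) c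
    - c a vanishes at y and not at x, and so does the nonnegative function d*
    d; a sum of finitely many of these is bounded below on K. *)
Lemma separate_point (K : set T) y : compact K -> K `<=` @spectrum R A M ->
  characters y -> ~ K y ->
  exists h, exists be : R, [/\ M h, cstar h = h, 0 < be, Re (ev y h) = 0 &
    (forall x, characters x -> 0 <= Re (ev x h)) /\
    (forall x, K x -> be <= Re (ev x h))].
Proof.
move=> cK Ks yc nKy.
pose P (B : set T) := exists h, exists be : R, [/\ M h, cstar h = h, 0 < be, Re (ev y h) = 0 &
    (forall x, characters x -> 0 <= Re (ev x h)) /\
    (forall x, B x -> characters x -> be <= Re (ev x h))].
suff [h [be [Mh sh be0 yh [h0 hK]]]] : P K.
  exists h, be; split => //; split => // x Kx; apply: hK => //.
  exact/(spectrum_characters HM)/Ks.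
apply: (@compact_ind _ P K _ _ _ cK).
- exists 0, 1; split => //; first exact: csub0.
  + exact: cstar0.
  + by have := chZ 0 yc (csub0 HM); rewrite scale0r mul0r => ->.
  + split => // x xc.
    by have := chZ 0 xc (csub0 HM); rewrite scale0r mul0r => ->.
- move=> B1 B2 B12 [h [be [Mh sh be0 yh [h0 hK]]]]; exists h, be; split => //.
  by split => // x /B12; exact: hK.
- move=> B1 B2 [h [be [Mh sh be0 yh [h0 hK]]]] [h' [be' [Mh' sh' be0' yh' [h0' hK']]]].
  exists (h + h'), (Num.min be be'); split.
  + exact: csubD.
  + by rewrite cstarD sh sh'.
  + by rewrite lt_min be0.
  + by rewrite (chD yc Mh Mh') ReD yh yh' addr0.
  + split=> [x xc|x Bx xc]; rewrite (chD xc Mh Mh') ReD.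
      by rewrite addr_ge0 ?h0 ?h0'.
    case: Bx => [/hK/(_ xc) H|/hK'/(_ xc) H].
      by rewrite ge_min (le_trans H)// lerDl h0'.
    by rewrite ge_min orbC (le_trans H)// lerDr h0.
- move=> x Kx; have xs := Ks x Kx; have xc := spectrum_characters HM xs.
  have [a [Ma xya]] : exists a, M a /\ ev x a <> ev y a.
    apply: contrapT => H; apply: nKy; have <- // : x = y.
    by apply: evP => a Ma; apply: contrapT => ne; apply: H; exists a.
  have [[c0 xc0] _ _ _] := xs; pose c := val c0.
  have Mc : M c by exact: set_valP.
  have xcn : (ev x c : R[i]) != 0 by rewrite (evE x c0).
  pose d := (ev y a : R[i]) *: c - c ** a.
  have Mca : M (c ** a) by exact: csubM.
  have Myc : M ((ev y a : R[i]) *: c) by exact: csubZ.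
  have Md : M d by exact: csubB.
  have dE t : characters t -> ev t d = (ev t c : R[i]) * (ev y a - ev t a).
    move=> tc; rewrite /d (chD tc Myc (csubN HM Mca)) -scaleN1r (chZ (-1) tc Mca).
    by rewrite (chZ (ev y a) tc Mc) (chM tc Mc Ma); ring.
  have [Mh sh] := star_mulE Md.
  have hE t : characters t -> Re (ev t (cstar d ** d)) = cabs (ev t d) ^+ 2.
    by move=> tc; rewrite ch_star_mul.
  have hx : 0 < Re (ev x (cstar d ** d)).
    rewrite hE// exprn_gt0// lt_def cabs_ge0 andbT; apply/eqP => /cabs_eq0.
    rewrite dE// => /eqP; rewrite mulf_eq0 (negbTE xcn) /= subr_eq0 => /eqP E.
    by apply: xya.
  set h := cstar d ** d in Mh sh hE hx *.
  have hx2 : 0 < Re (ev x h) / 2 by lra.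
  exists [set t | `|Re (ev x h) - Re (ev t h)| < Re (ev x h) / 2].
    exact: ev_Re_nbhs.
  exists h, (Re (ev x h) / 2); split => //.
  + by rewrite hE// dE// subrr mulr0 cabs0 expr0n.
  + split=> [t tc|t /= /ltW + _]; first by rewrite hE// sqr_ge0.
    by rewrite ler_distlC => /andP[H _]; lra.
Qed.

(** By separate_point each point off K has a neighbourhood that cutoffs
    separate from K; products of cutoffs treat finite unions of such
    neighbourhoods. *)
Theorem urysohn_cutoff (K C : set T) (e : R) : compact K -> K `<=` @spectrum R A M ->
  compact C -> C `<=` characters -> K `&` C = set0 -> 0 < e ->
  exists2 g, cutoff g & (forall x, K x -> 1 - e <= Re (ev x g)) /\
    (forall x, C x -> Re (ev x g) <= e).
Proof.
move=> cK Ks cC Cc KC e0; pose P (B : set T) := forall e : R, 0 < e ->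
  exists2 g, cutoff g & (forall x, K x -> 1 - e <= Re (ev x g)) /\
    (forall x, B x -> characters x -> Re (ev x g) <= e).
suff /(_ e e0) [g bg [H1 H2]] : P C.
  by exists g => //; split => // x Cx; apply: H2 => //; exact: Cc.
have Pmono B1 B2 : B1 `<=` B2 -> P B2 -> P B1.
  move=> B12 H d d0; have [g bg [H1 H2]] := H d d0; exists g => //.
  by split => // x /B12; exact: H2.
have Ploc y : characters y -> ~ K y -> exists2 N, nbhs y N & P N.
  move=> yc nKy; have [h [be [Mh sh be0 yh [h0 hK]]]] := separate_point cK Ks yc nKy.
  have b2 : 0 < be ^+ 2 by rewrite exprn_gt0.
  have b1 : 0 < be / 2 by lra.
  exists [set t | `|Re (ev y h) - Re (ev t h)| < be / 2].
    exact: ev_Re_nbhs.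
  move=> d d0.
  have al0 : 0 < (be / 2) ^+ 2 by rewrite exprn_gt0.
  have ab : (be / 2) ^+ 2 < be ^+ 2 by nra.
  have [f bf Hf] := cutoff_separate Mh sh al0 ab d0.
  exists f => //; split=> [x Kx|x Nx xc].
    have xc := spectrum_characters HM (Ks x Kx).
    have [+ _] := Hf x xc; apply; rewrite lerXn2r ?nnegrE ?(ltW be0)//.
      by apply: h0.
    exact: hK.
  have [_] := Hf x xc; apply; move: Nx; rewrite /= yh sub0r normrN => Nx.
  by rewrite -real_normK ?num_real// lerXn2r ?nnegrE// ltW.
apply: (@compact_ind _ P C _ Pmono _ cC).
(* Even for empty C some cutoff near 1 on K is required; separating K from the
   zero functional provides it. *)
- have nz : ~ K (@zeroT R A M).
    by move=> /Ks; rewrite (spectrumE HM) => -[_]; apply.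
  have [N _ PN] := Ploc _ (zero_character M) nz.
  exact: Pmono PN.
- move=> B1 B2 H1 H2 d d0; have d2 : 0 < d / 2 by lra.
  have [g1 b1 [K1 C1]] := H1 _ d2; have [g2 b2 [K2 C2]] := H2 _ d2.
  exists (g1 ** g2); first exact: cutoffM.
  have bnd g x : cutoff g -> characters x -> 0 <= Re (ev x g) <= 1.
    by move=> [_ _ _]; exact.
  split=> [x Kx|x Bx xc].
    have xc := spectrum_characters HM (Ks x Kx).
    rewrite ch_cutoffM//; have := K1 x Kx; have := K2 x Kx.
    have /andP[? ?] := bnd _ _ b1 xc; have /andP[? ?] := bnd _ _ b2 xc; nra.
  rewrite ch_cutoffM//.
  have /andP[? ?] := bnd _ _ b1 xc; have /andP[? ?] := bnd _ _ b2 xc.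
  by case: Bx => [/C1/(_ xc)|/C2/(_ xc)] ?; nra.
- move=> x Cx; apply: Ploc; first exact: Cc.
  by move=> Kx; have : (K `&` C) x by []; rewrite KC.
Qed.

End Urysohn.

(** * Integrals of step functions *)

Section Staircase.
Variable R : realFieldType.
Implicit Types (d u : R) (n : nat).

(** The largest multiple of d below u, truncated at n d. *)
Definition staircase d u n : R := \sum_(k <- iota 0 n) d * (k.+1%:R * d <= u)%R%:R.

Lemma staircaseS d u n :
  staircase d u n.+1 = staircase d u n + d * (n.+1%:R * d <= u)%R%:R.
Proof. by rewrite /staircase -addn1 iotaD big_cat /= big_seq1 add0n addn1. Qed.

Lemma staircase_le_top d u n : 0 <= d -> staircase d u n <= n%:R * d.
Proof.
move=> d0; elim: n => [|n IH]; first by rewrite /staircase big_nil mul0r.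
rewrite staircaseS -natr1 mulrDl mul1r; apply: lerD => //.
by rewrite ler_piMr// lern1 leq_b1.
Qed.

Lemma staircase_le d u n : 0 <= d -> 0 <= u -> staircase d u n <= u.
Proof.
move=> d0 u0; elim: n => [|n IH]; first by rewrite /staircase big_nil.
rewrite staircaseS; have [H|_] := boolP (n.+1%:R * d <= u); last first.
  by rewrite mulr0 addr0.
rewrite mulr1; apply: le_trans H; rewrite -natr1 mulrDl mul1r lerD2r.
exact: staircase_le_top.
Qed.

Lemma staircase_full d u n : 0 <= d -> n%:R * d <= u -> staircase d u n = n%:R * d.
Proof.
move=> d0; elim: n => [|n IH] H; first by rewrite /staircase big_nil mul0r.
rewrite staircaseS IH ?H ?mulr1; first by rewrite -natr1 mulrDl mul1r.
by apply: le_trans H; rewrite ler_wpM2r// ler_nat.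
Qed.

Lemma le_staircase d u n : 0 <= d -> u <= n%:R * d -> u <= staircase d u n + d.
Proof.
move=> d0; elim: n => [|n IH] H.
  by rewrite /staircase big_nil add0r (le_trans H)// mul0r.
rewrite staircaseS; have [H1|H1] := leP u (n%:R * d).
  apply: (le_trans (IH H1)); rewrite lerD2r lerDl.
  by rewrite mulr_ge0.
rewrite staircase_full ?(ltW H1)//.
move: H; rewrite -natr1 mulrDl mul1r => H.
by apply: (le_trans H); rewrite lerD2r lerDl mulr_ge0.
Qed.

End Staircase.

Section FiniteMeasureIntegral.
Context d {X : measurableType d} {R : realType}.
Variable m : {finite_measure set X -> \bar R}.

Lemma bounded_integrable (D : set X) (f : X -> R) (C : R) : measurable D ->
  measurable_fun D f -> (forall x, D x -> `|f x| <= C) ->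
  m.-integrable D (EFin \o f).
Proof.
move=> mD mf fC; apply: measurable_bounded_integrable => //.
  by rewrite -ge0_fin_numE// fin_num_measure.
exists C; split; first exact: num_real.
by move=> r Cr x Dx; exact: le_trans (fC x Dx) (ltW Cr).
Qed.

Lemma Rintegral_simple (D : set X) (s : seq (R * set X)) : measurable D ->
  (forall p, p \in s -> measurable p.2) ->
  m.-integrable D (EFin \o (fun x => \sum_(p <- s) p.1 * \1_(p.2) x)) /\
  Rintegral m D (fun x => \sum_(p <- s) p.1 * \1_(p.2) x) =
  \sum_(p <- s) p.1 * fine (m (p.2 `&` D)).
Proof.
move=> mD; elim: s => [|p s IH] ms.
  split.
    apply: (@bounded_integrable _ _ 0) => // [|x _]; last by rewrite big_nil normr0.
    rewrite (_ : (fun=> _) = cst 0); first exact: measurable_cst.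
    by apply/funext => x; rewrite big_nil.
  rewrite big_nil (_ : (fun=> _) = cst 0).
    by rewrite Rintegral_cst// mul0r.
  by apply/funext => x; rewrite big_nil.
have [|I1 I2] := IH; first by move=> q qs; apply: ms; rewrite inE qs orbT.
have mp : measurable p.2 by apply: ms; rewrite inE eqxx.
have i1 : m.-integrable D (EFin \o (\1_(p.2) : X -> R)).
  apply: (@bounded_integrable _ _ 1) => // x _.
  by rewrite indicE ger0_norm// lern1 leq_b1.
have ip : m.-integrable D (EFin \o (fun x => p.1 * \1_(p.2) x)).
  apply: (@bounded_integrable _ _ `|p.1|) => // [|x _].
    by apply: measurable_funM => //; exact: measurable_indic.
  by rewrite normrM ler_piMr// indicE ger0_norm// lern1 leq_b1.
have E : (fun x => \sum_(q <- p :: s) q.1 * \1_(q.2) x) =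
    (fun x => p.1 * \1_(p.2) x + \sum_(q <- s) q.1 * \1_(q.2) x).
  by apply/funext => x; rewrite big_cons.
rewrite E; split; first exact: (integrableD mD ip I1).
rewrite RintegralD// I2 big_cons RintegralZl//; congr (_ * _ + _).
by rewrite /Rintegral integral_indic.
Qed.

End FiniteMeasureIntegral.

(** * Positive functionals on the self-adjoint part *)

Record positive_ufunctional (R : realType) (A : cstarType R)
    (w : unitized A -> R[i]) : Prop := {
  puD : forall v v', w (v + v') = w v + w v' ;
  puZ : forall (z : R[i]) v, w (z *: v) = z * w v ;
  pu_ge0 : forall v, 0 <= w ((ustar v : unitized A) * v) ;
  pu_le : exists2 c : R, 0 <= c & forall v, cabs (w v) <= c * unorm1 v }.

Section RepresentingMeasure.
Local Open Scope complex_scope.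
Variables (R : realType) (A : cstarType R) (M : set A).
Hypothesis HM : abelian_csubalgebra M.
Local Notation T := {ptws M -> R[i]^o}.
Local Notation uA := (unitized A).
Local Notation characters := (@characters R A M).
Local Notation hball := (@hermitian_ball R A M).
Local Notation borelT := (g_sigma_algebraType (@open T)).
Implicit Types (a h : A) (z : R[i]).

(** This set is the self-adjoint part of M + C 1. *)
Lemma sa_subring :
  commuting_subring [set v : uA | M v.1 /\ ustar v = v :> uA].
Proof.
split=> [|v v' [Mv sv] [Mv' sv']|v v' [Mv sv] [Mv' sv']|v v' [Mv sv] [Mv' sv']] /=.
- by split; [exact: (csub0 HM)|exact: ustar1].
- split; first exact: (csubB HM Mv Mv').
  by rewrite ustarB sv sv'.
- have vv : v' * v = v * v'.
    apply: unitizedP; rewrite /= 1?mulrC//.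
    by rewrite (csub_comm HM Mv' Mv) addrAC.
  split; last by rewrite ustarM sv sv'.
  apply: (csubD HM); [apply: (csubD HM); [exact: csubM|exact: csubZ]|exact: csubZ].
- apply: unitizedP; rewrite /= 1?mulrC//.
  by rewrite (csub_comm HM Mv Mv') addrAC.
Qed.

Local Notation B := (comsub sa_subring).

Lemma sa_scalar (r : R) : (ustar (r%:C *: (1 : uA)) = r%:C *: (1 : uA) :> uA).
Proof. by rewrite ustarZ ustar1 conjc_real. Qed.

Definition sa_iota (r : R) : B :=
  @to_comsub uA _ sa_subring (r%:C *: (1 : uA))
    (conj (csubZ HM r%:C (csub0 HM)) (sa_scalar r)).

Definition sa_norm (b : B) : R := unorm1 (val b).

Lemma sa_norm0 : sa_norm 0 = 0.
Proof. by rewrite /sa_norm /unorm1 /= rnorm0 cabs0 addr0. Qed.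

Lemma sa_norm_ge0 b : 0 <= sa_norm b.
Proof. exact: unorm1_ge0. Qed.

Lemma sa_normM b b' : sa_norm (b * b') <= sa_norm b * sa_norm b'.
Proof. exact: unorm1M. Qed.

Lemma val_iotaM r b : val (sa_iota r * b) = r%:C *: val b :> uA.
Proof.
have -> : val (sa_iota r * b) = val (sa_iota r) * val b :> uA by [].
by rewrite /= uscalel mul1r.
Qed.

Lemma sa_norm_scale r b : sa_norm (sa_iota r * b) = `|r| * sa_norm b.
Proof. by rewrite /sa_norm val_iotaM unorm1Z cabs_real. Qed.

Definition sa_in h : B :=
  if pselect (M h /\ cstar h = h) is left Hh
  then @to_comsub uA _ sa_subring (uin h) (conj Hh.1 (etrans (ustar_in h) (congr1 (@uin R A) Hh.2)))
  else 0.

Lemma val_sa_in h : M h -> cstar h = h -> val (sa_in h) = uin h.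
Proof. by move=> Mh sh; rewrite /sa_in; case: pselect => // -[]. Qed.

Lemma sa_inD h k : M h -> cstar h = h -> M k -> cstar k = k ->
  sa_in (h + k) = sa_in h + sa_in k.
Proof.
move=> Mh sh Mk sk; apply: val_inj; rewrite rmorphD /= !val_sa_in ?uinD//.
  exact: csubD.
by rewrite cstarD sh sk.
Qed.

Lemma sa_inM h k : M h -> cstar h = h -> M k -> cstar k = k ->
  sa_in (h ** k) = sa_in h * sa_in k.
Proof.
move=> Mh sh Mk sk; apply: val_inj; rewrite rmorphM /= !val_sa_in ?uinM//.
  exact: csubM.
by rewrite cstarM sh sk; exact: (csub_comm HM Mk Mh).
Qed.

Lemma sa_inZ (r : R) h : M h -> cstar h = h -> sa_in (r%:C *: h) = sa_iota r * sa_in h.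
Proof.
move=> Mh sh; apply: val_inj; rewrite val_iotaM !val_sa_in ?uinZ//.
  exact: csubZ.
by rewrite cstarZ conjc_real sh.
Qed.

Lemma sa_norm_in h : M h -> cstar h = h -> sa_norm (sa_in h) = rnorm h.
Proof. by move=> Mh sh; rewrite /sa_norm val_sa_in// unorm1_in. Qed.

Local Notation qc := (quasi_character sa_iota sa_norm).

(** The complex-linear extension to M of a real-linear functional on
    self-adjoint elements. *)
Definition complexify (x : B -> R) : T :=
  fun a0 : M => x (sa_in (sreal (val a0))) +i* x (sa_in (simag (val a0))).

Lemma ev_complexify (x : B -> R) a : M a ->
  ev (complexify x) a = x (sa_in (sreal a)) +i* x (sa_in (simag a)).
Proof. by move=> Ma; have [a0 <-] := inMP Ma; rewrite (evE _ a0). Qed.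

Lemma sreal_unique h k : cstar h = h -> cstar k = k ->
  sreal (h + 'i *: k) = h /\ simag (h + 'i *: k) = k.
Proof.
move=> sh sk; have E : cstar (h + 'i *: k) = h - 'i *: k.
  rewrite cstarD cstarZ sh sk -scaleNr; congr (_ + _ *: _).
  by apply: complex_eq => /=; rewrite ?oppr0.
rewrite /sreal /simag E; split.
  rewrite addrACA subrr addr0 -mulr2n -[h *+ 2]scaler_nat scalerA.
  have -> : (2^-1)%:C * 2%:R = 1 :> R[i].
    by rewrite -(rmorph_nat (real_complex R)) -rmorphM/= mulVf// pnatr_eq0.
  by rewrite scale1r.
rewrite opprB addrC addrA subrK -mulr2n -[('i *: k) *+ 2]scaler_nat !scalerA.
have -> : (- 2^-1) *i * (2%:R * 'i) = 1 :> R[i].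
  rewrite -(rmorph_nat (real_complex R)).
  by apply: complex_eq => /=; field.
by rewrite scale1r.
Qed.

Lemma srealD a b : sreal (a + b) = sreal a + sreal b.
Proof. by rewrite /sreal cstarD addrACA scalerDr. Qed.
Lemma simagD a b : simag (a + b) = simag a + simag b.
Proof. by rewrite /simag cstarD opprD addrACA scalerDr. Qed.

Lemma srealZ_imag (z : R[i]) a :
  sreal (z *: a) = (Re z)%:C *: sreal a + (- Im z)%:C *: simag a /\
  simag (z *: a) = (Re z)%:C *: simag a + (Im z)%:C *: sreal a.
Proof.
have sa (r : R) (b : A) : cstar b = b -> cstar (r%:C *: b) = r%:C *: b.
  by move=> sb; rewrite cstarZ conjc_real sb.
have sab (b c : A) : cstar b = b -> cstar c = c -> cstar (b + c) = b + c.
  by move=> sb sc; rewrite cstarD sb sc.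
have E : z *: a = ((Re z)%:C *: sreal a + (- Im z)%:C *: simag a) +
    'i *: ((Re z)%:C *: simag a + (Im z)%:C *: sreal a).
  rewrite {1}(sreal_imag a); move: (sreal a) (simag a) => s t.
  rewrite !scalerDr !scalerA addrA [RHS](ACl (1*4*2*3)) /= -scalerDl -addrA -scalerDl.
  by congr (_ *: _ + _ *: _); apply: complex_eq; rewrite ?ReD ?ImD ?cReM ?cImM /=; ring.
rewrite E; apply: sreal_unique; apply: sab; apply: sa;
  by [exact: sreal_sa|exact: simag_sa].
Qed.

Lemma sreal_of_sa h : cstar h = h -> sreal h = h.
Proof.
move=> sh; have [] := sreal_unique sh (cstar0 A).
by rewrite scaler0 addr0.
Qed.

Lemma rnorm_sreal a : rnorm (sreal a) <= rnorm a.
Proof.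
rewrite /sreal rnormZ cabs_real ger0_norm ?invr_ge0//.
by have := rnormD a (cstar a); rewrite rnorm_star; lra.
Qed.

Lemma rnorm_simag a : rnorm (simag a) <= rnorm a.
Proof.
rewrite /simag rnormZ cabs_im normrN ger0_norm ?invr_ge0//.
by have := rnormB a (cstar a); rewrite rnorm_star; lra.
Qed.

Section QuasiCharacter.
Variable x : B -> R.
Hypothesis qx : qc x.

Let xD b b' : x (b + b') = x b + x b'. Proof. by case: qx. Qed.
Let xZ r b : x (sa_iota r * b) = r * x b. Proof. by case: qx. Qed.
Let xle b : `|x b| <= sa_norm b. Proof. by case: qx. Qed.
Let x0 : x 0 = 0. Proof. by have := xD 0 0; rewrite addr0; lra. Qed.

Lemma complexify_hermitian : hball (complexify x).
Proof.
split.
- move=> a b Ma Mb; rewrite !ev_complexify//; last exact: csubD.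
  rewrite srealD simagD !sa_inD ?xD //; first [exact: srealM|exact: simagM|exact: sreal_sa|exact: simag_sa].
- move=> z a Ma; rewrite !ev_complexify//; last exact: csubZ.
  have [-> ->] := srealZ_imag z a.
  have Mr := srealM HM Ma; have Mi := simagM HM Ma.
  have sr := sreal_sa a; have si := simag_sa a.
  have sa (r : R) (b : A) : cstar b = b -> cstar (r%:C *: b) = r%:C *: b.
    by move=> sb; rewrite cstarZ conjc_real sb.
  have MZ r b : M b -> M (r%:C *: b) by exact: csubZ.
  move: Mr Mi sr si; move: (sreal a) (simag a) => s t Ms Mt ss st.
  have [[[p0 q0] r0] u0] := (MZ (Re z) s Ms, MZ (- Im z) t Mt, MZ (Re z) t Mt, MZ (Im z) s Ms).
  rewrite (sa_inD p0 (sa _ _ ss) q0 (sa _ _ st)) (sa_inD r0 (sa _ _ st) u0 (sa _ _ ss)) !xD.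
  rewrite (sa_inZ _ Ms ss) (sa_inZ _ Mt st) (sa_inZ _ Mt st) (sa_inZ _ Ms ss) !xZ.
  by apply: complex_eq; rewrite ?cReM ?cImM /=; ring.
- move=> a Ma; have Msa := csub_star HM Ma; rewrite !ev_complexify//.
  have -> : sreal (cstar a) = sreal a by rewrite /sreal cstarK addrC.
  have -> : simag (cstar a) = (- 1)%:C *: simag a.
    by rewrite /simag cstarK -opprB scalerN rmorphN1 scaleN1r.
  by rewrite (sa_inZ (- 1) (simagM HM Ma) (simag_sa a)) xZ mulN1r.
- move=> a Ma; rewrite ev_complexify//; apply: (le_trans (cabs_le _)) => /=.
  have H1 := xle (sa_in (sreal a)); have H2 := xle (sa_in (simag a)).
  rewrite (sa_norm_in (srealM HM Ma) (sreal_sa a)) in H1.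
  rewrite (sa_norm_in (simagM HM Ma) (simag_sa a)) in H2.
  have := rnorm_sreal a; have := rnorm_simag a; lra.
Qed.

Lemma Re_ev_complexify h : M h -> cstar h = h ->
  Re (ev (complexify x) h) = x (sa_in h).
Proof. by move=> Mh sh; rewrite ev_complexify//= sreal_of_sa. Qed.

End QuasiCharacter.

Section Functional.
Variable w : uA -> R[i].
Hypothesis pw : positive_ufunctional w.

Definition sa_restrict (b : B) : R := Re (w (val b)).

Lemma sa_restrict_positive : positive_functional sa_iota sa_norm sa_restrict.
Proof.
rewrite /sa_restrict; split.
- by move=> b b'; rewrite rmorphD/= (puD pw) ReD.
- by move=> r b; rewrite val_iotaM (puZ pw) cReM /= mul0r subr0.
- move=> b; have [_ sb] := comsubP b.
  have := pu_ge0 pw (val b); rewrite sb => /ge0_complex[+ _].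
  by rewrite rmorphM.
- have [c c0 Hc] := pu_le pw; exists c => // b.
  exact: le_trans (cabs_Re _) (Hc _).
Qed.

Lemma w_star v : w (ustar v) = conjC (w v).
Proof.
have := @form_hermitian R uA (fun v v' => w ((ustar v : uA) * v')).
move=> /(_ _ _ _ _ _ (1 : uA) v); rewrite ustar1 mul1r mulr1; apply.
- by move=> a b c; rewrite ustarD mulrDl (puD pw).
- by move=> a b c; rewrite mulrDr (puD pw).
- by move=> z a b; rewrite ustarZ uscalel (puZ pw).
- by move=> z a b; rewrite uscaler (puZ pw).
- exact: pu_ge0.
Qed.

Lemma w_sa h : cstar h = h -> w (uin h) = (Re (w (uin h)))%:C.
Proof.
move=> sh; have := w_star (uin h); rewrite ustar_in sh => E.
have E2 := congr1 (@complex.Im R) E; rewrite Im_conjc in E2.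
by apply: complex_eq => //=; lra.
Qed.

End Functional.

Lemma measurable_evRe (D : set borelT) a : measurable D ->
  measurable_fun D (fun x : borelT => Re (ev (x : T) a)).
Proof.
move=> mD; apply: measurable_funTS.
apply: (measurability _ (RGenOpens.measurableE R)).
move=> _ [_ [b [c ->] <-]]; rewrite setTI.
apply: sub_sigma_algebra; rewrite openE => x /= xbc.
have o : open `]b, c[%classic by exact: interval_open.
move: o; rewrite openE => /(_ _ xbc) /nbhs_ballP[e /= e0 He].
apply: filterS (ev_Re_nbhs x a e0) => t tx; apply: He.
by rewrite -ball_normE.
Qed.

Lemma T_measurable_closed (F : set T) : closed F -> measurable (F : set borelT).
Proof.
move=> cF; rewrite -(setCK F); apply: measurableC; apply: sub_sigma_algebra.
exact: closed_openC.
Qed.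

Lemma measurable_characters : measurable (characters : set borelT).
Proof. by apply: T_measurable_closed; exact: closed_characters. Qed.

Lemma measurable_spectrum : measurable (@spectrum R A M : set borelT).
Proof.
rewrite (spectrumE HM); apply: measurableD; first exact: measurable_characters.
apply: T_measurable_closed; apply: accessible_closed_set1.
exact: hausdorff_accessible (T_hausdorff (M := M)).
Qed.

(** Multiplicativity at squares of self-adjoint elements polarizes to
    products, and the bound on the norm is a matter of scaling. *)
Lemma hermitian_multiplicative (x : T) : hball x ->
  (forall h, M h -> cstar h = h -> rnorm h <= 1 ->
    Re (ev x (h ** h)) = Re (ev x h) ^+ 2) -> characters x.
Proof.
move=> xh H; split => //.
have sq h : M h -> cstar h = h -> Re (ev x (h ** h)) = Re (ev x h) ^+ 2.
  move=> Mh sh; pose r := (rnorm h + 1)^-1.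
  have n0 : 0 < rnorm h + 1 by have := rnorm_ge0 h; lra.
  have r0 : 0 < r by rewrite invr_gt0.
  have Mr : M (r%:C *: h) by exact: (csubZ HM r%:C Mh).
  have sr : cstar (r%:C *: h) = r%:C *: h by rewrite cstarZ conjc_real sh.
  have nr : rnorm (r%:C *: h) <= 1.
    by rewrite rnormZ cabs_real gtr0_norm// mulrC ler_pdivrMr// mul1r lerDl.
  have := H _ Mr sr nr; rewrite cmulZl cmulZr scalerA.
  have Mhh : M (h ** h) by exact: csubM.
  rewrite (hfZ xh _ Mhh) (hfZ xh _ Mh) -rmorphM/= !cReM /= !mul0r !subr0 exprMn expr2.
  by apply: mulfI; rewrite mulf_neq0// gt_eqF.
have mul_sa h k : M h -> cstar h = h -> M k -> cstar k = k ->
    ev x (h ** k) = (ev x h : R[i]) * ev x k.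
  move=> Mh sh Mk sk.
  have Mhk : M (h + k) by exact: csubD.
  have shk : cstar (h + k) = h + k by rewrite cstarD sh sk.
  have mhk : M (h ** k) by exact: csubM.
  have mhh : M (h ** h) by exact: csubM.
  have mkk : M (k ** k) by exact: csubM.
  have ckh : k ** h = h ** k by exact: (csub_comm HM Mk Mh).
  have smhk : cstar (h ** k) = h ** k by rewrite cstarM sh sk ckh.
  have := sq _ Mhk shk.
  rewrite cmulDl !cmulDr ckh.
  have m1 : M (h ** h + h ** k) by exact: csubD.
  have m2 : M (h ** k + k ** k) by exact: csubD.
  rewrite (hfD xh m1 m2) (hfD xh mhh mhk) (hfD xh mhk mkk) (hfD xh Mh Mk) !ReD.
  rewrite (sq h)// (sq k)// => E.
  rewrite (hf_real xh mhk smhk) (hf_real xh Mh sh) (hf_real xh Mk sk) -rmorphM/=.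
  by congr (_%:C); move: E; rewrite sqrrD mulr2n; lra.
move=> a b Ma Mb.
have [Mra Mia] := (srealM HM Ma, simagM HM Ma).
have [Mrb Mib] := (srealM HM Mb, simagM HM Mb).
have [sra sia] := (sreal_sa a, simag_sa a).
have [srb sib] := (sreal_sa b, simag_sa b).
rewrite (sreal_imag a) (sreal_imag b).
move: (sreal a) (simag a) (sreal b) (simag b) Mra Mia Mrb Mib sra sia srb sib.
move=> p q r s Mp Mq Mr Ms sp sq' sr ss.
have MZ z (c : A) : M c -> M (z *: c) by exact: csubZ.
have MM (c d : A) : M c -> M d -> M (c ** d) by exact: csubM.
have MD (c d : A) : M c -> M d -> M (c + d) by exact: csubD.
rewrite cmulDl !cmulDr !cmulZl !cmulZr scalerA.
have [m1 m2 m3 m4] := And4 (MM p r Mp Mr) (MM p s Mp Ms) (MM q r Mq Mr) (MM q s Mq Ms).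
rewrite (hfD xh (MD _ _ m1 (MZ 'i _ m2)) (MD _ _ (MZ 'i _ m3) (MZ ('i * 'i) _ m4))).
rewrite (hfD xh m1 (MZ 'i _ m2)) (hfD xh (MZ 'i _ m3) (MZ ('i * 'i) _ m4)).
rewrite (hfZ xh _ m2) (hfZ xh _ m3) (hfZ xh _ m4).
rewrite (hfD xh Mp (MZ 'i _ Mq)) (hfD xh Mr (MZ 'i _ Ms)) (hfZ xh _ Mq) (hfZ xh _ Ms).
rewrite !mul_sa//.
have G (P Q U V : R[i]) : P * U + 'i * (P * V) + ('i * (Q * U) + 'i * 'i * (Q * V)) =
    (P + 'i * Q) * (U + 'i * V) by ring.
exact: G.
Qed.

End RepresentingMeasure.

(** * Representing measures on the spectrum *)

Section RepresentingMeasure2.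
Local Open Scope complex_scope.
Variables (R : realType) (A : cstarType R) (M : set A).
Hypothesis HM : abelian_csubalgebra M.
Local Notation T := {ptws M -> R[i]^o}.
Local Notation uA := (unitized A).
Local Notation characters := (@characters R A M).
Local Notation spectrum := (@spectrum R A M).
Local Notation hball := (@hermitian_ball R A M).
Local Notation borelT := (g_sigma_algebraType (@open T)).
Local Notation B := (comsub (sa_subring HM)).
Implicit Types (a h : A).

Lemma evRe_le (x : T) h : hball x -> M h -> `|Re (ev x h)| <= 2 * rnorm h.
Proof. by move=> xh Mh; apply: le_trans (cabs_Re _) _; exact: hf_le. Qed.

Lemma char_hball (x : T) : characters x -> hball x.
Proof. by case. Qed.

Lemma integrable_evRe (m : {finite_measure set borelT -> \bar R})
    (D : set borelT) h : measurable D -> D `<=` characters -> M h ->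
  m.-integrable D (EFin \o (fun x : borelT => Re (ev (x : T) h))).
Proof.
move=> mD Dc Mh; apply: (@bounded_integrable _ _ _ _ _ _ (2 * rnorm h)) => //.
  exact: measurable_evRe.
by move=> x /Dc xc; apply: evRe_le => //; exact: char_hball.
Qed.

Lemma closed_evRe (c : R) h : closed [set x : T | c <= Re (ev x h)].
Proof.
have -> : [set x : T | c <= Re (ev x h)] = ~` [set x | Re (ev x h) < c].
  by apply/seteqP; split=> x /=; rewrite leNgt => /negP.
apply: open_closedC; rewrite openE => x /= xc.
have d0 : 0 < c - Re (ev x h) by rewrite subr_gt0.
apply: filterS (ev_Re_nbhs x h d0) => t /=; rewrite ltr_distlC => /andP[_].
by rewrite addrC subrK.
Qed.

Section Construction.
Variable w : uA -> R[i].
Hypothesis pw : positive_ufunctional w.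
Let W := sa_restrict (HM := HM) w.

(** The content of positive_functional_content, moved to functionals on M by
    complexify, is regularized to a Radon measure. Near a functional that is
    not multiplicative some x (h h) - (x h)^2 stays away from 0, so the
    measure lives on characters. The bound of w by step functions on closed
    level sets of h passes to the measure, and finer staircases turn it into a
    bound by the integral. *)
Lemma representing_measure_characters :
  exists m : {finite_measure set borelT -> \bar R}, [/\
    m (~` characters) = 0%E,
    (m setT <= (Re (w 1))%:E)%E,
    forall (E : set borelT) (e : R), measurable E -> (0 < e)%R ->
      exists K : set T, [/\ compact K, K `<=` E & (m E <= m K + e%:E)%E] &
    forall h, M h -> cstar h = h ->
      Re (w (uin h)) <= Rintegral m characters (fun x => Re (ev (x : T) h))].
Proof.
have [nu [[nu0 nuU nuq nuT] nus nui]] :=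
  positive_functional_content (sa_norm0 HM) (@sa_norm_ge0 _ _ _ HM)
    (@sa_normM _ _ _ HM) (@sa_norm_scale _ _ _ HM) (sa_restrict_positive HM pw).
pose pt := complexify (HM := HM).
pose nu' (E : set T) := nu (pt @^-1` E).
have nu'0 E : 0 <= nu' E by exact: nu0.
have nu'U E F : E `&` F = set0 -> nu' (E `|` F) = nu' E + nu' F.
  move=> EF; rewrite /nu' preimage_setU nuU//.
  by rewrite -preimage_setI EF preimage_set0.
have nu'Y : nu' (~` hball) = 0.
  by apply: nuq => x qx; apply; exact: complexify_hermitian.
have [m [mK mU mU0 mreg]] := content_radon nu'0 nu'U (T_hausdorff (M := M))
  (compact_hermitian_ball HM) nu'Y.
have T2 := T_hausdorff (M := M).
have nuc0 : m (~` characters) = 0%E.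
  apply: mU0; first exact: closed_openC (closed_characters HM).
  move=> K cK Kc; apply: (@compact_ind _ (fun E => nu' E = 0) K _ _ _ cK).
  - exact: content0 nu'U.
  - move=> E F EF F0; apply/eqP; rewrite eq_le nu'0 andbT -F0.
    exact: (le_content nu'0 nu'U).
  - move=> E F E0 F0; apply/eqP; rewrite eq_le nu'0 andbT.
    by apply: (le_trans (contentU_le nu'0 nu'U _ _)); rewrite E0 F0 addr0.
  - move=> x Kx; have xnc := Kc x Kx.
    have [xh|xnh] := EM (hball x); last first.
      exists (~` hball) => //; apply: open_nbhs_nbhs; split => //.
      by apply: closed_openC; exact: compact_closed T2 (compact_hermitian_ball HM).
    have [h [Mh sh h1 hne]] : exists h, [/\ M h, cstar h = h, rnorm h <= 1 &
        Re (ev x (h ** h)) <> Re (ev x h) ^+ 2].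
      apply: contrapT => H; apply: xnc; apply: (hermitian_multiplicative HM xh).
      by move=> h Mh sh h1; apply: contrapT => ne; apply: H; exists h.
    pose q := `|Re (ev x (h ** h)) - Re (ev x h) ^+ 2|.
    have q0 : 0 < q by rewrite normr_gt0 subr_eq0; exact/eqP.
    have q2 : 0 < q / 2 by rewrite divr_gt0.
    have Mhh : M (h ** h) by exact: csubM.
    pose r := 2 * rnorm h + 1 + `|Re (ev x h)|.
    have r0 : 0 < r.
      by rewrite ltr_wpDr ?normr_ge0// ltr_wpDl// mulr_ge0// rnorm_ge0.
    pose d := Num.min 1 (q / (4 * (r + 1 + `|Re (ev x h)|))).
    have rr : 0 < 4 * (r + 1 + `|Re (ev x h)|).
      by rewrite mulr_gt0// ltr_wpDr// addr_gt0.
    have d0 : 0 < d by rewrite lt_min ltr01 divr_gt0.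
    have q4 : 0 < q / 4 by rewrite divr_gt0.
    exists [set t | q / 4 < `|Re (ev t (h ** h)) - Re (ev t h) ^+ 2|].
      apply: filterS (filterI (ev_Re_nbhs x (h ** h) q4) (ev_Re_nbhs x h d0)).
      move=> t /= [t1 t2].
      have d1 : d <= 1 by rewrite ge_min lexx.
      have dq : d * (4 * (r + 1 + `|Re (ev x h)|)) <= q.
        by rewrite -ler_pdivlMr// ge_min lexx orbT.
      have t3 : `|Re (ev x h) ^+ 2 - Re (ev t h) ^+ 2| < q / 4.
        rewrite subr_sqr normrM.
        have : `|Re (ev x h) + Re (ev t h)| <= 1 + 2 * `|Re (ev x h)|.
          have -> : Re (ev x h) + Re (ev t h) =
             2 * Re (ev x h) - (Re (ev x h) - Re (ev t h)) by ring.
          apply: (le_trans (ler_normB _ _)); rewrite normrM ger0_norm//.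
          by rewrite addrC lerD2r (le_trans (ltW t2)).
        have := normr_ge0 (Re (ev x h) + Re (ev t h)); have := normr_ge0 (Re (ev x h)).
        have := normr_ge0 (Re (ev x h) - Re (ev t h)).
        have := rnorm_ge0 h; move: t2 dq; rewrite /r.
        move: (`|Re (ev x h) + _|) (`|Re (ev x h) - _|) (`|Re (ev x h)|) (rnorm h).
        by move=> a1 a2 a3 a4; nra.
      have q_le : q <= `|Re (ev x (h ** h)) - Re (ev t (h ** h))| +
          `|Re (ev x h) ^+ 2 - Re (ev t h) ^+ 2| + `|Re (ev t (h ** h)) - Re (ev t h) ^+ 2|.
        rewrite /q.
        have -> : Re (ev x (h ** h)) - Re (ev x h) ^+ 2 =
          (Re (ev x (h ** h)) - Re (ev t (h ** h))) -
          (Re (ev x h) ^+ 2 - Re (ev t h) ^+ 2) + (Re (ev t (h ** h)) - Re (ev t h) ^+ 2) by ring.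
        by apply: (le_trans (ler_normD _ _)); rewrite lerD2r ler_normB.
      by lra.
    apply/eqP; rewrite eq_le nu'0 andbT /nu'.
    have Ns : sa_norm (sa_in HM h) <= 1 by rewrite sa_norm_in.
    pose P := [set y : B -> R | q / 4 < y (sa_in HM h * sa_in HM h) - y (sa_in HM h) ^+ 2].
    have E0 : nu P = 0 by exact: nus.
    pose Q := [set y : B -> R | ~ quasi_character (sa_iota HM) (@sa_norm _ _ _ HM) y].
    have Q0 : nu Q = 0 by apply: nuq => y qy; apply.
    apply: (@le_trans _ _ (nu (P `|` Q))); last first.
      by apply: (le_trans (contentU_le nu0 nuU _ _)); rewrite E0 Q0 addr0.
    apply: (le_content nu0 nuU) => y /=.
    have [qy|nqy] := EM (quasi_character (sa_iota HM) (@sa_norm _ _ _ HM) y); last by right.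
    rewrite /pt !Re_ev_complexify// ?sa_inM//; last by rewrite cstarM sh.
    case: qy => _ _ _ sy; rewrite ger0_norm; first by left.
    by rewrite subr_ge0.
have nu1 : nu setT = Re (w 1) by rewrite nuT.
have mT : (m setT <= (Re (w 1))%:E)%E.
  by rewrite -nu1; exact: (mU setT openT).
have mc : measurable (characters : set borelT) by exact: measurable_characters.
have mF c h : measurable ([set x : T | c <= Re (ev x h)] : set borelT).
  by apply: T_measurable_closed; exact: closed_evRe.
have mhb : measurable (hball : set borelT).
  by apply: T_measurable_closed; exact: compact_closed T2 (compact_hermitian_ball HM).
have le_char (F : set T) : closed F -> nu' F <= fine (m (F `&` characters)).
  move=> cF; have mF' : measurable (F : set borelT) by exact: T_measurable_closed.
  have -> : nu' F = nu' (F `&` hball).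
    apply/eqP; rewrite eq_le; apply/andP; split; last first.
      by apply: (le_content nu'0 nu'U) => x [].
    have FE : F `<=` (F `&` hball) `|` ~` hball.
      by move=> x Fx; have [xh|xh] := EM (hball x); [left|right].
    apply: (le_trans (le_content nu'0 nu'U FE)).
    by apply: (le_trans (contentU_le nu'0 nu'U _ _)); rewrite nu'Y addr0.
  rewrite -lee_fin fineK; last exact: fin_num_measure (measurableI _ _ mF' mc).
  have cFh : compact (F `&` hball).
    by rewrite setIC; apply: compact_closedI => //; exact: compact_hermitian_ball.
  apply: (le_trans (mK _ cFh)).
  have sub : F `&` hball `<=` (F `&` characters) `|` ~` characters.
    by move=> x [Fx _]; have [xh|xh] := EM (characters x); [left|right].
  apply: (@le_trans _ _ (m ((F `&` characters) `|` ~` characters))).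
    apply: le_measure => //; rewrite inE.
    - exact: measurableI.
    - by apply: measurableU; [exact: measurableI|exact: measurableC].
  have := @measureU2 _ _ _ m _ _ (measurableI _ _ mF' mc) (measurableC mc).
  move/le_trans; apply; rewrite -[leRHS]adde0; apply: leeD => //.
  by move: nuc0 => /eqP; rewrite eq_le => /andP[].
have QE : fine (m characters) = Re (w 1).
  apply/eqP; rewrite eq_le; apply/andP; split.
    rewrite -lee_fin fineK; last exact: fin_num_measure.
    by apply: le_trans mT; apply: le_measure => //; rewrite inE//; exact: measurableT.
  rewrite -nu1 -[leRHS](congr1 (fun E => fine (m E)) (setTI characters)).
  by apply: (le_char setT); exact: closedT.
have top : nu (pt @^-1` setT) = fine (m ([set: borelT] `&` characters)).
  exact: etrans nu1 (esym (etrans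
    (congr1 (fun E => fine (m E)) (setTI (characters : set borelT))) QE)).
exists m; split.
- exact: nuc0.
- exact: mT.
- exact: mreg.
move=> h Mh sh.
have wE : Re (w (uin h)) = W (sa_in HM h) by rewrite /W /sa_restrict val_sa_in.
rewrite wE; set I := Rintegral _ _ _.
pose c := 2 * rnorm h + 1.
have c0 : 0 < c by rewrite ltr_wpDl// mulr_ge0// rnorm_ge0.
(* Staircases with steps of height 2 c / (n + 1) over the interval [- c, c],
   which contains the values of h. *)
suff key n : W (sa_in HM h) <= I + (2 * c / n.+1%:R) * Re (w 1).
  apply/ler_addgt0Pr => e e0.
  have Q0 : 0 <= Re (w 1) by rewrite -QE fine_ge0.
  pose D := 2 * c * Re (w 1) / e.
  have D0 : 0 <= D by rewrite divr_ge0 ?(ltW e0)// !mulr_ge0// ltW.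
  have := key (Num.bound D) => /le_trans; apply; rewrite lerD2l.
  rewrite mulrAC ler_pdivrMr// [leRHS]mulrC -ler_pdivrMr//.
  by rewrite (le_trans (ltW (archi_boundP D0)))// ler_nat.
pose d := 2 * c / n.+1%:R.
have d0 : 0 < d by rewrite divr_gt0// mulr_gt0.
have nd : n.+1%:R * d = 2 * c by rewrite /d mulrC divfK.
pose F k := [set x : T | k.+1%:R * d - c <= Re (ev x h)].
pose sT : seq (R * set borelT) := (- c + d, setT) :: [seq (d, F k : set borelT) | k <- iota 0 n.+1].
pose sB : seq (R * set (B -> R)) := [seq (p.1, pt @^-1` (p.2 : set T)) | p <- sT].
have sumE (x : T) : \sum_(p <- sT) p.1 * \1_(p.2) x =
    - c + d + staircase d (Re (ev x h) + c) n.+1.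
  rewrite big_cons big_map indicT mulr1; congr (_ + _).
  rewrite /staircase; apply: eq_bigr => k _; congr (_ * _).
  rewrite indicE; congr (nat_of_bool _)%:R.
  by rewrite -lerBlDr; apply/idP/idP; rewrite inE.
have step1 : W (sa_in HM h) <= \sum_(p <- sB) p.1 * nu p.2.
  apply: nui => x qx; rewrite big_map /=.
  have -> : \sum_(p <- sT) p.1 * \1_(pt @^-1` p.2) x = \sum_(p <- sT) p.1 * \1_(p.2) (pt x).
    by apply: eq_bigr => p _; congr (_ * _); rewrite !indicE; congr (nat_of_bool _)%:R;
       apply/idP/idP; rewrite !inE.
  rewrite sumE -(Re_ev_complexify x Mh sh).
  have xh := complexify_hermitian qx.
  have := evRe_le xh Mh; rewrite ler_norml => /andP[l1 l2].
  have := @le_staircase _ d (Re (ev (pt x) h) + c) n.+1 (ltW d0).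
  rewrite nd -/pt => H; have := H _; rewrite /c => H'.
  have : Re (ev (pt x) h) + (2 * rnorm h + 1) <= 2 * (2 * rnorm h + 1) by rewrite /pt; lra.
  by move=> /H'; rewrite /pt; lra.
apply: (le_trans step1).
have step2 : \sum_(p <- sB) p.1 * nu p.2 <= \sum_(p <- sT) p.1 * fine (m (p.2 `&` characters)).
  rewrite big_map big_seq [leRHS]big_seq; apply: ler_sum => p.
  rewrite inE => /orP[/eqP ->|/mapP[k _ ->]].
    exact: (eq_ind _ (fun z => _ <= _ * z) (lexx _) _ top).
  by apply: ler_wpM2l; [exact: ltW|apply: le_char; exact: closed_evRe].
apply: (le_trans step2).
have msT p : p \in sT -> measurable p.2.
  rewrite inE => /orP[/eqP ->|/mapP[k _ ->]]; first exact: measurableT.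
  exact: mF.
have [I1 <-] := Rintegral_simple m mc msT.
have ih := integrable_evRe m mc (@subset_refl _ _) Mh.
have icst : m.-integrable (characters : set borelT) (EFin \o cst d).
  exact: finite_measure_integrable_cst.
rewrite -QE -(Rintegral_cst m mc d) -RintegralD//.
apply: le_Rintegral => //; first exact: (integrableD mc ih icst).
move=> x xc; rewrite sumE.
have := evRe_le (char_hball xc) Mh; rewrite ler_norml => /andP[l1 l2].
have u0 : 0 <= Re (ev (x : T) h) + c by rewrite /c; lra.
have := staircase_le n.+1 (ltW d0) u0; lra.
Qed.

End Construction.
End RepresentingMeasure2.

Section RepresentingMeasure3.
Local Open Scope complex_scope.
Variables (R : realType) (A : cstarType R) (M : set A).
Hypothesis HM : abelian_csubalgebra M.
Local Notation T := {ptws M -> R[i]^o}.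
Local Notation uA := (unitized A).
Local Notation characters := (@characters R A M).
Local Notation spectrum := (@spectrum R A M).
Local Notation borelT := (g_sigma_algebraType (@open T)).
Implicit Types (m : {finite_measure set borelT -> \bar R}).

Lemma spectrum_sub : spectrum `<=` characters.
Proof. by rewrite (spectrumE HM) => x []. Qed.

(** The only character off the spectrum is 0, where the integrand vanishes. *)
Lemma Rintegral_characters m h :
  Rintegral m characters (fun x => Re (ev (x : T) h)) =
  Rintegral m spectrum (fun x => Re (ev (x : T) h)).
Proof.
rewrite Rintegral_mkcond [RHS]Rintegral_mkcond; congr (Rintegral _ _ _).
apply/funext => x; rewrite /patch.
have [xs|xs] := boolP (x \in spectrum).
  by rewrite ifT// inE; apply: spectrum_sub; rewrite inE in xs.
have [xc|//] := boolP (x \in characters).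
have -> : x = @zeroT R A M.
  apply: contrapT => xz; move/negP: xs; apply; rewrite inE (spectrumE HM).
  by split; [rewrite inE in xc|].
by rewrite /ev; case: pselect.
Qed.

Lemma T_measurable_compact (K : set T) : compact K -> measurable (K : set borelT).
Proof.
by move=> cK; apply: T_measurable_closed; exact: compact_closed (T_hausdorff (M := M)) cK.
Qed.

(** On self-adjoint elements the inequality of representing_measure_characters
    holds for h and for - h, hence it is an equality. *)
Lemma representing_measure (w : uA -> R[i]) : positive_ufunctional w ->
  exists m, [/\ radon m, (m setT <= (Re (w 1))%:E)%E &
    forall a : M, w (uin (val a)) = cintegral m (fun x => x a)].
Proof.
move=> pw; have [m [m0 mT mreg mle]] := representing_measure_characters HM pw.
have ms : measurable (spectrum : set borelT) by exact: measurable_spectrum.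
have moo : (m (spectrum : set borelT) < +oo)%E.
  by rewrite -ge0_fin_numE//; exact: fin_num_measure.
pose n : {finite_measure set borelT -> \bar R} := mfrestr ms moo.
have nE (E : set borelT) : n E = m (E `&` spectrum) by [].
have nm (E : set borelT) : measurable E -> (n E <= m E)%E.
  move=> mE; rewrite nE; apply: le_measure; rewrite ?inE//.
  exact: measurableI.
exists n; split.
- move=> E mE; apply/eqP; rewrite eq_le; apply/andP; split.
    apply/lee_addgt0Pr => e e0.
    have [K [cK KE]] := mreg _ _ (measurableI _ _ mE ms) e0.
    rewrite nE => /le_trans; apply; apply: leeD => //.
    have -> : m K = n K.
      by rewrite nE; congr (m _); apply/seteqP; split=> [x Kx|x []//]; split=> //; case: (KE x Kx).
    by apply: ereal_sup_ubound; exists K => //; do 2?split; move=> // x /KE[].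
  apply: ge_ereal_sup => _ [K [[cK _] KE] <-].
  by apply: le_measure; rewrite ?inE//; exact: T_measurable_compact.
- exact: le_trans (nm _ measurableT) mT.
have int h : M h -> cstar h = h ->
    w (uin h) = (Rintegral n spectrum (fun x => Re (ev (x : T) h)))%:C.
  move=> Mh sh; rewrite (w_sa pw sh); congr (_%:C).
  have -> : Rintegral n spectrum (fun x => Re (ev (x : T) h)) =
      Rintegral m spectrum (fun x => Re (ev (x : T) h)).
    congr (fine _); apply: eq_measure_integral => E mE Es.
    by apply: etrans (nE E) _; congr (m _); apply/setIidl.
  have ih := integrable_evRe m ms spectrum_sub Mh.
  apply/eqP; rewrite eq_le -Rintegral_characters mle//=.
  have MZ : M ((-1)%:C *: h) by exact: csubZ.
  have sZ : cstar ((-1)%:C *: h) = (-1)%:C *: h by rewrite cstarZ sh conjc_real.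
  have := mle _ MZ sZ.
  rewrite uinZ (puZ pw) cReM /= mul0r subr0 mulN1r Rintegral_characters.
  have -> : Rintegral m spectrum (fun x => Re (ev (x : T) ((-1)%:C *: h))) =
      -1 * Rintegral m spectrum (fun x => Re (ev (x : T) h)).
    rewrite -RintegralZl//; apply: eq_Rintegral => x; rewrite inE => xs.
    have [xh _] := spectrum_sub xs.
    by rewrite (hfZ xh _ Mh) cReM /= mul0r subr0.
  by rewrite mulN1r lerN2 -Rintegral_characters.
move=> a0; have Ma : M (val a0) by exact: set_valP.
have Mr := srealM HM Ma; have Mi := simagM HM Ma.
have sr := sreal_sa (val a0); have si := simag_sa (val a0).
have E : val a0 = sreal (val a0) + 'i *: simag (val a0) := sreal_imag (val a0).
have xE x : spectrum x -> x a0 = Re (ev x (sreal (val a0))) +i* Re (ev x (simag (val a0))).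
  move=> /spectrum_sub[xh _]; rewrite -(evE x a0) {1}E.
  rewrite (hfD xh Mr (csubZ HM 'i Mi)) (hfZ xh 'i Mi).
  rewrite (hf_real xh Mr sr) (hf_real xh Mi si).
  by apply: complex_eq; rewrite ?ReD ?ImD ?cReM ?cImM /=; ring.
have wE (s t : A) : w (uin (s + 'i *: t)) = w (uin s) + 'i * w (uin t).
  by rewrite uinD uinZ (puD pw) (puZ pw).
rewrite /cintegral {1}E wE (int _ Mr sr) (int _ Mi si).
rewrite (_ : Rintegral n spectrum (fun x => Re (x a0)) =
  Rintegral n spectrum (fun x => Re (ev (x : T) (sreal (val a0))))); last first.
  by apply: eq_Rintegral => x; rewrite inE => /xE ->.
rewrite (_ : Rintegral n spectrum (fun x => Im (x a0)) =
  Rintegral n spectrum (fun x => Re (ev (x : T) (simag (val a0))))); last first.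
  by apply: eq_Rintegral => x; rewrite inE => /xE ->.
have G (p q : R) : p%:C + 'i * q%:C = p +i* q :> R[i].
  by apply: complex_eq; rewrite ?ReD ?ImD ?cReM ?cImM /=; ring.
exact: G.
Qed.

End RepresentingMeasure3.

(** * Indicator functions as limits of cutoffs *)

Section Chi.
Local Open Scope complex_scope.
Variables (R : realType) (A : cstarType R) (M : set A).
Hypothesis HM : abelian_csubalgebra M.
Local Notation T := {ptws M -> R[i]^o}.
Local Notation characters := (@characters R A M).
Local Notation spectrum := (@spectrum R A M).
Local Notation borelT := (g_sigma_algebraType (@open T)).
Local Notation cutoff := (@cutoff R A M).
Implicit Types (m : {finite_measure set borelT -> \bar R}) (K C : set T).

(** Along this filter cutoffs approximate the indicator function of K.
    Smallness on compact sets C off K is enough, since inner regular measures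
    are nearly carried by the union of K and one such C. *)
Definition cutoff_filter K : set_system A := [set P | exists e : R, exists C,
  [/\ 0 < e, compact C, C `<=` characters, K `&` C = set0 &
   forall g, cutoff g -> (forall x, K x -> 1 - e <= Re (ev x g)) ->
     (forall x, C x -> Re (ev x g) <= e) -> P g]].

Lemma cutoff_filter_proper K : spectrum_compact K -> ProperFilter (cutoff_filter K).
Proof.
move=> [cK Ks]; split.
  move=> [e [C [e0 cC Cc KC H]]].
  have [g bg [gK gC]] := urysohn_cutoff HM cK Ks cC Cc KC e0.
  exact: H bg gK gC.
split.
- exists 1, set0; split => //; first exact: compact0.
  by rewrite setI0.
- move=> P Q [e [C [e0 cC Cc KC HP]]] [e' [C' [e'0 cC' Cc' KC' HQ]]].
  exists (Num.min e e'), (C `|` C'); split.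
  + by rewrite lt_min e0.
  + exact: compactU.
  + by move=> x [/Cc|/Cc'].
  + by rewrite setIUr KC KC' setU0.
  + have l1 : Num.min e e' <= e by rewrite ge_min lexx.
    have l2 : Num.min e e' <= e' by rewrite ge_min lexx orbT.
    move=> g bg gK gC; split.
      by apply: HP => // x Kx; [have := gK x Kx; lra|apply: (le_trans (gC x _)); [left|]].
    by apply: HQ => // x Kx; [have := gK x Kx; lra|apply: (le_trans (gC x _)); [right|]].
- move=> P Q PQ [e [C [e0 cC Cc KC HP]]]; exists e, C; split => // g bg gK gC.
  by apply: PQ; exact: HP.
Qed.

Lemma cutoff_filter_cutoff K : cutoff_filter K cutoff.
Proof. by exists 1, set0; split => //; [exact: compact0|rewrite setI0]. Qed.

Lemma cutoff_filter_near_one K (e : R) : 0 < e ->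
  cutoff_filter K [set g | forall x, K x -> 1 - e <= Re (ev x g)].
Proof. by move=> e0; exists e, set0; split => //; [exact: compact0|rewrite setI0]. Qed.

Definition mass m g : R := Rintegral m spectrum (fun x => Re (ev (x : T) g)).

Lemma integrable_mass m g : M g ->
  m.-integrable spectrum (EFin \o (fun x : borelT => Re (ev (x : T) g))).
Proof.
move=> Mg; apply: integrable_evRe => //; first exact: measurable_spectrum.
exact: spectrum_sub.
Qed.

Lemma le_mass m K g (e : R) : spectrum_compact K -> cutoff g ->
  (forall x, K x -> 1 - e <= Re (ev x g)) -> (1 - e) * fine (m K) <= mass m g.
Proof.
move=> [cK Ks] [Mg _ _ bg] gK.
have ms : measurable (spectrum : set borelT) := measurable_spectrum HM.
pose s : seq (R * set borelT) := [:: (1 - e, K)].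
have [|I1 I2] := @Rintegral_simple _ _ _ m spectrum s ms.
  by move=> p; rewrite inE => /eqP ->; exact: (T_measurable_compact cK).
have -> : (1 - e) * fine (m K) = \sum_(p <- s) p.1 * fine (m (p.2 `&` spectrum)).
  by rewrite big_seq1 /=; congr (_ * fine (m _)); apply/esym/setIidl.
rewrite -I2 /mass; apply: le_Rintegral; [exact: ms|exact: I1|exact: integrable_mass|move=> x xs].
rewrite big_seq1 /= indicE; have [Kx|nKx] := boolP (x \in K).
  by rewrite mulr1; apply: gK; rewrite inE in Kx.
by rewrite mulr0; have /andP[] := bg x (spectrum_sub HM xs).
Qed.

Lemma mass_le m K C g (e : R) : spectrum_compact K -> compact C -> cutoff g ->
  0 <= e -> (forall x, C x -> Re (ev x g) <= e) ->
  mass m g <= fine (m K) + e * fine (m (C `&` spectrum)) +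
              fine (m ((spectrum `\` K) `\` C)).
Proof.
move=> [cK Ks] cC [Mg _ _ bg] e0 gC.
have ms : measurable (spectrum : set borelT) := measurable_spectrum HM.
have mK : measurable (K : set borelT) := T_measurable_compact cK.
have mC : measurable (C : set borelT) := T_measurable_compact cC.
pose s : seq (R * set borelT) := [:: (1, K); (e, C); (1, (spectrum `\` K) `\` C)].
have [|I1 I2] := @Rintegral_simple _ _ _ m spectrum s ms.
  move=> p; rewrite !inE => /or3P[] /eqP -> //=.
  by apply: measurableD => //; exact: measurableD.
have -> : fine (m K) + e * fine (m (C `&` spectrum)) + fine (m ((spectrum `\` K) `\` C)) =
    \sum_(p <- s) p.1 * fine (m (p.2 `&` spectrum)).
  rewrite !big_cons big_nil addr0 /= !mul1r addrA; congr (fine (m _) + _ + fine (m _)).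
    exact/esym/setIidl.
  by apply/esym/setIidl => x [[]].
rewrite -I2 /mass; apply: le_Rintegral; [exact: ms|exact: integrable_mass|exact: I1|move=> x xs].
have /andP[g0 g1] := bg x (spectrum_sub HM xs).
rewrite !big_cons big_nil addr0 /= !mul1r !indicE.
have [Kx|nKx] := boolP (x \in K).
  by apply: (le_trans g1); rewrite lerDl addr_ge0// mulr_ge0.
have [Cx|nCx] := boolP (x \in C).
  by rewrite add0r mulr1; apply: (le_trans (gC x _)); [rewrite inE in Cx|rewrite lerDl].
rewrite mulr0 !add0r (_ : (x \in _) = true)//.
by apply: mem_set; split; [split=> //|]; move=> /mem_set; exact/negP.
Qed.

Lemma radon_inner m (E : set borelT) (e : R) : radon m -> measurable E -> 0 < e ->
  exists C, [/\ spectrum_compact C, C `<=` E & fine (m E) <= fine (m C) + e].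
Proof.
move=> rm mE e0.
have fE : m E \is a fin_num by exact: fin_num_measure.
have := rm E mE; set S := image _ _ => mS.
have fS : ereal_sup S \is a fin_num by rewrite -mS.
have [_ [C [cC CE] <-] H] := ub_ereal_sup_adherent e0 fS.
exists C; split => //; apply: ltW.
have fC : m C \is a fin_num by apply: fin_num_measure; case: cC => cC _; exact: (T_measurable_compact cC).
by move: H; rewrite -mS -lte_fin EFinD !fineK// lteBlDr.
Qed.

(** By inner regularity a compact C carries nearly all the mass off K; a
    cutoff in the filter is controlled on K and on C. *)
Lemma mass_cvg m K : radon m -> spectrum_compact K ->
  mass m g @[g --> cutoff_filter K] --> fine (m K).
Proof.
move=> rm sK; have PF := cutoff_filter_proper sK.
have ms : measurable (spectrum : set borelT) := measurable_spectrum HM.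
have mK : measurable (K : set borelT) by case: sK => cK _; exact: (T_measurable_compact cK).
apply/cvgrPdist_lt => e e0.
pose t := fine (m setT); have t0 : 0 <= t by rewrite fine_ge0.
have lt E : measurable E -> fine (m E) <= t.
  by move=> mE; rewrite fine_le ?fin_num_measure// le_measure// inE.
(* The total error will be at most d t + d, where t is the total mass. *)
pose d := e / (t + 2).
have d0 : 0 < d by rewrite divr_gt0// ltr_wpDl.
have dE : d * (t + 2) = e by rewrite divfK// gt_eqF// ltr_wpDl.
have [C [sC CE mC]] := radon_inner rm (measurableD ms mK) d0.
have mC' : measurable (C : set borelT) by case: sC => cC _; exact: (T_measurable_compact cC).
exists d, C; split => //.
- by case: sC.
- by case: sC => _ Cs x /Cs; exact: spectrum_sub.
- by apply/seteqP; split=> // x [Kx /CE[_]]; exact.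
move=> g bg gK gC /=.
have H1 := le_mass m sK bg gK.
have [cC Cs] := sC.
have H2 := mass_le m sK cC bg (ltW d0) gC.
have E1 : fine (m (spectrum `\` K)) - fine (m C) = fine (m ((spectrum `\` K) `\` C)).
  have mD : measurable ((spectrum : set borelT) `\` K) := measurableD ms mK.
  have DC : (spectrum `\` K) `&` C = C by apply/setIidr.
  have Df := fin_num_measure m _ mD; have Cf := fin_num_measure m _ mC'.
  have Dy : (m (spectrum `\` K) < +oo)%E by rewrite ltey_eq Df.
  rewrite (measureD mD mC' Dy); apply/esym; apply: etrans (fineB Df Cf).
  by congr (fine (_ - m _)).
have l1 : fine (m (C `&` spectrum)) <= t by apply: lt; exact: measurableI.
have l2 : fine (m K) <= t by exact: lt.
have l3 : d * fine (m (C `&` spectrum)) <= d * t by rewrite ler_wpM2l// ltW.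
have l4 : d * fine (m K) <= d * t by rewrite ler_wpM2l// ltW.
rewrite distrC ltr_norml; apply/andP; split; lra.
Qed.

Lemma cintegral_sa m g a : M g -> cstar g = g -> val a = g ->
  cintegral m (fun x => x a) = (mass m g)%:C.
Proof.
move=> Mg sg ag; rewrite /cintegral.
rewrite (_ : Rintegral m spectrum (fun x => Im (x a)) = 0); last first.
  rewrite (_ : 0 = Rintegral m spectrum (cst 0)).
    apply: eq_Rintegral => x; rewrite inE => /(spectrum_sub HM) xc.
    by rewrite -(evE x a) ag (ch_real xc Mg sg).
  by rewrite Rintegral_cst ?mul0r//; exact: measurable_spectrum.
congr (_%:C); apply: eq_Rintegral => x _.
by rewrite -(evE x a) ag.
Qed.

Lemma ccvg_sum (J : Type) (F : set_system J) {FF : ProperFilter F} n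
    (f : 'I_n -> J -> R[i]^o) (p : 'I_n -> R[i]^o) :
  (forall k, f k @ F --> p k) ->
  (fun j => \sum_k f k j) @ F --> (\sum_k p k).
Proof.
elim: n f p => [|n IH] f p fp.
  rewrite big_ord0 (_ : (fun j => _) = cst 0); first exact: cvg_cst.
  by apply/funext => j; rewrite big_ord0.
rewrite big_ord_recl (_ : (fun j => _) =
    fun j => f ord0 j + \sum_(k < n) f (lift ord0 k) j); last first.
  by apply/funext => j; rewrite big_ord_recl.
by apply: (ccvgD (fp ord0)); apply: IH => k; exact: fp.
Qed.

Lemma ccvg_real (J : Type) (F : set_system J) {FF : ProperFilter F}
    (f : J -> R) (r : R) : f @ F --> r ->
  (fun j => (f j)%:C : R[i]^o) @ F --> (r%:C : R[i]^o).
Proof. by move=> fr; apply: (ccvg_ReIm fr); exact: cvg_cst. Qed.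

Lemma riesz_cvg mu (phi : {ptws A -> R[i]^o}) K : @riesz_measure R A M mu phi ->
  spectrum_compact K ->
  phi g @[g --> cutoff_filter K] -->
    (\sum_(k < 4) ('i : R[i]) ^+ k * (fine (mu k K))%:C : R[i]^o).
Proof.
move=> [rm Hm] sK; have PF := cutoff_filter_proper sK.
apply: (@ccvg_near _ _ _ _ (fun g => \sum_(k < 4) ('i : R[i]) ^+ k * (mass (mu k) g)%:C)).
  apply: ccvg_sum => k.
  by apply: ccvgZ; apply: ccvg_real; exact: mass_cvg.
apply: filterS (cutoff_filter_cutoff K) => g bg.
have [Mg sg _ _] := bg; have [a ag] := inMP Mg.
by rewrite -[in RHS]ag Hm; apply: eq_bigr => k _; rewrite (cintegral_sa _ Mg sg ag).
Qed.

(** The value of chi K comes from some representing measure, and for each of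
    them the mass of K is this limit. *)
Lemma chi_cvg mu (phi : {ptws A -> R[i]^o}) K : @riesz_measure R A M mu phi ->
  spectrum_compact K -> phi g @[g --> cutoff_filter K] --> chi K phi.
Proof.
move=> rm sK; rewrite /chi; case: xgetP => [z zE [m' rm' ->]|].
  exact: riesz_cvg rm' sK.
move=> /(_ (\sum_(k < 4) ('i : R[i]) ^+ k * (fine (mu k K))%:C)) H.
by case: H; exists mu.
Qed.

Lemma chiE mu (phi : {ptws A -> R[i]^o}) K : @riesz_measure R A M mu phi ->
  spectrum_compact K ->
  chi K phi = \sum_(k < 4) ('i : R[i]) ^+ k * (fine (mu k K))%:C.
Proof.
move=> rm sK; have PF := cutoff_filter_proper sK.
exact: (ccvg_unique (chi_cvg rm sK) (riesz_cvg rm sK)).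
Qed.

End Chi.

(** * Representing measures for matrix coefficients of a state *)

Section Polarization.
Local Open Scope complex_scope.
Variable R : realType.

Lemma conj_i_expr k : conjC ('i ^+ k : R[i]) * 'i ^+ k = 1.
Proof.
rewrite conjCX -exprMn (_ : _ * _ = 1) ?expr1n//.
by apply: complex_eq; rewrite ?cReM ?cImM /=; ring.
Qed.

Lemma sum_i_expr : \sum_(k < 4) ('i : R[i]) ^+ k = 0.
Proof. by rewrite !big_ord_recr big_ord0 /= !exprS expr0; apply: complex_eq => /=; ring. Qed.

Lemma sum_i_expr2 : \sum_(k < 4) ('i : R[i]) ^+ k * 'i ^+ k = 0.
Proof. by rewrite !big_ord_recr big_ord0 /= !exprS expr0; apply: complex_eq => /=; ring. Qed.

(** The sums of i^k and of (i^k)^2 over four k vanish, which leaves only the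
    term B x y. *)
Lemma polarization (V : lmodType R[i]) (B : V -> V -> R[i]) :
  (forall u u' v, B (u + u') v = B u v + B u' v) ->
  (forall u v v', B u (v + v') = B u v + B u v') ->
  (forall z u v, B (z *: u) v = conjC z * B u v) ->
  (forall z u v, B u (z *: v) = z * B u v) ->
  forall x y, B x y = \sum_(k < 4) ('i : R[i]) ^+ k *
    B ((2^-1)%:C *: (y + 'i ^+ k *: x)) ((2^-1)%:C *: (y + 'i ^+ k *: x)).
Proof.
move=> BDl BDr BZl BZr x y.
have E k : ('i : R[i]) ^+ k *
    B ((2^-1)%:C *: (y + 'i ^+ k *: x)) ((2^-1)%:C *: (y + 'i ^+ k *: x)) =
    (4^-1)%:C * ('i ^+ k * B y y + ('i ^+ k * 'i ^+ k) * B y x + B x y + 'i ^+ k * B x x).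
  rewrite BZl BZr BDl !BDr !BZl !BZr conjc_real.
  have := conj_i_expr k; set s := conjC ('i ^+ k); set t := 'i ^+ k; move: s t => s t st.
  have -> : (4^-1)%:C = (2^-1)%:C * (2^-1)%:C :> R[i].
    by rewrite -rmorphM; congr (_%:C); field.
  transitivity ((2^-1)%:C * (2^-1)%:C *
    (t * B y y + t * t * B y x + (s * t) * B x y + (s * t) * t * B x x)); first ring.
  by rewrite st !mul1r.
rewrite (eq_bigr _ (fun (k : 'I_4) _ => E k)) -mulr_sumr !big_split /= -!mulr_suml.
rewrite sum_i_expr sum_i_expr2 !mul0r !add0r addr0 sumr_const card_ord.
rewrite -[B x y *+ 4]mulr_natl mulrA (_ : _ * 4%:R = 1) ?mul1r//.
by rewrite -(rmorph_nat (real_complex R)) -rmorphM mulVf ?pnatr_eq0.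
Qed.

End Polarization.

Section Representability.
Local Open Scope complex_scope.
Variables (R : realType) (A : cstarType R) (M : set A).
Hypothesis HM : abelian_csubalgebra M.
Hypothesis HI : has_approximate_identity M.
Local Notation T := {ptws M -> R[i]^o}.
Local Notation uA := (unitized A).
Local Notation borelT := (g_sigma_algebraType (@open T)).
Local Notation cutoff := (@cutoff R A M).
Implicit Types (m : {finite_measure set borelT -> \bar R}) (K C : set T).

Lemma riesz_of_positive (w : 'I_4 -> uA -> R[i]) (psi : {ptws A -> R[i]^o}) :
  (forall k, positive_ufunctional (w k)) ->
  (forall a, M a -> psi a = \sum_(k < 4) ('i : R[i]) ^+ k * w k (uin a)) ->
  exists mu, @riesz_measure R A M mu psi /\
    (forall k, (mu k setT <= (Re (w k 1))%:E)%E) /\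
    (forall k (a : M), w k (uin (val a)) = cintegral (mu k) (fun x => x a)).
Proof.
move=> pw psiE; have [mu Hmu] := choice (fun k => representing_measure HM (pw k)).
exists mu; split; last by split=> k; have [] := Hmu k.
split=> [k|a]; first by have [] := Hmu k.
have Ma : M (val a) by exact: set_valP.
by rewrite psiE//; apply: eq_bigr => k _; have [_ _ ->] := Hmu k.
Qed.

Section State.
Variable phi : {ptws A -> R[i]^o}.
Hypothesis phi_state : @states R A phi.
Local Notation ue := (@uext R A phi).

(** The limit along U exists because the values are bounded, and it is
    positive because e* (v* v) e = (v e)* (v e). *)
Lemma conjugated_positive (J : Type) (U : set_system J) (e : J -> uA) (c : R) :
  UltraFilter U -> 0 <= c -> (\forall j \near U, unorm1 (e j) <= c) ->
  exists w, positive_ufunctional w /\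
    forall v, (fun j => ue ((ustar (e j) : uA) * v * e j)) @ U --> (w v : R[i]^o).
Proof.
move=> UU c0 He; have PF : ProperFilter U by exact: ultra_proper.
have bd v : \forall j \near U, cabs (ue ((ustar (e j) : uA) * v * e j)) <= c ^+ 2 * unorm1 v.
  apply: filterS He => j ej; apply: (le_trans (uext_le phi_state _)).
  apply: (le_trans (unorm1M _ _)).
  apply: (@le_trans _ _ (unorm1 (e j) * unorm1 v * unorm1 (e j))).
    by rewrite ler_wpM2r ?unorm1_ge0// -[X in _ <= X * _](unorm1_star (e j)) unorm1M.
  have ej0 := unorm1_ge0 (e j); have v0 := unorm1_ge0 v.
  by rewrite mulrAC ler_wpM2r// expr2 ler_pM.
have /choice[w Hw] v : exists p : R[i]^o, cabs p <= c ^+ 2 * unorm1 v /\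
    (fun j => ue ((ustar (e j) : uA) * v * e j)) @ U --> p.
  by have [p p1 p2] := ultra_ccvg UU (bd v); exists p.
exists w; split; last by move=> v; have [] := Hw v.
split.
- move=> v v'; apply: (ccvg_unique (Hw (v + v')).2).
  rewrite (_ : (fun j => _) = (fun j => ue ((ustar (e j) : uA) * v * e j) +
      ue ((ustar (e j) : uA) * v' * e j))); first exact: ccvgD (Hw v).2 (Hw v').2.
  by apply/funext => j; rewrite mulrDr mulrDl (uextD phi_state).
- move=> z v; apply: (ccvg_unique (Hw (z *: v)).2).
  rewrite (_ : (fun j => _) = (fun j => z * ue ((ustar (e j) : uA) * v * e j))).
    exact: ccvgZ (Hw v).2.
  by apply/funext => j; rewrite uscaler uscalel (uextZ phi_state).
- move=> v; apply: (ccvg_ge0 (Hw ((ustar v : uA) * v)).2); apply: filterE => j.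
  have := uext_ge0 HM HI phi_state ((v : uA) * e j).
  by rewrite ustarM !mulrA.
- by exists (c ^+ 2) => [|v]; [exact: sqr_ge0|have [] := Hw v].
Qed.

(** By polarization, phi (x* a y) is a sum of i^k phi (e k* a e k), which is
    the shape of a complex measure given by four positive ones; the shape
    survives in the limit along U. *)
Lemma matrix_coefficient_riesz (J : Type) (U : set_system J) (x y : J -> uA) (c : R)
    (psi : {ptws A -> R[i]^o}) :
  UltraFilter U -> 0 <= c -> (\forall j \near U, unorm1 (x j) <= c /\ unorm1 (y j) <= c) ->
  (forall a, M a -> (fun j => ue ((ustar (x j) : uA) * uin a * y j)) @ U --> psi a) ->
  exists mu, @riesz_measure R A M mu psi.
Proof.
move=> UU c0 Hxy Hpsi; have PF : ProperFilter U by exact: ultra_proper.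
pose e (k : 'I_4) j : uA := (2^-1)%:C *: (y j + 'i ^+ k *: x j).
have ec k : \forall j \near U, unorm1 (e k j) <= c.
  apply: filterS Hxy => j [xj yj].
  rewrite /e unorm1Z cabs_real ger0_norm ?invr_ge0//.
  have := unorm1D (y j) ('i ^+ k *: x j); rewrite unorm1Z.
  have -> : cabs ('i ^+ k : R[i]) = 1.
    by elim: (nat_of_ord k) => [|n IH]; [rewrite expr0 -[1]/(1%:C) cabs_real normr1|rewrite exprS cabsM IH cabs_i mulr1].
  by rewrite mul1r; lra.
have /choice[w Hw] k := conjugated_positive UU c0 (ec k).
have [mu [Hmu _]] : exists mu, @riesz_measure R A M mu psi /\
    (forall k, (mu k setT <= (Re (w k 1))%:E)%E) /\
    (forall k (a : M), w k (uin (val a)) = cintegral (mu k) (fun x => x a)); last by exists mu.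
apply: riesz_of_positive => [k|a Ma]; first by have [] := Hw k.
apply: (ccvg_unique (Hpsi a Ma)).
rewrite (_ : (fun j => _) = (fun j => \sum_(k < 4) ('i : R[i]) ^+ k *
    ue ((ustar (e k j) : uA) * uin a * e k j))).
  by apply: ccvg_sum => k; apply: ccvgZ; have [_] := Hw k; apply.
apply/funext => j.
apply: (@polarization R uA (fun u v => ue ((ustar u : uA) * uin a * v))).
- by move=> u u' v; rewrite ustarD !mulrDl (uextD phi_state).
- by move=> u v v'; rewrite mulrDr (uextD phi_state).
- by move=> z u v; rewrite ustarZ !uscalel (uextZ phi_state).
- by move=> z u v; rewrite uscaler (uextZ phi_state).
Qed.

Section CompactSet.
Variable K : set T.
Hypothesis sK : spectrum_compact K.

Lemma cutoff_rnorm g : cutoff g -> rnorm g <= 1. Proof. by case. Qed.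

Lemma arens_inner_cvg (x : uA) a :
  phi (a ** uact x g) @[g --> cutoff_filter K] -->
  chi K (fun b => phi (a ** uact x b)).
Proof.
have PF := cutoff_filter_proper HM sK.
have [U [UU FU]] := ultraFilterLemma PF.
pose c := unorm1 (uin a * x) + 1.
have c0 : 0 <= c by rewrite addr_ge0 ?unorm1_ge0.
have [mu Hmu] : exists mu, @riesz_measure R A M mu (fun b => phi (a ** uact x b)).
  apply: (@matrix_coefficient_riesz A U (fun=> ustar (uin a * x)) (fun=> 1) c _ UU c0).
    apply: filterE => j; rewrite unorm1_star; split; first by rewrite lerDl.
    by rewrite uone1 /unorm1 /= rnorm0 add0r -[1]/(1%:C) cabs_real normr1 lerDr unorm1_ge0.
  move=> b Mb; rewrite (_ : (fun j => _) = cst (phi (a ** uact x b))); first exact: cvg_cst.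
  by apply/funext => j; rewrite ustarK mulr1 -mulrA -uactE -uinM uext_in.
exact: (chi_cvg HM Hmu sK).
Qed.

(** For fixed a the inner functional is a matrix coefficient of phi; the outer
    one, as a function of a, is a limit of matrix coefficients phi (a (x g))
    by arens_inner_cvg. Both are thus represented by measures. *)
Lemma compress_cvg (x : uA) :
  chi K (fun b => phi (g ** uact x b)) @[g --> cutoff_filter K] --> compress K x phi.
Proof.
have PF := cutoff_filter_proper HM sK.
have [U [UU FU]] := ultraFilterLemma PF.
have PU : ProperFilter U by exact: ultra_proper.
pose c := unorm1 x + 1.
have c0 : 0 <= c by rewrite addr_ge0 ?unorm1_ge0.
have [mu Hmu] : exists mu,
    @riesz_measure R A M mu (fun a => chi K (fun b => phi (a ** uact x b))).
  apply: (@matrix_coefficient_riesz A U (fun=> 1) (fun g => uin (uact x g)) c _ UU c0).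
    have : U cutoff by apply: FU; exact: cutoff_filter_cutoff.
    apply: filterS => g /cutoff_rnorm g1; split.
      by rewrite uone1 /unorm1 /= rnorm0 add0r -[1]/(1%:C) cabs_real normr1 lerDr unorm1_ge0.
    rewrite unorm1_in (le_trans (uact_le _ _))// (@le_trans _ _ (unorm1 x))// ?lerDl//.
    by rewrite ler_piMr// unorm1_ge0.
  move=> a Ma; rewrite (_ : (fun j => _) = (fun g => phi (a ** uact x g))).
    exact: cvg_trans (cvg_app _ FU) (@arens_inner_cvg x a).
  by apply/funext => g; rewrite ustar1 mul1r -uinM uext_in.
exact: (chi_cvg HM Hmu sK).
Qed.

(** A state is itself positive, so the other three positive parts can be taken
    to be 0, and their measures then vanish. *)
Lemma state_mass : exists m, [/\ radon m, fine (m setT) <= 1,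
  forall g, M g -> cstar g = g -> phi g = (mass m g)%:C & chi K phi = (fine (m K))%:C].
Proof.
have pz : positive_ufunctional (fun _ : uA => 0 : R[i]).
  split=> [v v'|z v|v|]; rewrite ?addr0 ?mulr0//.
  by exists 0 => // v; rewrite cabs0 mul0r.
have pu : positive_ufunctional (ue : uA -> R[i]).
  split.
  - exact: uextD.
  - exact: uextZ.
  - exact: (uext_ge0 HM HI phi_state).
  - by exists 1 => // v; rewrite mul1r; exact: uext_le.
pose w (k : 'I_4) : uA -> R[i] := if k == ord0 then ue else (fun=> 0).
have wE (u : 'I_4 -> R[i]) : (forall k, k != ord0 -> u k = 0) ->
    \sum_(k < 4) ('i : R[i]) ^+ k * u k = u ord0.
  move=> u0; rewrite (bigD1 ord0)//= expr0 mul1r big1 ?addr0// => k k0.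
  by rewrite u0// mulr0.
have [mu [Hmu [m1 mE]]] : exists mu, @riesz_measure R A M mu phi /\
    (forall k, (mu k setT <= (Re (w k 1))%:E)%E) /\
    (forall k (a : M), w k (uin (val a)) = cintegral (mu k) (fun x => x a)).
  apply: riesz_of_positive => [k|a Ma]; first by rewrite /w; case: ifP.
  by rewrite wE /w /= ?uext_in// => k /negPf ->.
have [rm _] := Hmu.
exists (mu ord0); split => //.
- have := m1 ord0; rewrite /w /= (uext1 phi_state) => m1'.
  by rewrite -lee_fin fineK// fin_num_measure.
- move=> g Mg sg; have [a ag] := inMP Mg.
  by rewrite -(cintegral_sa HM _ Mg sg ag) -mE /w /= uext_in ag.
rewrite (chiE HM Hmu sK) wE// => k k0.
have := m1 k; rewrite /w (negPf k0) /= => mk0.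
have -> : mu k K = 0%E.
  have mK : measurable (K : set borelT) by case: sK => cK _; exact: (T_measurable_compact cK).
  apply/eqP; rewrite eq_le measure_ge0 andbT; apply: le_trans mk0.
  by apply: le_measure; rewrite ?inE.
by [].
Qed.

End CompactSet.

End State.
End Representability.

(** * Tame sets are tight *)

Section Tightness.
Local Open Scope complex_scope.
Variables (R : realType) (A : cstarType R) (M : set A).
Hypothesis HM : abelian_csubalgebra M.
Hypothesis HI : has_approximate_identity M.
Local Notation T := {ptws M -> R[i]^o}.
Local Notation uA := (unitized A).
Local Notation characters := (@characters R A M).
Local Notation spectrum := (@spectrum R A M).
Local Notation borelT := (g_sigma_algebraType (@open T)).
Local Notation cutoff := (@cutoff R A M).
Local Notation state := (@states R A).
Implicit Types (K C : set T) (phi : {ptws A -> R[i]^o}).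

Lemma spectrum_compact0 : spectrum_compact (set0 : set T).
Proof. by split; [exact: compact0|]. Qed.

Lemma mass_bound (m : {finite_measure set borelT -> \bar R}) h (c : R) :
  M h -> fine (m setT) <= 1 ->
  0 <= c -> (forall x, spectrum x -> Re (ev x h) <= c) -> mass m h <= c.
Proof.
move=> Mh m1 c0 hc; have ms : measurable (spectrum : set borelT) := measurable_spectrum HM.
apply: (@le_trans _ _ (c * fine (m spectrum))).
  rewrite -(Rintegral_cst m ms c) /mass; apply: le_Rintegral => //.
  - exact: integrable_mass.
  - exact: finite_measure_integrable_cst.
rewrite ler_piMr// (le_trans _ m1)// fine_le ?fin_num_measure//.
by apply: le_measure; rewrite ?inE.
Qed.

Lemma state_le_of_spectrum phi h (c : R) : state phi -> M h -> cstar h = h ->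
  0 <= c -> (forall x, spectrum x -> Re (ev x h) <= c) -> Re (phi h) <= c.
Proof.
move=> sp Mh sh c0 hc.
have [m [_ m1 mE _]] := state_mass HM HI sp spectrum_compact0.
by rewrite mE//=; exact: mass_bound.
Qed.

Lemma state_cutoffM_le phi f g : state phi -> cutoff f -> cutoff g ->
  Re (phi (f ** g)) <= Re (phi g).
Proof.
move=> sp cf cg; have [Mfg sfg _ _] := cutoffM HM cf cg; have [Mg sg _ bg] := cg.
have [_ _ _ bf] := cf.
have M0 : M (f ** g - g) by exact: csubB.
have : Re (phi (f ** g - g)) <= 0.
  apply: state_le_of_spectrum => //; first by rewrite cstarB sfg sg.
  move=> x /(spectrum_sub HM) xc.
  have -> : ev x (f ** g - g) = ev x (f ** g) + ev x ((-1) *: g).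
    by rewrite scaleN1r -chD//; rewrite -scaleN1r; exact: csubZ.
  rewrite (chZ _ xc Mg) mulN1r ReD ReN (ch_cutoffM xc cf cg).
  have /andP[f0 f1] := bf x xc; have /andP[g0 g1] := bg x xc.
  by rewrite subr_le0 ler_piMl.
by rewrite (stateB sp) ReD ReN subr_le0.
Qed.

Lemma state_chi_le phi K g (e : R) : state phi -> spectrum_compact K -> cutoff g ->
  (forall x, K x -> 1 - e <= Re (ev x g)) ->
  (1 - e) * Re (chi K phi) <= Re (phi g).
Proof.
move=> sp sK cg gK; have [Mg sg _ _] := cg.
have [m [_ m1 mE ->]] := state_mass HM HI sp sK.
by rewrite mE//=; exact: le_mass.
Qed.

Lemma state_chi_cvg phi K : state phi -> spectrum_compact K ->
  phi g @[g --> cutoff_filter K] --> chi K phi.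
Proof.
move=> sp sK; have PF := cutoff_filter_proper HM sK.
have [m [rm _ mE ->]] := state_mass HM HI sp sK.
apply: (ccvg_near (ccvg_real (mass_cvg HM rm sK))).
by apply: filterS (@cutoff_filter_cutoff _ _ _ K) => g [Mg sg _ _]; rewrite mE.
Qed.

(** On the spectrum the function h (1 - f g) is at most 2 de on K and at most
    ep elsewhere. *)
Lemma near_unit_sandwich phi K f g h (ep de : R) : state phi ->
  cutoff f -> cutoff g -> cutoff h -> 0 <= ep -> 0 <= de -> de <= 1 ->
  (forall x, K x -> 1 - de <= Re (ev x f)) ->
  (forall x, K x -> 1 - de <= Re (ev x g)) ->
  (forall x, spectrum x -> ~ K x -> Re (ev x h) <= ep) ->
  Re (phi h) - ep - 2 * de <= Re (phi (f ** h ** g)).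
Proof.
move=> sp cf cg ch ep0 de0 de1 fK gK hK.
have cfh := cutoffM HM cf ch; have cfhg := cutoffM HM cfh cg.
have [Mh sh _ bh] := ch; have [Mfhg sfhg _ _] := cfhg.
have [_ _ _ bf] := cf; have [_ _ _ bg] := cg.
have M0 : M (h - f ** h ** g) by exact: csubB.
suff : Re (phi (h - f ** h ** g)) <= ep + 2 * de.
  by rewrite (stateB sp) ReD ReN; lra.
apply: state_le_of_spectrum => //.
- by rewrite cstarB sfhg sh.
- by rewrite addr_ge0// mulr_ge0.
move=> x xs; have xc := spectrum_sub HM xs.
have -> : ev x (h - f ** h ** g) = ev x h + ev x ((-1) *: (f ** h ** g)).
  by rewrite -chD//; [rewrite scaleN1r|exact: csubZ].
rewrite (chZ _ xc Mfhg) mulN1r ReD ReN (ch_cutoffM xc cfh cg) (ch_cutoffM xc cf ch).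
have /andP[f0 f1] := bf x xc; have /andP[g0 g1] := bg x xc.
have /andP[h0 h1] := bh x xc.
have [Kx|nKx] := EM (K x); last first.
  have := hK x xs nKx; have : 0 <= Re (ev x f) * Re (ev x h) * Re (ev x g).
    by rewrite !mulr_ge0.
  by lra.
have := fK x Kx; have := gK x Kx; move: h0 h1 f0 f1 g0 g1.
move: (Re (ev x f)) (Re (ev x g)) (Re (ev x h)) => p q u u0 u1 p0 p1 q0 q1 qd pd.
have pq : 1 - 2 * de <= p * q.
  have : (1 - de) * (1 - de) <= p * q by rewrite ler_pM// subr_ge0.
  by have := sqr_ge0 de; rewrite expr2; lra.
have : u * (1 - p * q) <= 2 * de.
  have : u * (1 - p * q) <= 1 * (1 - p * q).
    by rewrite ler_wpM2r// subr_ge0 mulr_ile1.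
  by lra.
by rewrite mulrBr mulr1 mulrCA mulrA; lra.
Qed.

(** The element o - 1 annihilates A, hence its multiplier norm is 0. *)
Lemma uext_unit phi (o : uA) : state phi -> (forall b, uact o b = b) ->
  uext phi o = 1.
Proof.
move=> sp oE.
apply/eqP; rewrite -subr_eq0 -(uext1 sp) -uextN// -uextD//; apply/eqP/cabs_eq0/eqP.
rewrite eq_le cabs_ge0 andbT; apply: (uext_opnorm HM HI sp) => b.
rewrite mul0r (_ : uact _ b = 0) ?rnorm0//.
by apply: uin_inj; rewrite uactE mulrBl mul1r -uactE oE subrr.
Qed.

(** Here o acts as a unit and d is q-close to h. For cutoffs f and g near 1 on
    K, and y = s (d - r o), phi (f y g) is about s (phi h - r phi (f g)) and
    phi y is about s (phi h - r), while phi (f g) <= phi g. In the limit f and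
    g become the indicator function of K. *)
Lemma compress_lower_bound phi K h (d o : uA) (r s q ep de : R) :
  state phi -> spectrum_compact K -> cutoff h ->
  0 <= ep -> 0 < de -> de <= 1 -> 0 <= r -> 0 <= s ->
  (forall b, uact o b = b) ->
  (forall b, rnorm (uact (uin h - d) b) <= q * rnorm b) ->
  (forall x, spectrum x -> ~ K x -> Re (ev x h) <= ep) ->
  s * (r * (1 - Re (chi K phi)) - 2 * q - ep - 2 * de) <=
  Re (compress K (s%:C *: (d - r%:C *: o) : uA) phi)
    - Re (uext phi (s%:C *: (d - r%:C *: o) : uA)).
Proof.
move=> sp sK ch ep0 de0 de1 r0 s0 oE hd hK.
set y : uA := s%:C *: (d - r%:C *: o).
have PF := cutoff_filter_proper HM sK.
have yE b : uact y b = s%:C *: (uact d b - r%:C *: b).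
  apply: uin_inj; rewrite uactE /y uscalel mulrBl uscalel -!uactE oE.
  by rewrite uinZ uinB uinZ.
have o1 := uext_unit sp oE.
have Ey : Re (uext phi y) = s * (Re (uext phi d) - r).
  by rewrite /y (uextZ sp) (uextD sp) (uextN sp) (uextZ sp) o1 mulr1 cReM ReD ReN /= mul0r subr0.
have dh : Re (uext phi d) <= Re (phi h) + q.
  have := uext_opnorm HM HI sp hd; rewrite (uextD sp) (uextN sp) uext_in => H.
  have := le_trans (cabs_Re _) H; rewrite ReD ReN ler_norml => /andP[+ _]; lra.
have q0 : 0 <= q := le_trans (cabs_ge0 _) (uext_opnorm HM HI sp hd).
have key f g : cutoff f -> cutoff g ->
  (forall x, K x -> 1 - de <= Re (ev x f)) ->
  (forall x, K x -> 1 - de <= Re (ev x g)) ->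
  s * (Re (phi h) - ep - 2 * de - q - r * Re (phi g)) <= Re (phi (f ** uact y g)).
  move=> cf cg fK gK.
  rewrite yE cmulZr (stateZ sp) cReM /= mul0r subr0 ler_wpM2l//.
  rewrite cmulBr (stateB sp) cmulZr (stateZ sp) ReD ReN cReM /= mul0r subr0.
  have H1 := near_unit_sandwich sp cf cg ch ep0 (ltW de0) de1 fK gK hK.
  have H2 := state_cutoffM_le sp cf cg.
  have H3 : r * Re (phi (f ** g)) <= r * Re (phi g) by rewrite ler_wpM2l.
  have : Re (phi (f ** h ** g)) - Re (phi (f ** uact d g)) <= q.
    rewrite -ReN -ReD -(stateB sp) -cmulA -cmulBr.
    have -> : h ** g - uact d g = uact (uin h - d) g.
      by apply: uin_inj; rewrite uactE mulrBl uinB uinM uactE.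
    apply: (le_trans (ler_norm _)); apply: (le_trans (cabs_Re _)).
    apply: (le_trans (state_le sp _)); apply: (le_trans (rnormM _ _)).
    have [_ _ f1 _] := cf; have [_ _ g1 _] := cg.
    rewrite -[q]mul1r; apply: ler_pM; rewrite ?rnorm_ge0//.
    by apply: (le_trans (hd g)); rewrite ler_piMr.
  by lra.
have inner f : cutoff f -> (forall x, K x -> 1 - de <= Re (ev x f)) ->
  s * (Re (phi h) - ep - 2 * de - q - r * Re (chi K phi)) <=
  Re (chi K (fun b => phi (f ** uact y b))).
  move=> cf fK.
  have l1 := @arens_inner_cvg _ _ _ HM HI _ sp _ sK y f.
  have l2 : phi g @[g --> cutoff_filter K] --> chi K phi by exact: state_chi_cvg.
  have := ccvg_ge_Re (ccvgD l1 (ccvgZ (s * r)%:C l2)) (c := s * (Re (phi h) - ep - 2 * de - q)).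
  rewrite ReD cReM /= mul0r subr0 => H.
  suff : s * (Re (phi h) - ep - 2 * de - q) <=
    Re (chi K (fun b : A => phi (f ** uact y b))) + s * r * Re (chi K phi) by lra.
  apply: H; apply: filterS (filterI (@cutoff_filter_cutoff _ _ _ K) (cutoff_filter_near_one K de0)) => g [cg gK].
  by have := key f g cf cg fK gK; rewrite ReD cReM /= mul0r subr0; lra.
have outer := compress_cvg HM HI sp sK (x := y).
have : s * (Re (phi h) - ep - 2 * de - q - r * Re (chi K phi)) <= Re (compress K y phi).
  apply: (ccvg_ge_Re outer).
  apply: filterS (filterI (@cutoff_filter_cutoff _ _ _ K) (cutoff_filter_near_one K de0)) => f [cf fK].
  exact: inner.
rewrite Ey.
have : s * (Re (phi h) - ep - 2 * de - q) - s * Re (uext phi d) >= s * (- 2 * q - ep - 2 * de).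
  by rewrite -mulrBr ler_wpM2l//; lra.
by lra.
Qed.

Lemma unorm_opnorm (x : uA) b : rnorm (uact x b) <= unorm x * rnorm b.
Proof.
have hs : has_sup [set rnorm (uact x b) | b in [set b | rnorm b <= 1]].
  split; first by exists (rnorm (uact x 0)), 0 => //=; rewrite rnorm0.
  exists (unorm1 x) => _ [c c1 <-]; apply: (le_trans (uact_le _ _)).
  by rewrite ler_piMr ?unorm1_ge0.
have [->|b0] := eqVneq b 0.
  by rewrite (_ : uact x 0 = 0) ?rnorm0 ?mulr0//; apply: uin_inj; rewrite uactE mulr0.
have nb : 0 < rnorm b.
  rewrite lt_neqAle rnorm_ge0 andbT eq_sym; apply: contra b0 => /eqP H.
  by apply/eqP; exact: rnorm_eq0.
pose c := (rnorm b)^-1%:C *: b.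
have c1 : rnorm c <= 1.
  by rewrite rnormZ cabs_real ger0_norm ?invr_ge0 ?rnorm_ge0// mulVf// gt_eqF.
have : rnorm (uact x c) <= unorm x by apply: sup_upper_bound hs _ _; exists c.
have -> : uact x c = (rnorm b)^-1%:C *: uact x b.
  by apply: uin_inj; rewrite uactE /c uinZ uscaler -uactE uinZ.
by rewrite rnormZ cabs_real ger0_norm ?invr_ge0 ?rnorm_ge0// mulrC ler_pdivrMr.
Qed.

Lemma uact_uone b : uact (@uone R A) b = b.
Proof.
rewrite /uone; case: asboolP => [uA1|_]; rewrite /uact /=.
  rewrite scale0r addr0; have [e He] := uA1.
  by have /(_ b)[] := @xgetI _ 0 (@is_unit R A) e He.
by rewrite cmul0l scale1r add0r.
Qed.

(** As ep > 0, the level set stays away from the zero functional. *)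
Lemma compact_level h (ep : R) : M h -> 0 < ep ->
  spectrum_compact (characters `&` [set x : T | ep <= Re (ev x h)]).
Proof.
move=> Mh ep0; split.
  by apply: compact_closedI; [exact: compact_characters|exact: closed_evRe].
rewrite (spectrumE HM) => x [xc /= xe]; split => // xz.
by move: xe; rewrite xz /ev; case: pselect => [?|_] /=; rewrite leNgt ep0.
Qed.

Lemma cutoff_on K (e : R) : spectrum_compact K -> 0 < e ->
  exists2 g, cutoff g & forall x, K x -> 1 - e <= Re (ev x g).
Proof.
move=> [cK Ks] e0.
have [g cg [gK _]] :=
  urysohn_cutoff HM cK Ks (@compact0 T) (@sub0set _ _) (setI0 K) e0.
by exists g.
Qed.

Lemma tame_bound D L (S : set {ptws A -> R[i]^o}) (mu : {ptws A -> R[i]^o}) (e : R) :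
  ereal_sup ([set 0%E] `|`
    [set (complex.Re `|uext p.2 p.1 - compress K p.1 p.2|)%:E
       | p in lip_ball D L mu `*` S])
    @[K --> @compacts R A M] --> (0 : \bar R)%E -> 0 < e ->
  exists2 Q : set T, spectrum_compact Q & forall K, spectrum_compact K -> Q `<=` K ->
    forall x phi, lip_ball D L mu x -> S phi ->
      Re (compress K x phi) - Re (uext phi x) <= e.
Proof.
move=> H e0.
have /H[Q sQ HQ] : nbhs (0 : \bar R)%E [set y : \bar R | (y < e%:E)%E].
  change (nbhs (0 : R) [set r : R | (r%:E < e%:E)%E]).
  apply/nbhs_ballP; exists e => //= r; rewrite -ball_normE /= sub0r normrN lte_fin.
  exact: le_lt_trans (ler_norm _).
exists Q => // K sK QK x phi Lx Sphi; have /= := HQ K sK QK.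
move=> /ltW /(le_trans _) H1; rewrite -lee_fin; apply: H1.
apply: (@le_trans _ _ (complex.Re `|uext phi x - compress K x phi|)%:E).
  rewrite lee_fin -ReN -ReD -[Re `|_|]/(cabs _) -[cabs (_ - _)]cabsN opprB.
  by apply: le_trans (ler_norm _) (cabs_Re _).
by apply: ereal_sup_ubound; right; exists (x, phi).
Qed.

(** The element d - mu(d) 1, with d close to a cutoff h such that mu h >= 1/2,
    is in the Lipschitz ball up to the scale s. Once K contains the level set
    of h at et, compress_lower_bound bounds mu(d) (1 - phi (chi_K)) by a
    quantity that tameness makes small. *)
Lemma tame_tight D L (S : set {ptws A -> R[i]^o}) :
  lipschitz_pair D L -> S `<=` state -> tame D L M S -> tight M S.
Proof.
move=> HL Sst [mu [smu [K0 sK0 muK0]] Hlim] e e0.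
have [h ch hK0] := cutoff_on sK0 (ltac:(by lra) : 0 < 2^-1 :> R).
have [Mh sh h1 bh] := ch.
have t2 : 2^-1 <= Re (mu h).
  by have := state_chi_le smu sK0 ch hK0; rewrite muK0 /=; lra.
(* The final estimate is 1 - phi (chi_K) <= 20 et. *)
pose et := Num.min (4^-1) (e / 40).
have et0 : 0 < et by rewrite lt_min divr_gt0// andbT invr_gt0.
have et4 : et <= 4^-1 by rewrite ge_min lexx.
have ete : 40 * et <= e.
  have : et <= e / 40 by rewrite ge_min lexx orbT.
  by rewrite ler_pdivlMr//; lra.
have uh : usa (uin h : A * R[i]^o) by split => //; rewrite ustar_in sh.
have [d Dd dn] := lip_dense HL uh et0.
have hd b : rnorm (uact (uin h - d : uA) b) <= et * rnorm b.
  apply: (le_trans (unorm_opnorm _ _)); apply: ler_wpM2r; first exact: rnorm_ge0.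
  exact: ltW.
pose r := Re (uext mu d).
have dsa : ustar d = d by have [] := lip_dom HL Dd.
have mud : uext mu d = r%:C.
  have := uext_hermitian HM HI smu d; rewrite dsa => E.
  have := congr1 (@complex.Im R) E; rewrite Im_conjc => E2.
  by apply: complex_eq => //=; lra.
have r4 : 4^-1 <= r.
  have := uext_opnorm HM HI smu hd; rewrite (uextD smu) (uextN smu) uext_in => H.
  have := le_trans (cabs_Re _) H; rewrite ReD ReN ler_norml -/r => /andP[_]; lra.
pose o := @uone R A.
have Do z : D (z%:C *: o).
  have : [set z%:C *: o | z in [set: R]] (z%:C *: o) by exists z.
  by rewrite -(lip_ker HL) => -[].
pose y : A * R[i]^o := d - r%:C *: o.
have Dy : D y.
  rewrite /y -scaleNr -rmorphN; apply: (lip_domD HL) => //; exact: Do.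
pose s := (L y + 1)^-1.
have Ly := lip_ge0 HL Dy.
have s0 : 0 < s by rewrite invr_gt0 ltr_wpDl.
have o1 : uext mu o = 1 by apply: uext_unit => //; exact: uact_uone.
have Lx : lip_ball D L mu (s%:C *: y).
  split; first exact: (lip_domZ HL).
    rewrite (lipZ HL)// gtr0_norm// /s mulrC ler_pdivrMr ?ltr_wpDl// mul1r lerDl//.
  rewrite (uextZ smu) (uextD smu) (uextN smu) (uextZ smu) mud o1 mulr1 subrr mulr0//.
have [Q sQ HQ] := tame_bound Hlim (mulr_gt0 s0 et0).
have [sK1 Ks1] := compact_level Mh et0.
exists (Q `|` (characters `&` [set x : T | et <= Re (ev x h)])).
  split; first by apply: compactU => //; case: sQ.
  by move=> x [|]; [case: sQ => _; exact|exact: Ks1].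
move=> K sK QK.
apply: (@le_lt_trans _ _ (e / 2)%:E); last by rewrite lte_fin; lra.
apply: ge_ereal_sup => _ [phi Sphi <-]; rewrite lee_fin ReD ReN /=.
have sp := Sst _ Sphi.
have B1 := HQ K sK (fun x Qx => QK x (or_introl Qx)) _ _ Lx Sphi.
have hK x : spectrum x -> ~ K x -> Re (ev x h) <= et.
  move=> xs nKx; rewrite leNgt; apply/negP => xh; apply: nKx; apply: QK; right.
  by split; [exact: spectrum_sub|exact: ltW].
have r0 : 0 <= r by lra.
have et2 : 0 < et / 2 by rewrite divr_gt0.
have etle : et / 2 <= 1 by lra.
have B2 := compress_lower_bound sp sK ch (ltW et0) et2 etle r0 (ltW s0) uact_uone hd hK.
have := le_trans B2 B1; rewrite ler_pM2l// => B3.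
set c := 1 - Re (chi K phi) in B3 *.
have : r * c <= 5 * et by lra.
have [c0|c0] := leP c 0; first by lra.
have : 4^-1 * c <= r * c by rewrite ler_wpM2r// ltW.
by lra.
Qed.

End Tightness.

(** * The weak* closure of a tight set *)

Section Closure.
Local Open Scope complex_scope.
Variables (R : realType) (A : cstarType R).
Local Notation state := (@states R A).
Local Notation V := {ptws A -> R[i]^o}.
Implicit Types (S : set V) (phi psi : V).

(** The properties of states that pass to pointwise limits. *)
Record contractive_positive phi : Prop := {
  cp_lin : scalar phi ;
  cp_le : forall a, cabs (phi a) <= rnorm a ;
  cp_pos : forall a, 0 <= (phi (cstar a ** a) : R[i]) }.

Lemma contractive_positive_dual phi : contractive_positive phi -> dual phi.
Proof.
move=> cp; have lin := cp_lin cp; split => // a.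
apply/cvgrPdist_lt => e e0.
have sub b : phi a - phi b = phi (a - b).
  have : phi (-1 *: b + a) = -1 * (phi b : R[i]) + phi a := lin _ _ _.
  by rewrite scaleN1r mulN1r [- b + a]addrC => ->; rewrite addrC.
have /cvgrPdist_lt /(_ e e0) : (fun b : A => b) @ nbhs a --> a by exact: cvg_id.
apply: filterS => b; apply: le_lt_trans.
by rewrite sub cabsE rnormE lecR; exact: cp_le.
Qed.

Lemma state_contractive_positive phi : state phi -> contractive_positive phi.
Proof.
move=> sp; split.
- exact: state_lin.
- exact: state_le.
- exact: state_pos.
Qed.

Lemma contractive_positive_limit (F : set_system V) psi : ProperFilter F ->
  (\forall phi \near F, contractive_positive phi) ->
  (forall a, (fun phi : V => phi a) @ F --> psi a) -> contractive_positive psi.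
Proof.
move=> PF HF Hpsi; split.
- move=> z a b; apply: (ccvg_unique (Hpsi _)).
  apply: ccvg_near (ccvgD (ccvgZ z (Hpsi a)) (Hpsi b)) _.
  by apply: filterS HF => phi cp; rewrite (cp_lin cp).
- move=> a; apply: (ccvg_le (Hpsi a)); apply: filterS HF => phi cp.
  exact: cp_le.
- move=> a; apply: (ccvg_ge0 (Hpsi _)); apply: filterS HF => phi cp.
  exact: cp_pos.
Qed.

Lemma closure_pointwise S psi : closure S psi ->
  exists F : set_system V, [/\ ProperFilter F, F S &
    forall a, (fun phi : V => phi a) @ F --> psi a].
Proof.
rewrite closureEcvg => -[F PF [Fpsi FS]]; exists F; split => //.
  by apply: FS => phi.
by move=> a; move/pointwise_cvgP: Fpsi; apply.
Qed.

Lemma closure_contractive_positive S psi : S `<=` state -> closure S psi ->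
  contractive_positive psi.
Proof.
move=> Sst /closure_pointwise[F [PF FS Fpsi]].
apply: (contractive_positive_limit PF _ Fpsi).
by apply: filterS FS => phi /Sst; exact: state_contractive_positive.
Qed.

(** As for the Banach-Alaoglu theorem: an ultrafilter of contractions
    converges at every point, and the limit is a contraction. *)
Lemma compact_wstar_closure S : S `<=` state -> compact (wstar_closure S).
Proof.
move=> Sst; rewrite compact_ultra => U UU HU.
have PU : ProperFilter U by exact: ultra_proper.
have Ucp : U contractive_positive.
  by apply: filterS HU => phi [_]; exact: closure_contractive_positive.
have /choice[psi psiE] a : exists p : R[i]^o, (fun phi : V => phi a) @ U --> p.
  have [|p _ Hp] := @ultra_ccvg _ _ _ (fun phi : V => phi a) (rnorm a) UU; last by exists p.
  by apply: filterS Ucp => phi /cp_le.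
have Upsi : U --> (psi : V) by apply/pointwise_cvgP.
exists psi; split => //; split.
  apply: contractive_positive_dual.
  exact: (contractive_positive_limit PU Ucp psiE).
rewrite ((closure_id (closure S)).1 (@closed_closure _ S)) closureEcvg.
exists U => //; split => // P SP.
by apply: filterS HU => phi [_ /SP].
Qed.

Variable M : set A.
Hypothesis HM : abelian_csubalgebra M.
Hypothesis HI : has_approximate_identity M.

(** Only the norm could drop in a limit. By tightness there is one cutoff g
    with phi g >= 1 - e for all phi in S, and this bound passes to the
    closure. *)
Lemma tight_closure_states S : S `<=` state -> tight M S ->
  wstar_closure S `<=` state.
Proof.
move=> Sst HT psi [dpsi cpsi].
have cp := closure_contractive_positive Sst cpsi.
have [F [PF FS Fpsi]] := closure_pointwise cpsi.
split => //; first exact: cp_pos.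
have le1 : ubound [set complex.Re `|psi a| | a in [set a | rnorm a <= 1]] 1.
  by move=> _ [a a1 <-]; apply: (le_trans (cp_le cp a)).
apply/eqP; rewrite eq_le; apply/andP; split.
  apply: ge_sup => //; exists (complex.Re `|psi 0|), 0 => //=.
  by rewrite rnorm0.
apply/ler_addgt0Pr => e e0.
have e2 : 0 < e / 2 by rewrite divr_gt0.
have [K sK HK] := HT _ e2.
have [g cg gK] := cutoff_on HM sK e2.
have sup_ge : Re (psi g) <= dual_norm psi.
  have [_ _ g1 _] := cg.
  apply: (@le_trans _ _ (cabs (psi g))); first exact: le_trans (ler_norm _) (cabs_Re _).
  by apply: ub_le_sup; [exists 1|exists g].
suff : 1 - e <= Re (psi g) by lra.
apply: (ccvg_ge_Re (Fpsi g)); apply: filterS FS => phi Sphi.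
have := state_chi_le HM HI (Sst _ Sphi) sK cg gK.
have [m [_ m1 _ E]] := state_mass HM HI (Sst _ Sphi) sK.
have : Re (1 - chi K phi) < e / 2.
  rewrite -lte_fin; apply: le_lt_trans (HK K sK (@subset_refl _ _)).
  by apply: ereal_sup_ubound; exists phi.
rewrite E ReD ReN /=; set p := fine _ => H1.
have p0 : 0 <= p by rewrite fine_ge0.
have p1 : p <= 1.
  apply: le_trans m1; rewrite fine_le ?fin_num_measure//; first exact: T_measurable_compact sK.1.
  by apply: le_measure; rewrite ?inE//; exact: T_measurable_compact sK.1.
have : e / 2 * p <= e / 2 by rewrite ler_piMr// ltW.
by lra.
Qed.

End Closure.

Theorem theorem2p30 (R : realType) (A : cstarType R)
    (D : set (A * R[i]^o)%type) (L : A * R[i]^o -> R) (M : set A)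
    (S : set {ptws A -> R[i]^o}) :
  lipschitz_triple D L M -> S `<=` @states R A -> tame D L M S ->
  tight M S /\
  (compact (wstar_closure S) /\ wstar_closure S `<=` @states R A).
Proof.
move=> [HL [HM HI]] Sst Stame.
have HT := tame_tight HM HI HL Sst Stame.
split => //; split; first exact: compact_wstar_closure.
exact: tight_closure_states HM HI _ Sst HT.
Qed.
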